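(* Let $X=\{X(t)\}_{t\in\mathbb{R}^N}$ be a real-valued centered Gaussian random field with continuous sample functions, let $I\subset\mathbb{R}^N$ be a compact $N$-dimensional interval and fix $t_0\in I$. Suppose $(\mathbb{E}[(X(t)-X(s))^2])^{1/2}\asymp\varphi(|t-s|)$ for all $t,s\in I$, where $\varphi:[0,\infty)\to[0,\infty)$ is non-decreasing, continuous and regularly varying at $0$ of index $\theta\in[0,1]$ with $$\int_0^1\frac{\varphi(hr)\,dr}{r\sqrt{\log(2/r)}}\lesssim\varphi(h)\sqrt{\log\log(1/h)}=o(1)\quad\text{as }h\to0^+.$$ Suppose there are $n_0\in\mathbb{N}$, $a>1$ and a sequence $(t_n)_{n=n_0}^\infty$ in $I$ with $|t_n-t_0|=a^{-n}$, and there exists $C_0>0$ such that $$\mathrm{Var}(X(t_n)-X(t_0)\mid X(t_m)-X(t_0))\ge C_0\,\mathrm{Var}(X(t_n)-X(t_0))$$ for all $m>n\ge n_0$. Then there is a non-random number $K_2$ with $0<K_2<\infty$, possibly depending on $t_0$, such that $$\lim_{h\to0^+}\ \sup_{t\in I:\,0<|t-t_0|\le h}\frac{|X(t)-X(t_0)|}{\varphi(|t-t_0|)\sqrt{\log\log(1/|t-t_0|)}}=K_2\quad\text{a.s.}$$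
   Context: $|\cdot|$ is the Euclidean norm; $\mathbb{N}=\{1,2,\dots\}$. $f\lesssim g$ means there is a constant $C\in(0,\infty)$ with $f\le Cg$ throughout the indicated range (for statements ''as $h\to0^+$'': for all sufficiently small $h>0$); $f\asymp g$ means $f\lesssim g$ and $g\lesssim f$. A function $\varphi$ is regularly varying at $0$ of index $\theta$ if $\lim_{r\to0^+}\varphi(\lambda r)/\varphi(r)=\lambda^\theta$ for all $\lambda>0$. $\mathrm{Var}(Y\mid Z)$ is the conditional variance of $Y$ given $Z$, a non-random number for jointly Gaussian variables. The field $X$ is defined on a complete probability space. *)

(* Defs.v *)
From HB Require Import structures.
From mathcomp Require Import all_boot all_order all_algebra.
From mathcomp Require Import all_classical all_reals all_analysis.

Set Implicit Arguments.
Unset Strict Implicit.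
Unset Printing Implicit Defensive.

Import Order.TTheory GRing.Theory Num.Theory.
Import numFieldNormedType.Exports.

Local Open Scope classical_set_scope.
Local Open Scope ring_scope.

(* The norm [`| x |] that the library puts on ['rV[R]_N] is the sup norm. *)
Definition enorm (R : realType) (N : nat) (x : 'rV[R]_N) : R :=
  Num.sqrt (\sum_(i < N) x ord0 i ^+ 2).

Definition box (R : realType) (N : nat) (lo hi : 'rV[R]_N) : set 'rV[R]_N :=
  [set t | forall i, lo ord0 i <= t ord0 i <= hi ord0 i].

(* The range of validity is the filter F: [globally A] for "throughout A",
   [0^'+] for "for all sufficiently small h > 0". *)
Definition lesssim (R : realType) (U : Type) (F : set_system U)
    (f g : U -> \bar R) : Prop :=
  exists2 C : R, 0 < C & \forall x \near F, (f x <= C%:E * g x)%E.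

Definition asymp (R : realType) (U : Type) (F : set_system U)
    (f g : U -> \bar R) : Prop :=
  lesssim F f g /\ lesssim F g f.

(* Since [x / 0 = 0], the case [lam = 1] forces [phi r != 0] for all small
   [r > 0]. *)
Definition regularly_varying_at0 (R : realType) (phi : R -> R) (theta : R) :
    Prop :=
  forall lam : R, 0 < lam -> phi (lam * r) / phi r @[r --> 0^'+] --> lam `^ theta.

(* [normal_prob m 0] is not the point mass at m, so the degenerate law is
   treated separately. *)
Definition gaussian_law (R : realType) (m s : R) (A : set R) : \bar R :=
  if s == 0 then \d_m A else normal_prob m s A.

Definition is_gaussian (d : measure_display) (T : measurableType d)
    (R : realType) (P : probability T R) (Y : T -> R) : Prop :=
  measurable_fun [set: T] Y /\
  exists m s : R, forall A : set R, measurable A ->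
    P (Y @^-1` A) = gaussian_law m s A.

Definition gaussian_field (d : measure_display) (T : measurableType d)
    (R : realType) (P : probability T R) (I : Type) (X : I -> {RV P >-> R}) :
    Prop :=
  forall (k : nat) (t : 'I_k -> I) (c : 'I_k -> R),
    is_gaussian P (fun w => \sum_(i < k) c i * X (t i) w).

Arguments gaussian_field {d T R} P {I} X.

Definition centered_field (d : measure_display) (T : measurableType d)
    (R : realType) (P : probability T R) (I : Type) (X : I -> {RV P >-> R}) :
    Prop :=
  forall t : I, ('E_P[X t] = 0)%E.

Arguments centered_field {d T R} P {I} X.

Definition sigma_of (d : measure_display) (T : measurableType d)
    (R : realType) (Z : T -> R) : set_system T :=
  preimage_set_system [set: T] Z measurable.

(* [cond_expectation P Y Z W]: W is a version of E(Y | Z). *)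
Definition cond_expectation (d : measure_display) (T : measurableType d)
    (R : realType) (P : probability T R) (Y Z W : T -> R) : Prop :=
  [/\ P.-integrable [set: T] (EFin \o Y),
      P.-integrable [set: T] (EFin \o W),
      forall B : set R, measurable B -> sigma_of Z (W @^-1` B) &
      forall A : set T, sigma_of Z A ->
        (\int[P]_(w in A) (W w)%:E = \int[P]_(w in A) (Y w)%:E)%E].

(* [cond_variance P Y Z V]: V is a version of
   Var(Y | Z) = E((Y - E(Y | Z))^2 | Z). *)
Definition cond_variance (d : measure_display) (T : measurableType d)
    (R : realType) (P : probability T R) (Y Z V : T -> R) : Prop :=
  exists2 W : T -> R, cond_expectation P Y Z W &
    cond_expectation P (fun w => (Y w - W w) ^+ 2) Z V.

(* Main.v *)
From HB Require Import structures.
From mathcomp Require Import all_boot all_order all_algebra.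
From mathcomp Require Import all_classical all_reals all_analysis.
From mathcomp Require Import measurable_realfun.
From mathcomp Require Import zify ring lra.
Require Import Defs.

Set Implicit Arguments.
Unset Strict Implicit.
Unset Printing Implicit Defensive.

Import Order.TTheory GRing.Theory Num.Theory.
Import numFieldNormedType.Exports.

Local Open Scope classical_set_scope.
Local Open Scope ring_scope.

(**
The limit in the statement exists for each sample point, because the
supremum over 0 < |t - t0| <= h decreases with h; what has to be shown is that
it is almost surely constant, finite and positive.

Constancy is a zero-one law. Put Z_t = (X t - X t0) / psi(|t - t0|), where psi(r)
is phi(r) sqrt(log log (1/r)). By continuity of the paths t may be restricted to
a countable dense set of points. The variance of Z_t tends to 0 as t tends to
t0. Hence, for a fixed variable G of the Gaussian space L spanned by X,
replacing every Z_t by its component orthogonal to G changes it by a_t G with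
a_t tending to 0, and does not change the event that limsup |Z_t| <= q. This
event is therefore independent of every G in L, hence of the sigma-algebra
generated by L, hence of itself ([gaussian_limsup_zero_one]). All independence
statements are obtained from characteristic functions: uncorrelated f and g in L
satisfy E cos(f + a) cos(g + b) = E cos(f + a) E cos(g + b), and an integrable W
with E W cos(f + b) = 0 for all f in a linear space has mean zero on every event
generated by that space ([annihilates_sigma]). The constant K2 is the infimum of
the q for which the event has probability one.

Finiteness of K2 is a chaining argument. By the zero-one law it suffices that
some bound holds with positive probability. For t with |t - t0| about 2^-n the
increment X t - X t0 is split along projections of t on grids of mesh
2^-(n + 2^j), with j0 <= j and 2^j0 of the order of log n. At the scale j there
are exp(O(2^j)) relevant pairs of points, including the choice of n < 2^(2^j),
so the Gaussian tail at level const * sqrt(2^j) makes the j-th exceptional event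
so small that the union over j has probability at most 1/3 ([probability_bad]).
Off this event the increment is at most a constant times
sqrt(2^j0) phi(2^-n) + sum_j sqrt(2^j) phi(2^-n 2^-(2^j)) ([chain_bound]). The
first term is of the order of phi(2^-n) sqrt(log n), and the sum is dominated by
the entropy integral of the hypothesis ([dyadic_condensation]). Regular
variation makes phi doubling, so 2^-n can be replaced by |t - t0|.

Positivity of K2 uses the points t_n. The hypothesis on conditional variances
says that the squared correlation of X(t_n) - X t0 and X(t_m) - X t0 is at most
1 - C0 ([cond_variance_correlation]). For m standardized Gaussian variables whose
correlations are bounded by rho < 1, the probability that all of them stay below
a small multiple of sqrt(log m) is small ([gaussian_sudakov]): if they do, then
by independence of each variable from the residuals of the others any one of
them could be moved to the level l and would then be the strict maximum, and the
m events so obtained are disjoint. Since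
log log (1/|t_n - t0|) is of the order of log n, the event that limsup |Z_t| is
below a small constant is null ([limsup_event_null]).
*)

(** * Integration over a probability space *)

Lemma Rdominated_convergence d (T : measurableType d) (R : realType)
    (mu : {measure set T -> \bar R}) (f_ : nat -> T -> R) (f g : T -> R) :
  (forall n, measurable_fun [set: T] (f_ n)) ->
  (forall x, f_ n x @[n --> \oo] --> f x) ->
  (forall n x, `|f_ n x| <= g x) ->
  mu.-integrable [set: T] (EFin \o g) ->
  mu.-integrable [set: T] (EFin \o f) /\
  \int[mu]_x f_ n x @[n --> \oo] --> \int[mu]_x f x.
Proof.
move=> mf_ f_f f_g ig.
have mf : measurable_fun [set: T] f.
  by apply: (measurable_fun_cvg (h := f_)) => // x _; exact: f_f.
have [fi _ fc] : [/\ mu.-integrable [set: T] (EFin \o f),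
    (\int[mu]_x `|(f_ n x)%:E - (f x)%:E|)%E @[n --> \oo] --> 0%E &
    (\int[mu]_x (f_ n x)%:E)%E @[n --> \oo] --> (\int[mu]_x (f x)%:E)%E].
  apply: (@dominated_convergence _ _ _ mu _ measurableT (fun n => EFin \o f_ n)
    (EFin \o f) (EFin \o g)) => //.
  - by move=> n; exact/measurable_EFinP.
  - exact/measurable_EFinP.
  - by apply: aeW => x _; apply: cvg_EFin; [exact: nearW|exact: f_f].
  - by apply: aeW => x n _; rewrite lee_fin.
split => //.
have fin : (\int[mu]_x (f x)%:E)%E \is a fin_num by exact: integrable_fin_num.
by apply/fine_cvg; rewrite fineK.
Qed.

Lemma Rintegral_probability_cst d (T : measurableType d) (R : realType)
    (P : probability T R) (r : R) : \int[P]_x r = r.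
Proof. by rewrite Rintegral_cst//= probability_setT mulr1. Qed.

Lemma probability_integrable_bounded d (T : measurableType d) (R : realType)
    (P : probability T R) (f : T -> R) (M : R) :
  measurable_fun [set: T] f -> (forall x, `|f x| <= M) ->
  P.-integrable [set: T] (EFin \o f).
Proof.
move=> mf fM; apply: measurable_bounded_integrable => //.
  by rewrite /= probability_setT ltry.
exists M; split; first exact: num_real.
by move=> x Mx y _; apply: (le_trans (fM y)); exact: ltW.
Qed.

(** * The normal law *)

Section normal_integral.
Variables (R : realType) (m s : R).
Hypothesis s0 : s != 0.
Local Notation mu := (@lebesgue_measure R).
Local Notation nu := (normal_prob m s).
Local Notation p := (normal_pdf m s).

Lemma ge0_integral_normal_prob (f : R -> \bar R) :
  measurable_fun [set: R] f -> (forall x, 0 <= f x)%E ->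
  (\int[nu]_x f x = \int[mu]_x (f x * (p x)%:E))%E.
Proof.
move=> mf f0.
have dom := normal_prob_dominates m s.
have fi := @Radon_Nikodym_SigmaFinite.f_integrable _ _ _ nu mu dom.
rewrite -(@Radon_Nikodym_SigmaFinite.change_of_variables _ _ _ nu mu dom f setT)//.
apply: ae_eq_integral => //.
- apply: emeasurable_funM => //; exact: measurable_int fi.
- apply: emeasurable_funM => //; apply/measurable_EFinP; exact: measurable_normal_pdf.
- apply: ae_eqe_mul2l; apply: integral_ae_eq => //.
  + by apply/measurable_EFinP; exact: measurable_normal_pdf.
  + move=> E _ mE; rewrite -Radon_Nikodym_SigmaFinite.f_integral//.
Qed.

Lemma integrable_normal_prob (f : R -> \bar R) :
  nu.-integrable setT f -> mu.-integrable setT (fun x => f x * (p x)%:E)%E.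
Proof.
move=> /integrableP[mf fi]; apply/integrableP; split.
  by apply: emeasurable_funM => //; apply/measurable_EFinP; exact: measurable_normal_pdf.
apply: le_lt_trans fi; rewrite ge0_integral_normal_prob//; last exact: measurableT_comp.
rewrite le_eqVlt; apply/orP; left; apply/eqP; apply: eq_integral => x _.
by rewrite abseM; congr (_ * _)%E; rewrite gee0_abs// lee_fin normal_pdf_ge0.
Qed.

Lemma integral_normal_prob (f : R -> \bar R) : nu.-integrable setT f ->
  (\int[nu]_x f x = \int[mu]_x (f x * (p x)%:E))%E.
Proof.
move=> fi; have mf : measurable_fun [set: R] f by case/integrableP: fi.
have p0 x : (0 <= (p x)%:E)%E by rewrite lee_fin normal_pdf_ge0.
rewrite integralE [RHS]integralE ge0_integral_normal_prob//; last first.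
  exact: measurable_funepos.
rewrite ge0_integral_normal_prob//; last first.
  exact: measurable_funeneg.
congr (_ - _)%E; apply: eq_integral => x _ /=.
by rewrite !funeposE maxeMl// mul0e.
by rewrite !funenegE maxeMl// mul0e mulNe.
Qed.

(** Multiplying by this exponential only halves the exponent of the density, that
is, doubles the variance. This gives both a dominating function for every
integrand of moderate growth and the Gaussian tail bound. *)
Lemma expR_sqr_normal_pdf x :
  expR ((x - m) ^+ 2 / (s ^+ 2 *+ 4)) * p x =
  Num.sqrt 2 * normal_pdf m (Num.sqrt 2 * s) x.
Proof.
have s2 : Num.sqrt 2 * s != 0 :> R by rewrite mulf_neq0// gt_eqF// sqrtr_gt0.
have q0 : Num.sqrt 2 != 0 :> R by rewrite gt_eqF// sqrtr_gt0.
rewrite !normal_pdfE// /normal_fun /normal_peak.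
have e2 : (Num.sqrt 2 * s) ^+ 2 = s ^+ 2 *+ 2.
  by rewrite exprMn sqr_sqrtr// mulr_natl.
rewrite e2 mulrCA -expRD.
have -> : s ^+ 2 *+ 2 * pi *+ 2 = 2 * (s ^+ 2 * pi *+ 2).
  by rewrite mulr_natl mulrnAl.
rewrite sqrtrM// invfM mulrA mulrA divff// mul1r; congr (_ * expR _).
by field.
Qed.

Lemma integral_expR_sqr_normal_prob :
  (\int[nu]_x (expR ((x - m) ^+ 2 / (s ^+ 2 *+ 4)))%:E = (Num.sqrt 2)%:E)%E.
Proof.
rewrite ge0_integral_normal_prob//; last first.
  apply/measurable_EFinP; apply: measurableT_comp => //.
  by apply: measurable_funM => //; apply: measurable_funX; exact: measurable_funB.
under eq_integral do rewrite -EFinM expR_sqr_normal_pdf EFinM.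
rewrite integralZl//; last exact: integrable_normal_pdf.
by rewrite integral_normal_pdf mule1.
Qed.

(** Domination by the exponential of a quarter of the normalized square, whose
integral is sqrt 2, covers every integrand used below. *)
Lemma normal_prob_integrable_dominated (f : R -> R) (K : R) :
    measurable_fun [set: R] f ->
    (forall x, `|f x| <= K * expR ((x - m) ^+ 2 / (s ^+ 2 *+ 4))) ->
  nu.-integrable [set: R] (EFin \o f).
Proof.
move=> mf fK.
have mE : measurable_fun [set: R] (fun x => expR ((x - m) ^+ 2 / (s ^+ 2 *+ 4))).
  apply: measurableT_comp => //.
  by apply: measurable_funM => //; apply: measurable_funX; exact: measurable_funB.
have iE : nu.-integrable [set: R]
    (EFin \o (fun x => expR ((x - m) ^+ 2 / (s ^+ 2 *+ 4)))).
  apply/integrableP; split; first exact/measurable_EFinP.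
  under eq_integral do rewrite gee0_abs ?lee_fin ?expR_ge0//.
  by rewrite integral_expR_sqr_normal_prob ltry.
apply: (le_integrable measurableT _ _ (integrableZl measurableT K iE)).
  exact/measurable_EFinP.
move=> x _; rewrite /= lee_fin; apply: (le_trans (fK x)).
exact: ler_norm.
Qed.

Lemma sqr_le_expR x : (1 + `|x - m|) ^+ 2 <=
  (2 + s ^+ 2 *+ 8) * expR ((x - m) ^+ 2 / (s ^+ 2 *+ 4)).
Proof.
have s20 : 0 < s ^+ 2 by rewrite exprn_even_gt0.
set y := x - m.
have h : 1 + y ^+ 2 / (s ^+ 2 *+ 4) <= expR (y ^+ 2 / (s ^+ 2 *+ 4)).
  exact: expR_ge1Dx.
have y2 : `|y| ^+ 2 = y ^+ 2 by rewrite real_normK// num_real.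
have h2 : (2 + s ^+ 2 *+ 8) * (1 + y ^+ 2 / (s ^+ 2 *+ 4)) =
   2 + s^+2 *+ 8 + y ^+ 2 / (s^+2 *+ 2) + 2 * y ^+ 2.
  by field.
apply: le_trans (ler_wpM2l _ h); last by rewrite addr_ge0// mulrn_wge0// ltW.
rewrite h2.
have d0 : 0 <= y ^+ 2 / (s ^+ 2 *+ 2).
  by rewrite divr_ge0 ?sqr_ge0// mulrn_wge0// ltW.
have h3 : (1 + `|y|) ^+ 2 <= 2 + 2 * y ^+ 2.
  rewrite -y2 -subr_ge0.
  by rewrite (_ : _ - _ = (`|y| - 1) ^+ 2) ?sqr_ge0//; ring.
apply: (le_trans h3); rewrite lerD2r -addrA lerDl addr_ge0//.
by rewrite mulrn_wge0// ltW.
Qed.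

End normal_integral.

Section normal_stein.
Variables (R : realType) (m s : R).
Hypothesis s0 : s != 0.
Local Notation mu := (@lebesgue_measure R).
Local Notation nu := (normal_prob m s).
Local Notation p := (normal_pdf m s).

Lemma is_derive_normal_pdf (x : R) :
  is_derive x 1 (p : R -> R) (- ((x - m) / s ^+ 2 * p x)).
Proof.
rewrite normal_pdfE// /normal_fun.
have h : is_derive x 1 (fun x : R => - (x - m) ^+ 2 / (s ^+ 2 *+ 2))
   (- ((x - m) / s ^+ 2)).
  apply: is_derive_eq.
  by rewrite /GRing.scale /=; field.
have h2 := @is_derive1_comp R expR _ x _ _ (is_derive_expR _) h.
have h3 := is_deriveZ (normal_peak s) h2.
apply: is_derive_eq.
by rewrite /GRing.scale /=; ring.
Qed.

Lemma normal_pdf_decay : exists2 K : R, 0 < K &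
  forall x, (1 + `|x - m|) * p x <= K / (1 + `|x - m|).
Proof.
have s20 : 0 < s ^+ 2 by rewrite exprn_even_gt0.
exists (normal_peak s * (2 + s ^+ 2 *+ 8)) => [|x].
  by rewrite mulr_gt0 ?normal_peak_gt0// ltr_wpDr// mulrn_wge0// ltW.
have y0 : 0 < 1 + `|x - m| by rewrite ltr_wpDr.
rewrite ler_pdivlMr// normal_pdfE//.
rewrite [leLHS](_ : _ = normal_peak s * ((1 + `|x - m|) ^+ 2 * normal_fun m s x)); last by ring.
rewrite ler_pM2l ?normal_peak_gt0//.
have := ler_wpM2r (expR_ge0 (- (x - m) ^+ 2 / (s ^+ 2 *+ 2))) (sqr_le_expR m s0 x).
move=> /le_trans; apply; rewrite -mulrA -expRD ler_piMr//.
  by rewrite addr_ge0// mulrn_wge0// ltW.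
rewrite -expR0 ler_expR.
rewrite (_ : _ + _ = - ((x - m) ^+ 2 / (s ^+ 2 *+ 4))); last by field.
by rewrite oppr_le0 divr_ge0 ?sqr_ge0// mulrn_wge0// ltW.
Qed.

(** Stein's identity, from which the mean, the variance and the characteristic
function of the normal law are all read off. The function
(g' - g (x - m) / s^2) p is the derivative of g p, so its integral is the limit
of boundary terms, and these vanish because p decays. *)
Lemma normal_stein (g g' : R -> R) (C : R) :
  (forall x : R, is_derive x 1 g (g' x)) -> continuous g' ->
  (forall x, `|g' x| <= C) -> (forall x, `|g x| <= C * (1 + `|x - m|)) ->
  [/\ nu.-integrable [set: R] (EFin \o g'),
      nu.-integrable [set: R] (EFin \o (fun x => g x * (x - m))) &
  \int[nu]_x (g x * (x - m)) = s ^+ 2 * \int[nu]_x (g' x)].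
Proof.
move=> dg cg' g'C gC.
have s20 : 0 < s ^+ 2 by rewrite exprn_even_gt0.
have C0 : 0 <= C by apply: le_trans (g'C 0).
have dgx x : derivable g x 1 by case: (dg x).
have cg : continuous g.
  by move=> x; apply/differentiable_continuous/derivable1_diffP.
have mg : measurable_fun [set: R] g by exact: continuous_measurable_fun.
have mg' : measurable_fun [set: R] g' by exact: continuous_measurable_fun.
have mxm : measurable_fun [set: R] (fun x : R => x - m) by exact: measurable_funB.
have ig' : nu.-integrable [set: R] (EFin \o g').
  apply: (@normal_prob_integrable_dominated _ m s s0 _ C) => // x.
  apply: (le_trans (g'C x)); rewrite ler_peMr// -expR0 ler_expR.
  by rewrite divr_ge0 ?sqr_ge0// mulrn_wge0// ltW.
have igx : nu.-integrable [set: R] (EFin \o (fun x => g x * (x - m))).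
  apply: (@normal_prob_integrable_dominated _ m s s0 _ (C * (2 + s ^+ 2 *+ 8))) => [|x].
    exact: measurable_funM.
  rewrite -mulrA; apply: le_trans (ler_wpM2l C0 (sqr_le_expR m s0 x)).
  rewrite normrM expr2 mulrA ler_pM//.
  by rewrite lerDr.
split => //.
set q := fun x => g' x - s ^- 2 * (g x * (x - m)).
have igx2 : nu.-integrable [set: R]
    (EFin \o (fun x => s ^- 2 * (g x * (x - m)))).
  have := integrableZl measurableT (s ^- 2) igx.
  by apply: eq_integrable => // x _; rewrite /= EFinM.
have iq : nu.-integrable [set: R] (EFin \o q).
  have := integrableB measurableT ig' igx2.
  by apply: eq_integrable => // x _; rewrite /= EFinB.
suff q0 : \int[nu]_x q x = 0.
  move: q0; rewrite /q RintegralB// RintegralZl// => /eqP.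
  rewrite subr_eq0 => /eqP ->; rewrite mulrA divff ?mul1r//.
  by rewrite gt_eqF.
rewrite /Rintegral integral_normal_prob//.
pose h x := q x * p x.
have ih : mu.-integrable [set: R] (EFin \o h).
  have := integrable_normal_prob iq.
  by apply: eq_integrable.
have ch : continuous h.
  move=> x; apply: cvgM; last exact: continuous_normal_pdf.
  apply: (@cvgB _ R^o); first exact: cg'.
  apply: cvgM; first exact: cvg_cst.
  apply: cvgM; first exact: cg.
  by apply: (@cvgB _ R^o); [exact: cvg_id|exact: cvg_cst].
pose F x := g x * p x.
have dF (x : R) : is_derive x 1 F (h x).
  have h1 := @is_deriveM R R^o g p x 1 _ _ (dg x) (is_derive_normal_pdf x).
  apply: is_derive_eq.
  by rewrite /h /q /GRing.scale /=; ring.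
have cF : continuous F.
  by move=> x; apply/differentiable_continuous/derivable1_diffP; case: (dF x).
(* The intervals are indexed by n.+1 so that none of them is degenerate. *)
have FTC (n : nat) : (\int[mu]_(x in `[(- n.+1%:R)%R, n.+1%:R]) (h x)%:E =
    (F n.+1%:R - F (- n.+1%:R))%:E)%E.
  rewrite (@continuous_FTC2 _ h F) ?EFinB//.
  - by rewrite gtrN.
  - exact: continuous_subspaceT.
  - split.
    + by move=> x _; case: (dF x).
    + by apply: cvg_at_right_filter; exact: cF.
    + by apply: cvg_at_left_filter; exact: cF.
  - by move=> x _; rewrite derive1E; apply: derive_val.
have lim1 : \int[mu]_(x in `[(- n.+1%:R)%R, n.+1%:R]) h x @[n --> \oo] -->
    \int[mu]_x h x.
  have [] // := @Rdominated_convergence _ _ _ mu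
    (fun n => h \_ `[(- n.+1%:R)%R, n.+1%:R]) h (fun x => `|h x|).
  - move=> n; apply/(measurable_restrictT _ _).1 => //.
    by apply: measurable_funTS; exact: continuous_measurable_fun.
  - move=> x; apply: cvg_near_cst; near=> n.
    rewrite patchE mem_set//= in_itv/= -ler_norml.
    apply: (le_trans (ltW (truncnS_gt _))); rewrite ler_nat ltnS.
    by near: n; exact: nbhs_infty_ge.
  - by move=> n x; rewrite patchE; case: ifPn; rewrite ?normr0.
  - exact: integrable_norm.
  - by move=> _; under eq_fun do rewrite -Rintegral_mkcond.
have [K K0 Fdec] := normal_pdf_decay.
have Fb x : `|F x| <= C * (K / (1 + `|x - m|)).
  apply: le_trans (ler_wpM2l C0 (Fdec x)).
  by rewrite normrM mulrA ler_pM// ger0_norm// normal_pdf_ge0.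
have lim2 : \int[mu]_(x in `[(- n.+1%:R)%R, n.+1%:R]) h x @[n --> \oo] --> (0 : R).
  under eq_fun do rewrite /Rintegral FTC.
  apply/cvgr0Pnorm_le => e e0; near=> n.
  rewrite /= (le_trans (ler_normB _ _))// (splitr e).
  have Cn : C * K * 2 / e + `|m| <= n.+1%:R.
    apply: (le_trans (ltW (truncnS_gt _))); rewrite ler_nat ltnS.
    by near: n; exact: nbhs_infty_ge.
  have small y : n.+1%:R <= `|y| + `|m| -> C * (K / (1 + `|y|)) <= e / 2.
    move=> ny; rewrite mulrA ler_pdivrMr ?ltr_wpDr// -ler_pdivrMl; last first.
      by rewrite divr_gt0.
    rewrite invf_div mulrC mulrA.
    have : C * K * 2 / e <= `|y| by rewrite -(lerD2r `|m|) (le_trans Cn).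
    by move=> /le_trans; apply; rewrite lerDr.
  rewrite lerD//; (apply: (le_trans (Fb _)); apply: small).
    by have := ler_normD (n.+1%:R - m) m; rewrite subrK ger0_norm.
  by have := ler_normD (- n.+1%:R - m) m; rewrite subrK normrN ger0_norm.
have -> : fine (\int[mu]_x ((q x)%:E * (p x)%:E)) = \int[mu]_x h x by [].
exact: (cvg_unique _ lim1 lim2).
Unshelve. all: by end_near. Qed.

End normal_stein.

Section normal_moments.
Variables (R : realType) (m s : R).
Hypothesis s0 : s != 0.
Local Notation nu := (normal_prob m s).

Lemma normal_mean : nu.-integrable [set: R] (EFin \o (fun x => x - m)) /\
  \int[nu]_x (x - m) = 0.
Proof.
have D1 (x : R) : is_derive x 1 (cst 1 : R -> R) (cst 0 x) by exact: is_derive_cst.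
have D2 : continuous (cst 0 : R -> R) by move=> x; exact: cvg_cst.
have D3 (x : R) : `|(cst 0 : R -> R) x| <= 1 by rewrite normr0.
have D4 (x : R) : `|(cst 1 : R -> R) x| <= 1 * (1 + `|x - m|).
  by rewrite normr1 mul1r lerDl.
have [_] := normal_stein s0 D1 D2 D3 D4.
rewrite /comp /=; under eq_fun do rewrite mul1r; move=> ->.
by under eq_Rintegral do rewrite mul1r; rewrite Rintegral_cst// mul0r mulr0.
Qed.

Lemma normal_variance :
  nu.-integrable [set: R] (EFin \o (fun x => (x - m) ^+ 2)) /\
  \int[nu]_x (x - m) ^+ 2 = s ^+ 2.
Proof.
have D1 (x : R) : is_derive x 1 (fun x : R => x - m) (cst 1 x).
  by apply: is_derive_eq; rewrite subr0.
have D2 : continuous (cst 1 : R -> R) by move=> x; exact: cvg_cst.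
have D3 (x : R) : `|(cst 1 : R -> R) x| <= 1 by rewrite normr1.
have D4 (x : R) : `|x - m| <= 1 * (1 + `|x - m|) by rewrite mul1r lerDr.
have [_] := normal_stein s0 D1 D2 D3 D4.
rewrite /comp /=; under eq_fun do rewrite -expr2; move=> ->.
under eq_Rintegral do rewrite -expr2; move=> ->.
by rewrite (Rintegral_probability_cst nu) mulr1.
Qed.
End normal_moments.

Section normal_cos.
Variables (R : realType) (s : R).
Hypothesis s0 : s != 0.
Local Notation nu := (normal_prob 0 s).

Lemma is_derive_cosM (u b x : R) :
  is_derive u 1 (fun u => cos (u * x + b)) (- (x * sin (u * x + b))).
Proof.
have h : is_derive u 1 (fun u : R => u * x + b) x.
  by apply: is_derive_eq; rewrite /GRing.scale /=; ring.
have h2 := @is_derive1_comp R cos _ u _ _ (is_derive_cos _) h.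
by apply: is_derive_eq; rewrite mulrC mulrN.
Qed.

(** The integral F(u) solves F' = - s^2 u F: differentiate under the integral and
apply Stein's identity to x sin(u x + b). Hence exp((s u)^2 / 2) F(u) is
constant. *)
Lemma normal_cos (u b : R) :
  \int[nu]_x (cos (u * x + b)) = expR (- (s * u) ^+ 2 / 2) * cos b.
Proof.
have mlin (v : R) : measurable_fun [set: R] (fun x : R => v * x + b).
  by apply: measurable_funD => //; exact: measurable_funM.
have mcos (v : R) : measurable_fun [set: R] (fun x : R => cos (v * x + b)).
  apply: measurableT_comp (mlin v).
  by apply: continuous_measurable_fun; exact: continuous_cos.
have icos (v : R) : nu.-integrable [set: R] (EFin \o (fun x => cos (v * x + b))).
  apply: (@normal_prob_integrable_dominated _ 0 s s0 _ 1) => // x.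
  rewrite mul1r (le_trans (cos_max _))// -expR0 ler_expR.
  by rewrite divr_ge0 ?sqr_ge0// mulrn_wge0// sqr_ge0.
have [iid _] := normal_mean 0 s0.
have iabs : nu.-integrable [set: R] (EFin \o [eta Num.Def.normr]).
  have := integrable_norm iid; apply: eq_integrable => // x _.
  by rewrite /= subr0.
pose F v := \int[nu]_x (cos (v * x + b)).
have dF (v : R) : is_derive v 1 F (- (s ^+ 2 * v * F v)).
  have stein : \int[nu]_x (x * sin (v * x + b)) = s ^+ 2 * v * F v.
    have D1 (x : R) : is_derive x 1 (fun x : R => sin (v * x + b))
        (v * cos (v * x + b)).
      have h : is_derive x 1 (fun x : R => v * x + b) v.
        by apply: is_derive_eq; rewrite /GRing.scale /=; ring.
      have h2 := @is_derive1_comp R sin _ x _ _ (is_derive_sin _) h.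
      by apply: is_derive_eq; rewrite mulrC.
    have D2 : continuous (fun x : R => v * cos (v * x + b)).
      move=> x; apply: cvgM; first exact: cvg_cst.
      apply: continuous_comp; last exact: continuous_cos.
      apply: (@cvgD _ R^o); last exact: cvg_cst.
      by apply: cvgM; [exact: cvg_cst|exact: cvg_id].
    have D3 (x : R) : `|v * cos (v * x + b)| <= 1 + `|v|.
      by rewrite normrM (@le_trans _ _ `|v|) ?lerDr// ler_piMr// cos_max.
    have D4 (x : R) : `|sin (v * x + b)| <= (1 + `|v|) * (1 + `|x - 0|).
      by rewrite (le_trans (sin_max _))// -[leLHS]mul1r ler_pM// lerDl.
    have [_ _] := normal_stein s0 D1 D2 D3 D4.
    under eq_Rintegral do rewrite subr0 mulrC.
    by move=> ->; rewrite RintegralZl// mulrA.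
  have dcos x := is_derive_cosM v b x.
  have loc : v \in `](v - 1), (v + 1)[ by rewrite in_itv/= ltrBlDr ltrDl ltr01.
  have ub (w x : R) : `](v - 1), (v + 1)[%classic w -> [set: R] x ->
      `|partial1of2 (fun w x => cos (w * x + b)) w x| <= `|x|.
    move=> _ _; rewrite partial1of2E (@derive_val _ _ _ _ _ _ _ (is_derive_cosM w b x)).
    by rewrite normrN normrM ler_piMr// sin_max.
  apply: DeriveDef.
    apply: (@derivable_under_integral R _ _ nu (fun w x => cos (w * x + b)) setT
      measurableT v (v - 1) (v + 1) loc _ _ (fun x => `|x|)) => //.
  rewrite -derive1E.
  rewrite (@differentiation_under_integral R _ _ nu (fun w x => cos (w * x + b)) setT
      measurableT v (v - 1) (v + 1) loc _ _ (fun x => `|x|)) => //.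
  - rewrite -stein -mulN1r -RintegralZl//.
    + apply: eq_Rintegral => x _.
      by rewrite partial1of2E (@derive_val _ _ _ _ _ _ _ (is_derive_cosM v b x)) mulN1r.
    + apply: (le_integrable measurableT _ _ iabs).
        apply/measurable_EFinP; apply: measurable_funM => //.
        apply: measurableT_comp (mlin v).
        by apply: continuous_measurable_fun; exact: continuous_sin.
      move=> x _; rewrite /= lee_fin normrM normr_id.
      by rewrite ler_piMr// sin_max.
pose H v := expR ((s * v) ^+ 2 / 2) * F v.
have dH (v : R) : is_derive v (1 : R) H 0.
  have h : is_derive v 1 (fun v : R => (s * v) ^+ 2 / 2) (s ^+ 2 * v).
    by apply: is_derive_eq; rewrite /GRing.scale /=; field.
  have h2 := @is_derive1_comp R expR _ v _ _ (is_derive_expR _) h.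
  have h3 := @is_deriveM R R^o _ F v 1 _ _ h2 (dF v).
  by apply: is_derive_eq; rewrite /GRing.scale /=; ring.
have : H u = H 0 by exact: is_derive_0_is_cst.
rewrite /H mulr0 expr0n /= mul0r expR0 mul1r {2}/F.
under eq_Rintegral do rewrite mul0r add0r.
rewrite (Rintegral_probability_cst nu) => <-.
by rewrite -/(F u) mulrA -expRD mulNr addNr expR0 mul1r.
Qed.
End normal_cos.

(** * Centered Gaussian variables *)

Section gaussian_variable.
Variables (d : measure_display) (T : measurableType d) (R : realType)
  (P : probability T R).
Implicit Types (Y : T -> R) (m s u b : R).

(** The set function [gaussian_law] as a probability measure, so that integrals are
transferred in the same way for s = 0 and for s <> 0. *)
Definition gaussian_measure m s : probability (g_sigma_algebraType (R.-ocitv.-measurable)) R :=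
  if s == 0 then (@dirac _ (g_sigma_algebraType (R.-ocitv.-measurable)) m R : probability _ _) else (normal_prob m s : probability _ _).

Lemma gaussian_measureE m s (A : set R) : gaussian_law m s A = gaussian_measure m s A.
Proof. by rewrite /gaussian_law /gaussian_measure; case: ifP. Qed.

Section transfer.
Variables (Y : T -> R) (m s : R).
Hypothesis mY : measurable_fun [set: T] Y.
Hypothesis lawY : forall A, measurable A -> P (Y @^-1` A) = gaussian_law m s A.

Let mY' : @measurable_fun _ _ T (g_sigma_algebraType (R.-ocitv.-measurable)) [set: T] Y.
Proof. exact: mY. Qed.

Lemma ge0_gaussian_transfer (f : R -> \bar R) :
  measurable_fun [set: R] f -> (forall x, 0 <= f x)%E ->
  (\int[P]_w f (Y w) = \int[gaussian_measure m s]_x f x)%E.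
Proof.
move=> mf f0.
rewrite -[LHS](@ge0_integral_pushforward _ _ _ _ _ _ mY' P setT f)//.
apply: eq_measure_integral => A mA _.
exact: etrans (lawY mA) (gaussian_measureE _ _ _).
Qed.

Lemma gaussian_transfer (f : R -> R) :
  (gaussian_measure m s).-integrable [set: R] (EFin \o f) ->
  P.-integrable [set: T] (EFin \o (f \o Y)) /\
  \int[P]_w f (Y w) = \int[gaussian_measure m s]_x f x.
Proof.
move=> fi; have /integrableP[mf fioo] := fi.
have fYi : P.-integrable [set: T] (EFin \o (f \o Y)).
  apply/integrableP; split.
    by apply/measurable_EFinP/measurableT_comp => //; exact/measurable_EFinP.
  apply: le_lt_trans fioo.
  rewrite -(@ge0_gaussian_transfer (fun x => `|(f x)%:E|%E))//.
  exact: measurableT_comp.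
split => //; rewrite /Rintegral; congr fine.
rewrite -[LHS](@integral_pushforward _ _ _ _ _ _ mY' P setT (EFin \o f))//.
apply: eq_measure_integral => A mA _.
exact: etrans (lawY mA) (gaussian_measureE _ _ _).
Qed.

End transfer.

Lemma integral_gaussian_measure0 m (f : R -> R) : measurable_fun [set: R] f ->
  (gaussian_measure m 0).-integrable [set: R] (EFin \o f) /\
  \int[gaussian_measure m 0]_x f x = f m.
Proof.
move=> mf; have mf' : measurable_fun [set: R] (EFin \o f) by exact/measurable_EFinP.
rewrite /gaussian_measure eqxx; split.
  apply/integrableP; split => //.
  rewrite integral_dirac//; last exact: measurableT_comp.
  by rewrite diracT mul1e ltry.
by rewrite /Rintegral integral_dirac// diracT mul1e.
Qed.

Lemma gaussian_measure_moments m s :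
  [/\ (gaussian_measure m s).-integrable [set: R] (EFin \o (fun x => x - m)),
      \int[gaussian_measure m s]_x (x - m) = 0,
      (gaussian_measure m s).-integrable [set: R] (EFin \o (fun x => (x - m) ^+ 2)) &
      \int[gaussian_measure m s]_x (x - m) ^+ 2 = s ^+ 2].
Proof.
have [->|s0] := eqVneq s 0.
  have mB : measurable_fun [set: R] (fun x => x - m) by exact: measurable_funB.
  have [i1 e1] := integral_gaussian_measure0 m mB.
  have [i2 e2] := integral_gaussian_measure0 m (measurable_funX 2 mB).
  by split => //; rewrite ?e1 ?e2 subrr// expr0n.
rewrite /gaussian_measure (negbTE s0).
have [i1 e1] := normal_mean m s0; have [i2 e2] := normal_variance m s0.
by split.
Qed.

Lemma measurable_cos_affine u b : measurable_fun [set: R] (fun x => cos (u * x + b)).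
Proof.
apply: (@measurableT_comp _ _ _ _ _ _ cos).
  by apply: continuous_measurable_fun; exact: continuous_cos.
by apply: measurable_funD => //; exact: measurable_funM.
Qed.

Lemma gaussian_measure_cos s b :
  (gaussian_measure 0 s).-integrable [set: R] (EFin \o (fun x => cos (x + b))) /\
  \int[gaussian_measure 0 s]_x cos (x + b) = expR (- s ^+ 2 / 2) * cos b.
Proof.
have mc : measurable_fun [set: R] (fun x => cos (x + b)).
  by have := measurable_cos_affine 1 b; under eq_fun do rewrite mul1r.
split.
  by apply: (@probability_integrable_bounded _ _ _ _ _ 1) => // x; exact: cos_max.
have [->|s0] := eqVneq s 0.
  by have [_ ->] := integral_gaussian_measure0 0 mc;
    rewrite add0r expr0n /= oppr0 mul0r expR0 mul1r.
rewrite /gaussian_measure (negbTE s0).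
have := normal_cos s0 1 b; rewrite mulr1 => <-.
by under [in RHS]eq_Rintegral do rewrite mul1r.
Qed.

Definition centered_gaussian Y := measurable_fun [set: T] Y /\
  exists s, forall A, measurable A -> P (Y @^-1` A) = gaussian_law 0 s A.

Lemma is_gaussian_integrable Y : is_gaussian P Y -> P.-integrable [set: T] (EFin \o Y).
Proof.
move=> [mY [m [s lawY]]]; have [i1 _ _ _] := gaussian_measure_moments m s.
have [iYm _] := gaussian_transfer mY lawY i1.
have := integrableD measurableT iYm (finite_measure_integrable_cst P m measurableT).
by apply: eq_integrable => // w _; rewrite /= -EFinD subrK.
Qed.

(** Since the centered moment about m vanishes, the mean determines the first
parameter of the law. *)
Lemma is_gaussian_centered Y : is_gaussian P Y -> \int[P]_w Y w = 0 ->
  centered_gaussian Y.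
Proof.
move=> gY EY; have iY := is_gaussian_integrable gY.
have [mY [m [s lawY]]] := gY; split => //; exists s => A mA; rewrite lawY//.
have [i1 e1 _ _] := gaussian_measure_moments m s.
have [_] := gaussian_transfer mY lawY i1.
rewrite /= e1 RintegralB//; last exact: finite_measure_integrable_cst.
by rewrite EY Rintegral_probability_cst sub0r => /eqP; rewrite oppr_eq0 => /eqP ->.
Qed.

(** The second moment of the variable is the only parameter of its characteristic
function; from here on the law is never mentioned, only covariances. *)
Lemma centered_gaussian_sqr Y : centered_gaussian Y ->
  P.-integrable [set: T] (EFin \o (fun w => Y w ^+ 2)) /\
  forall b, \int[P]_w cos (Y w + b) = expR (- (\int[P]_w (Y w ^+ 2)) / 2) * cos b.
Proof.
move=> [mY [s lawY]].
have [_ _ i2 e2] := gaussian_measure_moments 0 s.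
have [i2' e2'] := gaussian_transfer mY lawY i2.
have e : \int[P]_w (Y w ^+ 2) = s ^+ 2.
  by rewrite -e2 -e2'; apply: eq_Rintegral => w _; rewrite subr0.
split.
  by apply: eq_integrable i2' => // w _; rewrite /= subr0.
move=> b; rewrite e; have [i3 e3] := gaussian_measure_cos s b.
by have [_ ->] := gaussian_transfer mY lawY i3.
Qed.

(** On the event the factor exp(y^2 / (4 s^2) - x^2 / 4) is at least one, and by
[expR_sqr_normal_pdf] its product with the density has integral
sqrt 2 exp(- x^2 / 4). *)
Lemma centered_gaussian_tail Y (v x : R) : centered_gaussian Y ->
  0 < v -> 0 <= x -> \int[P]_w (Y w ^+ 2) <= v ^+ 2 ->
  (P [set w | (x * v < `|Y w|)%R] <= (Num.sqrt 2 * expR (- x ^+ 2 / 4))%:E)%E.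
Proof.
move=> [mY [s lawY]] v0 x0.
have [_ _ i2 e2] := gaussian_measure_moments 0 s.
have [i2' e2'] := gaussian_transfer mY lawY i2.
have -> : \int[P]_w (Y w ^+ 2) = s ^+ 2.
  by rewrite -e2 -e2'; apply: eq_Rintegral => w _; rewrite subr0.
move=> sv.
pose A := [set y : R | x * v < `|y|].
have mA : measurable A.
  rewrite (_ : A = `]x * v, +oo[ `|` `]-oo, (- (x * v))%R[); first exact: measurableU.
  apply/seteqP; split => y; rewrite /A /= !in_itv/= ltr_normr andbT ltrNr.
    by move=> /orP.
  by move=> [->|->]//; rewrite orbT.
rewrite -[X in (P X <= _)%E]/(Y @^-1` A) lawY// /gaussian_law.
have [_|s0] := eqVneq s 0.
  rewrite diracE memNset ?lee_fin ?mulr_ge0 ?expR_ge0 ?sqrtr_ge0//.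
  by rewrite /A /= normr0 ltNge mulr_ge0// ltW.
have s20 : 0 < s ^+ 2 by rewrite exprn_even_gt0.
set c := expR (- x ^+ 2 / 4).
have mq := @measurable_normal_pdf R 0 (Num.sqrt 2 * s).
have mc : measurable_fun [set: R]
    (fun y => (c * (Num.sqrt 2 * normal_pdf 0 (Num.sqrt 2 * s) y))%:E).
  by apply/measurable_EFinP; do 2!apply: measurable_funM => //.
have cq0 y : (0 <= (c * (Num.sqrt 2 * normal_pdf 0 (Num.sqrt 2 * s) y))%:E)%E.
  by rewrite lee_fin !mulr_ge0 ?expR_ge0 ?sqrtr_ge0// normal_pdf_ge0.
apply: (@le_trans _ _ (\int[lebesgue_measure]_(y in A)
    (c * (Num.sqrt 2 * normal_pdf 0 (Num.sqrt 2 * s) y))%:E)%E).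
  apply: ge0_le_integral => //.
  - by move=> y _; rewrite lee_fin normal_pdf_ge0.
  - apply/measurable_EFinP/measurable_funTS; exact: measurable_normal_pdf.
  - exact: measurable_funTS.
  - move=> y Ay; rewrite lee_fin -expR_sqr_normal_pdf// mulrA.
    rewrite ler_peMl ?normal_pdf_ge0// -expRD -[leLHS]expR0 ler_expR subr0.
    have h : x ^+ 2 * v ^+ 2 <= y ^+ 2.
      rewrite -exprMn -[leRHS]real_normK ?num_real// lerXn2r//.
      - by rewrite nnegrE mulr_ge0// ltW.
      - exact: ltW.
    rewrite mulNr addrC subr_ge0 ler_pdivlMr ?mulrn_wgt0//.
    rewrite (le_trans _ h)//.
    have -> : x ^+ 2 / 4 * (s ^+ 2 *+ 4) = x ^+ 2 * s ^+ 2 by field.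
    by rewrite ler_wpM2l// sqr_ge0.
apply: (@le_trans _ _ (\int[lebesgue_measure]_y
    (c * (Num.sqrt 2 * normal_pdf 0 (Num.sqrt 2 * s) y))%:E)%E).
  exact: ge0_subset_integral.
under eq_integral do rewrite mulrA EFinM.
rewrite integralZl//; last exact: integrable_normal_pdf.
by rewrite integral_normal_pdf mule1 mulrC.
Qed.

(** The density on [l, l + 1] is at least its value at the right end point. *)
Lemma centered_gaussian_lower Y (l : R) : centered_gaussian Y ->
  \int[P]_w (Y w ^+ 2) = 1 -> 0 <= l ->
  ((normal_peak 1 * expR (- (l + 1) ^+ 2 / 2))%:E
     <= P [set w | (l <= Y w <= l + 1)%R])%E.
Proof.
move=> [mY [s lawY]].
have [_ _ i2 e2] := gaussian_measure_moments 0 s.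
have [i2' e2'] := gaussian_transfer mY lawY i2.
have -> : \int[P]_w (Y w ^+ 2) = s ^+ 2.
  by rewrite -e2 -e2'; apply: eq_Rintegral => w _; rewrite subr0.
move=> s1 l0.
rewrite -[X in (_ <= P X)%E]/(Y @^-1` `[l, l + 1]) lawY// /gaussian_law.
have s0 : s != 0 by apply/eqP => s0; move: s1 => /eqP; rewrite s0 expr0n eq_sym oner_eq0.
rewrite (negbTE s0).
pose c : R := normal_peak 1 * expR (- (l + 1) ^+ 2 / 2); rewrite -/c.
apply: (@le_trans _ _ (\int[lebesgue_measure]_(y in `[l, (l + 1)%R]) c%:E)%E).
  rewrite integral_cst//= lebesgue_measure_itv/= lte_fin ltrDl ltr01.
  by rewrite -EFinB addrAC subrr add0r mule1.
apply: ge0_le_integral => //.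
- by move=> y _; rewrite lee_fin mulr_ge0 ?normal_peak_ge0 ?expR_ge0.
- apply/measurable_EFinP/measurable_funTS; exact: measurable_normal_pdf.
- move=> y /=; rewrite in_itv/= => /andP[ly yl]; rewrite lee_fin normal_pdfE//.
  rewrite /c /normal_peak s1 expr1n ler_pM ?invr_ge0 ?sqrtr_ge0 ?expR_ge0//.
  rewrite /normal_fun ler_expR s1 subr0 !mulNr lerN2 ler_pM2r ?invr_gt0//.
  by rewrite lerXn2r// nnegrE ?addr_ge0// (le_trans l0).
Qed.

End gaussian_variable.

(** * Events seen by trigonometric moments *)

Section sign_approximation.
Variable R : realType.
Implicit Types v x : R.

(** Iterating this odd cubic drives [-1, 1] minus 0 to the signs; it turns a
polynomial closure property into one for discontinuous functions. *)
Definition sign_step v : R := (3 * v - v ^+ 3) / 2.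

Lemma iter_sign_stepN n v : iter n sign_step (- v) = - iter n sign_step v.
Proof. by elim: n => //= n ->; rewrite /sign_step; field. Qed.

Lemma iter_sign_step_pos n v : 0 <= v <= 1 ->
  v <= iter n sign_step v <= 1 /\ 1 - iter n sign_step v <= (1 - v / 2) ^+ n.
Proof.
move=> /andP[v0 v1]; elim: n => [|n [/andP[vu u1] un]].
  by rewrite /= lexx v1 expr0 gerBl.
rewrite iterS; set u := iter n sign_step v in vu u1 un *.
have e : 1 - sign_step u = (1 - u) * ((2 - u - u ^+ 2) / 2).
  by rewrite /sign_step; field.
have e2 : sign_step u - u = u * (1 - u ^+ 2) / 2 by rewrite /sign_step; field.
have u0 : 0 <= u := le_trans v0 vu.
have uu1 : u ^+ 2 <= 1 by rewrite expr_le1.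
have b0 : 0 <= (2 - u - u ^+ 2) / 2 by lra.
have bv : (2 - u - u ^+ 2) / 2 <= 1 - v / 2 by have := sqr_ge0 u; lra.
split; last first.
  by rewrite [leRHS]exprSr e ler_pM// subr_ge0.
apply/andP; split.
  apply: (le_trans vu); rewrite -subr_ge0 e2 divr_ge0// mulr_ge0//.
  by rewrite subr_ge0.
by rewrite -subr_ge0 e mulr_ge0// subr_ge0.
Qed.

Lemma iter_sign_step_bound n v : `|v| <= 1 -> `|iter n sign_step v| <= 1.
Proof.
move=> v1; wlog v0 : v v1 / 0 <= v => [hw|].
  have [|v0] := leP 0 v; first exact: hw.
  rewrite -[v]opprK iter_sign_stepN normrN hw ?normrN//.
  by rewrite oppr_ge0 ltW.
have [] := @iter_sign_step_pos n v; first by rewrite v0 (le_trans (ler_norm v)).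
by move=> /andP[vu u1] _; rewrite ger0_norm// (le_trans v0).
Qed.

Lemma cvg_iter_sign_step v : `|v| <= 1 ->
  iter n sign_step v @[n --> \oo] --> Num.sg v.
Proof.
have pos (x : R) : 0 < x -> `|x| <= 1 -> iter n sign_step x @[n --> \oo] --> (1 : R).
  move=> x0 x1; have x01 : 0 <= x <= 1 by rewrite ltW//= (le_trans (ler_norm x)).
  rewrite -[X in _ --> X]subr0.
  under eq_fun do rewrite -[iter _ _ _](subKr 1).
  apply: cvgB; first exact: cvg_cst.
  apply: (@squeeze_cvgr _ _ _ _ (cst 0) (fun n => (1 - x / 2) ^+ n)).
  - apply: nearW => n; have [/andP[_ h] ->] := iter_sign_step_pos n x01.
    by rewrite subr_ge0 h.
  - exact: cvg_cst.
  - apply: cvg_expr; rewrite ger0_norm; last by lra.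
    by lra.
move=> v1; have [v0|v0|->] := ltrgt0P v.
- by rewrite gtr0_sg//; exact: pos.
- rewrite ltr0_sg//.
  have -> : (fun n => iter n sign_step v) = (fun n => - iter n sign_step (- v)).
    by apply/funext => n; rewrite iter_sign_stepN opprK.
  by apply: cvgN; apply: pos; rewrite ?normrN// oppr_gt0.
- rewrite sgr0; have -> : (fun n => iter n sign_step 0) = cst 0; last exact: cvg_cst.
  by apply/funext; elim=> //= n ->; rewrite /sign_step expr0n /= mulr0 subr0 mul0r.
Qed.

(** The sign of x is recovered from sines of small multiples of x, hence from
functions of the form cos(f + b). *)
Lemma cvg_sg_sin x : Num.sg (sin (x / 2 ^+ n)) @[n --> \oo] --> Num.sg x.
Proof.
have pos (y : R) : 0 < y -> \forall n \near \oo, Num.sg (sin (y / 2 ^+ n)) = 1.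
  move=> y0; near=> n; apply: gtr0_sg; apply: sin_gt0_pi.
  rewrite divr_gt0 ?exprn_gt0//= ltr_pdivrMr ?exprn_gt0//.
  have h : y < 2 ^+ n.
    apply: (lt_le_trans (truncnS_gt y)); rewrite -natrX ler_nat.
    apply: (@leq_trans n); last by rewrite ltnW// ltn_expl.
    by near: n; exact: nbhs_infty_ge.
  apply: (lt_le_trans h); rewrite ler_peMl ?exprn_ge0//.
  by rewrite (le_trans _ (pi_ge2 R))// ler1n.
apply: cvg_near_cst.
have [x0|x0|->] := ltrgt0P x.
- by rewrite (gtr0_sg x0); exact: pos.
- near=> n; rewrite (ltr0_sg x0) -[in LHS](opprK x) mulNr sinN sgrN; congr (- _).
  by near: n; apply: pos; rewrite oppr_gt0.
- by near=> n; rewrite mul0r sin0.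
Unshelve. all: by end_near. Qed.

End sign_approximation.

Section annihilation.
Variables (d : measure_display) (T : measurableType d) (R : realType)
  (P : probability T R).
Implicit Types (f g W : T -> R) (L : set (T -> R)) (b c y : R).

Definition measurable_linear L :=
  [/\ (forall f g, L f -> L g -> L (fun w => f w + g w)),
      (forall c f, L f -> L (fun w => c * f w)) &
      (forall f, L f -> measurable_fun [set: T] f)].

Definition annihilates L W :=
  forall f b, L f -> \int[P]_w (cos (f w + b) * W w) = 0.

(** The multipliers are the bounded functions that may be inserted in all the
vanishing moments at once. They form an algebra closed under bounded pointwise
limits, which is what makes the passage from cosines to indicators possible
without a monotone class theorem. *)
Definition multiplier L g :=
  [/\ measurable_fun [set: T] g, (exists M, forall w, `|g w| <= M) &
   forall W, P.-integrable [set: T] (EFin \o W) ->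
     annihilates L W -> annihilates L (fun w => W w * g w)].

(** The sigma-algebra that the functions of L generate, presented by the rays. *)
Definition sigma_of_family L : set_system T :=
  <<s [set E | exists f y, L f /\ E = [set w | y < f w]] >>.

Lemma measurable_cosD f b : measurable_fun [set: T] f ->
  measurable_fun [set: T] (fun w => cos (f w + b)).
Proof.
move=> mf; apply: (@measurableT_comp _ _ _ _ _ _ cos).
  by apply: continuous_measurable_fun; exact: continuous_cos.
exact: measurable_funD.
Qed.

Lemma integrable_bounded_mul g W M : measurable_fun [set: T] g ->
  (forall w, `|g w| <= M) -> P.-integrable [set: T] (EFin \o W) ->
  P.-integrable [set: T] (EFin \o (fun w => g w * W w)).
Proof.
move=> mg gM iW; have /integrableP[/measurable_EFinP mW _] := iW.
apply: (le_integrable measurableT _ _ (integrableZl measurableT M iW)).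
  by apply/measurable_EFinP; exact: measurable_funM.
move=> w _; rewrite /= lee_fin normrM [leRHS]normrM ler_wpM2r//.
by rewrite (le_trans (gM w))// ler_norm.
Qed.

Lemma integrable_cosM f b W : measurable_fun [set: T] f ->
  P.-integrable [set: T] (EFin \o W) ->
  P.-integrable [set: T] (EFin \o (fun w => cos (f w + b) * W w)).
Proof.
move=> mf iW; apply: (@integrable_bounded_mul _ _ 1) => // [|w].
  exact: measurable_cosD.
exact: cos_max.
Qed.

Section multipliers.
Variable L : set (T -> R).
Hypothesis linL : measurable_linear L.

(** The product formula for cosines: L is linear, so f' + f and f' - f are again in
L. *)
Lemma multiplier_cos f b : L f -> multiplier L (fun w => cos (f w + b)).
Proof.
case: linL => LD LZ Lm Lf; split.
- by apply: measurable_cosD; exact: Lm.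
- by exists 1 => w; exact: cos_max.
move=> W iW aW f' b' Lf'.
have Lp := LD _ _ Lf' Lf.
have Lmm := LD _ _ Lf' (LZ (-1) _ Lf).
have ip := integrable_cosM (b' + b) (Lm _ Lp) iW.
have im := integrable_cosM (b' - b) (Lm _ Lmm) iW.
have -> : \int[P]_w (cos (f' w + b') * (W w * cos (f w + b))) =
    \int[P]_w (2^-1 * (cos (f' w + f w + (b' + b)) * W w +
                       cos (f' w + -1 * f w + (b' - b)) * W w)).
  apply: eq_Rintegral => w _.
  rewrite (_ : f' w + f w + (b' + b) = (f' w + b') + (f w + b)); last by ring.
  rewrite (_ : f' w + -1 * f w + (b' - b) = (f' w + b') - (f w + b)); last by ring.
  by rewrite (cosD (f' w + b')) (cosB (f' w + b')); field.
rewrite RintegralZl//; last first.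
  by have := integrableD measurableT ip im; apply: eq_integrable.
by rewrite RintegralD// aW// aW// addr0 mulr0.
Qed.

Lemma multiplier_cst c : multiplier L (cst c).
Proof.
case: linL => LD LZ Lm; split => //; first by exists `|c|.
move=> W iW aW f b Lf.
have -> : \int[P]_w (cos (f w + b) * (W w * c)) = \int[P]_w (c * (cos (f w + b) * W w)).
  by apply: eq_Rintegral => w _; ring.
rewrite RintegralZl// ?aW ?mulr0//; apply: integrable_cosM => //; exact: Lm.
Qed.

Lemma multiplier_integrable g W : multiplier L g ->
  P.-integrable [set: T] (EFin \o W) ->
  P.-integrable [set: T] (EFin \o (fun w => W w * g w)).
Proof.
move=> [mg [M gM] _] iW; under eq_fun do rewrite mulrC.
exact: integrable_bounded_mul gM iW.
Qed.

Lemma multiplierM g1 g2 : multiplier L g1 -> multiplier L g2 ->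
  multiplier L (fun w => g1 w * g2 w).
Proof.
move=> h1 h2; have [m1 [M1 b1] a1] := h1; have [m2 [M2 b2] a2] := h2.
split.
- exact: measurable_funM.
- by exists (M1 * M2) => w; rewrite normrM ler_pM.
move=> W iW aW; have iW1 := multiplier_integrable h1 iW.
have := a2 _ iW1 (a1 _ iW aW).
by under eq_fun do rewrite -mulrA.
Qed.

Lemma multiplierD g1 g2 : multiplier L g1 -> multiplier L g2 ->
  multiplier L (fun w => g1 w + g2 w).
Proof.
case: linL => LD LZ Lm.
move=> h1 h2; have [m1 [M1 b1] a1] := h1; have [m2 [M2 b2] a2] := h2.
split.
- exact: measurable_funD.
- by exists (M1 + M2) => w; rewrite (le_trans (ler_normD _ _))// lerD.
move=> W iW aW f b Lf.
under eq_Rintegral do rewrite mulrDr mulrDr.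
rewrite RintegralD//.
- by rewrite a1// a2// addr0.
- by apply: integrable_cosM; [exact: Lm|exact: multiplier_integrable].
- by apply: integrable_cosM; [exact: Lm|exact: multiplier_integrable].
Qed.

Lemma multiplier_lim (g_ : nat -> T -> R) g M :
  (forall n, multiplier L (g_ n)) -> (forall n w, `|g_ n w| <= M) ->
  (forall w, g_ n w @[n --> \oo] --> g w) -> multiplier L g.
Proof.
case: linL => LD LZ Lm hg gM gg.
have mg : measurable_fun [set: T] g.
  apply: (measurable_fun_cvg (h := g_)) => [n|w _]; last exact: gg.
  by case: (hg n).
split => //.
  exists M => w.
  have nc : `|g_ n w| @[n --> \oo] --> `|g w| by apply: cvg_norm; exact: gg.
  rewrite -(cvg_lim _ nc)//; apply: limr_le; first exact: (cvgP _ nc).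
  exact: nearW.
move=> W iW aW f b Lf.
have [] := @Rdominated_convergence _ _ _ P
  (fun n w => cos (f w + b) * (W w * g_ n w)) (fun w => cos (f w + b) * (W w * g w))
  (fun w => M * `|W w|).
- move=> n; have /integrableP[/measurable_EFinP + _] :=
    integrable_cosM b (Lm _ Lf) (multiplier_integrable (hg n) iW).
  by [].
- move=> w; apply: cvgM; first exact: cvg_cst.
  by apply: cvgM; [exact: cvg_cst|exact: gg].
- move=> n w; rewrite normrM normrM -[leRHS]mul1r ler_pM ?cos_max// mulrC.
  by rewrite ler_wpM2r.
- have := integrableZl measurableT M (integrable_norm iW).
  by apply: eq_integrable => // w _; rewrite /= EFinM.
move=> _; under eq_fun do rewrite (let: And3 _ _ a := hg _ in a W iW aW f b Lf).
by move=> h; apply: (cvg_unique _ h (cvg_cst _)).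
Qed.

(** The sine of a small multiple of f - y is a multiplier; iterating the cubic gives
its sign, and then the multiple is sent to 0. *)
Lemma multiplier_sign f y : L f -> multiplier L (fun w => Num.sg (f w - y)).
Proof.
case: linL => LD LZ Lm Lf.
have msin n : multiplier L (fun w => sin ((f w - y) / 2 ^+ n)).
  have := @multiplier_cos _ (- y / 2 ^+ n - pi / 2) (LZ (2 ^- n) _ Lf).
  under eq_fun do rewrite addrA cosBpihalf.
  congr (multiplier L _); apply/funext => w; congr sin; rewrite mulrC.
  by rewrite mulrBl mulNr.
have step g : multiplier L g -> multiplier L (fun w => sign_step (g w)).
  move=> hg.
  have := multiplierD (multiplierM (multiplier_cst (3 / 2)) hg)
    (multiplierM (multiplier_cst (- 2^-1)) (multiplierM hg (multiplierM hg hg))).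
  congr (multiplier L _); apply/funext => w; rewrite /sign_step /=.
  by field.
have mit n k : multiplier L (fun w => iter k (@sign_step R) (sin ((f w - y) / 2 ^+ n))).
  by elim: k => [|k IH]; [exact: msin|exact: step IH].
have msg n : multiplier L (fun w => Num.sg (sin ((f w - y) / 2 ^+ n))).
  apply: (multiplier_lim (mit n) (M := 1)) => [k w|w].
    by apply: iter_sign_step_bound; exact: sin_max.
  by apply: cvg_iter_sign_step; exact: sin_max.
apply: (multiplier_lim msg (M := 1)) => [n w|w]; last exact: cvg_sg_sin.
by rewrite normr_sg; case: (_ != 0).
Qed.

Lemma multiplier_ray f y : L f -> multiplier L \1_[set w | y < f w].
Proof.
move=> Lf; have hs := multiplier_sign y Lf.
have := multiplierD (multiplierM (multiplier_cst 2^-1) hs)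
  (multiplierM (multiplier_cst 2^-1) (multiplierM hs hs)).
congr (multiplier L _); apply/funext => w; rewrite indicE /=.
have [wy|wy|wy] := ltgtP y (f w).
- rewrite mem_set//= gtr0_sg ?subr_gt0//; by field.
- rewrite memNset//= ?ltr0_sg ?subr_lt0//; [by field|by rewrite ltNge ltW].
- rewrite memNset//= ?wy ?subrr ?sgr0 ?ltxx//; by rewrite !mulr0 addr0.
Qed.

Lemma multiplier_sigma E : sigma_of_family L E ->
  measurable E /\ multiplier L \1_E.
Proof.
pose S := [set E : set T | measurable E /\ multiplier L \1_E].
move: E; apply: (@smallest_sub _ _ _ S); last first.
  move=> _ [f [y [Lf ->]]]; split; last exact: multiplier_ray.
  have mf : measurable_fun [set: T] f by case: linL => _ _; exact.
  have := mf measurableT `]y, +oo[%classic (measurable_itv _).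
  by rewrite setTI; congr measurable; apply/seteqP; split => w /=; rewrite in_itv/= andbT.
split.
- split => //; have := multiplier_cst 0; congr (multiplier L _).
  by apply/funext => w; rewrite indic0.
- move=> A [mA hA]; split; first exact: measurableD.
  have := multiplierD (multiplier_cst 1) (multiplierM (multiplier_cst (-1)) hA).
  congr (multiplier L _); apply/funext => w; rewrite setTD !indicE in_setC /=.
  by case: (w \in A); rewrite /= ?mulr1 ?mulr0 ?subrr ?addr0.
move=> F hF; split; first by apply: bigcup_measurable => k _; case: (hF k).
pose g_ n := \1_(\bigcup_(k < n) F k) : T -> R.
apply: (@multiplier_lim g_ _ 1) => [n|n w|w].
- rewrite /g_; elim: n => [|n IH].
    have := multiplier_cst 0; congr (multiplier L _).
    by apply/funext => w; rewrite bigcup_mkord big_ord0 indic0.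
  (* Inclusion-exclusion for the indicator of a union of two sets. *)
  have := multiplierD (multiplierD IH (hF n).2)
    (multiplierM (multiplier_cst (-1)) (multiplierM IH (hF n).2)).
  congr (multiplier L _); apply/funext => w; rewrite !bigcup_mkord big_ord_recr /=.
  rewrite !indicE in_setU.
  by case: (w \in \big[setU/set0]_(i < n) F i); case: (w \in F n) => /=; ring.
- by rewrite /g_ indicE ger0_norm// lern1; case: (_ \in _).
- apply: cvg_near_cst; rewrite /g_ !indicE.
  have [|wF] := boolP (w \in _).
    rewrite inE => -[k _ Fk]; exists k.+1 => // n /= kn.
    by rewrite indicE mem_set//; exists k.
  apply: nearW => n; rewrite indicE memNset// => -[k _ Fk].
  by move: wF; rewrite notin_setE; apply; exists k.
Qed.

(** A uniqueness theorem for characteristic functions, in the form in which it is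
used: vanishing trigonometric moments against W give vanishing of W on every
event generated by L. *)
Theorem annihilates_sigma W E : L (cst 0) -> P.-integrable [set: T] (EFin \o W) ->
  annihilates L W -> sigma_of_family L E -> \int[P]_w (W w * \1_E w) = 0.
Proof.
move=> L0 iW aW /multiplier_sigma[mE [_ _ h]].
have := h W iW aW (cst 0) 0 L0.
by under eq_Rintegral do rewrite /= addr0 cos0 mul1r.
Qed.

End multipliers.
End annihilation.

(** * Gaussian spaces: independence and the zero-one law *)

Section gaussian_space.
Variables (d : measure_display) (T : measurableType d) (R : realType)
  (P : probability T R).
Implicit Types (f g G : T -> R) (L : set (T -> R)).

Definition gaussian_space L :=
  [/\ (forall f g, L f -> L g -> L (fun w => f w + g w)),
      (forall (c : R) f, L f -> L (fun w => c * f w)) &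
      (forall f, L f -> centered_gaussian P f)].

Local Notation "''Cov' f g" := (\int[P]_w (f w * g w)) (at level 10, f, g at level 8).

Definition orthogonal_in L G := [set f | L f /\ 'Cov f G = 0].

Lemma sigma_of_family_sub L L' : L `<=` L' ->
  sigma_of_family L `<=` sigma_of_family L'.
Proof.
by move=> LL'; apply: sub_sigma_algebra2 => _ [f [y [/LL' Lf ->]]]; exists f, y.
Qed.

Lemma sigma_of_family_ray L f (y : R) : L f -> sigma_of_family L [set w | y < f w].
Proof. by move=> Lf; apply: sub_sigma_algebra; exists f, y. Qed.

Lemma sigma_of_family_le L f (y : R) : L f -> sigma_of_family L [set w | f w <= y].
Proof.
move=> Lf; have -> : [set w | f w <= y] = ~` [set w | y < f w].
  by apply/seteqP; split => w /=; rewrite leNgt => /negP.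
apply: (@measurableC _ (g_sigma_algebraType
  [set E | exists f y, L f /\ E = [set w | y < f w]])).
exact: sigma_of_family_ray.
Qed.

Lemma sigma_of_family_bigcap L (D : set nat) (F : nat -> set T) :
  (forall i, D i -> sigma_of_family L (F i)) ->
  sigma_of_family L (\bigcap_(i in D) F i).
Proof.
move=> sF; rewrite bigcap_mkcond; apply: (@bigcapT_measurable _ (g_sigma_algebraType
  [set E | exists f y, L f /\ E = [set w | y < f w]])) => i.
case: ifPn => [/set_mem/sF//|_].
exact: (@measurableT _ (g_sigma_algebraType _)).
Qed.

Lemma sigma_of_familyI L A B : sigma_of_family L A -> sigma_of_family L B ->
  sigma_of_family L (A `&` B).
Proof.
move=> sA sB; exact: (@measurableI _ (g_sigma_algebraType
  [set E | exists f y, L f /\ E = [set w | y < f w]])).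
Qed.

Lemma sigma_of_family_ge L f (y : R) : measurable_linear L -> L f ->
  sigma_of_family L [set w | y <= f w].
Proof.
move=> [_ LZ _] Lf; have -> : [set w | y <= f w] = [set w | -1 * f w <= - y].
  by apply/seteqP; split => w /=; rewrite mulN1r lerN2.
by apply: sigma_of_family_le; exact: LZ.
Qed.

Lemma sigma_of_family_norm_le L f (r : R) : measurable_linear L -> L f ->
  sigma_of_family L [set w | `|f w| <= r].
Proof.
move=> linL Lf; have -> : [set w | `|f w| <= r] = [set w | - r <= f w] `&` [set w | f w <= r].
  apply/seteqP; split => w /=; first by rewrite ler_norml => /andP.
  by rewrite ler_norml => -[-> ->].
by apply: sigma_of_familyI; [exact: sigma_of_family_ge|exact: sigma_of_family_le].
Qed.

Section theory.
Variable L : set (T -> R).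
Hypothesis gL : gaussian_space L.

Lemma gaussian_space_linear : measurable_linear L.
Proof. by case: gL => LD LZ Lg; split=> // f /Lg[]. Qed.

Lemma gaussian_space_measurable f : L f -> measurable_fun [set: T] f.
Proof. by case: gaussian_space_linear => _ _; exact. Qed.

Lemma gaussian_space_integrableM f g : L f -> L g ->
  P.-integrable [set: T] (EFin \o (fun w => f w * g w)).
Proof.
case: gL => LD LZ Lg Lf Lg'.
have [i1 _] := centered_gaussian_sqr (Lg _ Lf).
have [i2 _] := centered_gaussian_sqr (Lg _ Lg').
apply: (le_integrable measurableT _ _ (integrableD measurableT i1 i2)).
  by apply/measurable_EFinP; apply: measurable_funM; exact: gaussian_space_measurable.
move=> w _; rewrite /= lee_fin [leRHS]ger0_norm ?addr_ge0 ?sqr_ge0// normrM.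
rewrite -(real_normK (num_real (f w))) -(real_normK (num_real (g w))).
have := sqr_ge0 (`|f w| - `|g w|); have := normr_ge0 (f w); have := normr_ge0 (g w).
by nra.
Qed.

Lemma gaussian_space_integrable f : L f -> P.-integrable [set: T] (EFin \o f).
Proof.
move=> Lf; have i2 := gaussian_space_integrableM Lf Lf.
apply: (le_integrable measurableT _ _ (integrableD measurableT
  (finite_measure_integrable_cst P 1 measurableT) i2)).
  by apply/measurable_EFinP; exact: gaussian_space_measurable.
move=> w _; rewrite /= lee_fin -expr2 [leRHS]ger0_norm ?addr_ge0 ?sqr_ge0//.
rewrite -(real_normK (num_real (f w))).
by have := sqr_ge0 (`|f w| - 1); have := normr_ge0 (f w); nra.
Qed.

Lemma covC f g : 'Cov f g = 'Cov g f.
Proof. by apply: eq_Rintegral => w _; rewrite mulrC. Qed.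

Lemma covDl f g G : L f -> L g -> L G ->
  'Cov (fun w => f w + g w) G = 'Cov f G + 'Cov g G.
Proof.
move=> Lf Lg LG; under eq_Rintegral do rewrite mulrDl.
by rewrite RintegralD//; exact: gaussian_space_integrableM.
Qed.

Lemma covZl (c : R) f G : L f -> L G -> 'Cov (fun w => c * f w) G = c * 'Cov f G.
Proof.
move=> Lf LG; under eq_Rintegral do rewrite -mulrA.
by rewrite RintegralZl//; exact: gaussian_space_integrableM.
Qed.

Lemma var_ge0 f : 0 <= 'Cov f f.
Proof. by apply: Rintegral_ge0 => w _; rewrite -expr2 sqr_ge0. Qed.

Lemma varDZ f g (c : R) : L f -> L g ->
  'Cov (fun w => f w + c * g w) (fun w => f w + c * g w) =
  'Cov f f + 2 * c * 'Cov f g + c ^+ 2 * 'Cov g g.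
Proof.
move=> Lf Lg; case: gL => LD LZ _; have Lcg := LZ c _ Lg; have LF := LD _ _ Lf Lcg.
rewrite covDl// covZl// (covC f) (covC g) !covDl// !covZl// (covC g f).
by ring.
Qed.

Lemma gaussian_cauchy_schwarz f g : L f -> L g ->
  'Cov f g ^+ 2 <= 'Cov f f * 'Cov g g.
Proof.
move=> Lf Lg; set b := 'Cov f g; set v := 'Cov g g; set u := 'Cov f f.
have q c : 0 <= u + 2 * c * b + c ^+ 2 * v.
  by rewrite /u /b /v -varDZ//; exact: var_ge0.
have v0 : 0 <= v := var_ge0 g.
have u0 : 0 <= u := var_ge0 f.
have [v00|vn0] := eqVneq v 0.
  have b0 : b = 0.
    apply/eqP/negP => /negP b0.
    have := q (- (u + 1) / (2 * b)); rewrite v00 mulr0 addr0.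
    rewrite (_ : u + _ = -1); last by field.
    by rewrite lerNr oppr0 ler10.
  by rewrite b0 v00 expr0n mulr0.
have vp : 0 < v by rewrite lt_neqAle eq_sym vn0.
have := q (- b / v).
rewrite (_ : u + _ + _ = (u * v - b ^+ 2) / v); last by field.
by rewrite pmulr_lge0 ?invr_gt0// subr_ge0.
Qed.

Lemma gaussian_space_cos f (b : R) : L f ->
  \int[P]_w cos (f w + b) = expR (- 'Cov f f / 2) * cos b.
Proof.
case: gL => _ _ Lg /Lg/centered_gaussian_sqr[_ ->].
by under eq_Rintegral do rewrite expr2.
Qed.

Lemma integrable_cosD f (b : R) : L f ->
  P.-integrable [set: T] (EFin \o (fun w => cos (f w + b))).
Proof.
move=> Lf; apply: (@probability_integrable_bounded _ _ _ _ _ 1) => [|w].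
  by apply: measurable_cosD; exact: gaussian_space_measurable.
exact: cos_max.
Qed.

(** Both sides only depend on the variances of f + g and f - g, which agree when f
and g are uncorrelated. *)
Lemma uncorrelated_cos f g (a b : R) : L f -> L g -> 'Cov f g = 0 ->
  \int[P]_w (cos (f w + a) * cos (g w + b)) =
  \int[P]_w cos (f w + a) * \int[P]_w cos (g w + b).
Proof.
move=> Lf Lg fg0; case: gL => LD LZ _.
have Lp := LD _ _ Lf (LZ 1 _ Lg); have Lm := LD _ _ Lf (LZ (-1) _ Lg).
have -> : \int[P]_w (cos (f w + a) * cos (g w + b)) =
   \int[P]_w (2^-1 * (cos (f w + 1 * g w + (a + b)) + cos (f w + -1 * g w + (a - b)))).
  apply: eq_Rintegral => w _.
  rewrite (_ : f w + 1 * g w + (a + b) = (f w + a) + (g w + b)); last by ring.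
  rewrite (_ : f w + -1 * g w + (a - b) = (f w + a) - (g w + b)); last by ring.
  by rewrite (cosD (f w + a)) (cosB (f w + a)); field.
have ip := integrable_cosD (a + b) Lp; have im := integrable_cosD (a - b) Lm.
rewrite RintegralZl//; last by have := integrableD measurableT ip im; apply: eq_integrable.
rewrite RintegralD// !gaussian_space_cos// !varDZ// fg0 cosD cosB.
rewrite (_ : - ('Cov f f + _ + _) / 2 = - 'Cov f f / 2 + (- 'Cov g g / 2)); last by field.
rewrite (_ : - ('Cov f f + _ + _) / 2 = - 'Cov f f / 2 + (- 'Cov g g / 2)); last by field.
by rewrite expRD; field.
Qed.

Lemma orthogonal_in_linear G : L G -> measurable_linear (orthogonal_in L G).
Proof.
case: gL => LD LZ Lg LG; split.
- move=> f g [Lf f0] [Lg' g0]; split; first exact: LD.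
  by rewrite covDl// f0 g0 addr0.
- move=> c f [Lf f0]; split; first exact: LZ.
  by rewrite covZl// f0 mulr0.
- by move=> f [Lf _]; exact: gaussian_space_measurable.
Qed.

Lemma gaussian_space0 f : L f -> L (cst 0).
Proof.
case: gL => _ LZ _ Lf; have := LZ 0 _ Lf; congr L.
by apply/funext => w; rewrite mul0r.
Qed.

Lemma orthogonal_in0 G : L G -> orthogonal_in L G (cst 0).
Proof.
move=> LG; split; first exact: gaussian_space0 LG.
by under eq_Rintegral do rewrite mul0r; rewrite Rintegral_cst// mul0r.
Qed.

Lemma integrable_indic (E : set T) : measurable E ->
  P.-integrable [set: T] (EFin \o (\1_E : T -> R)).
Proof.
move=> mE; apply: (@probability_integrable_bounded _ _ _ _ _ 1) => [|w].
  exact: measurable_indic.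
by rewrite indicE ger0_norm// lern1; case: (_ \in _).
Qed.

Lemma Rintegral_indic (E : set T) : measurable E ->
  \int[P]_w (\1_E w : R) = fine (P E).
Proof. by move=> mE; rewrite /Rintegral integral_indic// setIT. Qed.

(** The function cos(G + b) minus its mean annihilates the orthogonal complement of
G by [uncorrelated_cos], hence has mean zero on every event generated by it. *)
Lemma gaussian_independent_cos G E (b : R) : L G -> sigma_of_family (orthogonal_in L G) E ->
  \int[P]_w (cos (G w + b) * \1_E w) = \int[P]_w cos (G w + b) * fine (P E).
Proof.
move=> LG sE; have linO := orthogonal_in_linear LG.
have [mE _] := multiplier_sigma P linO sE.
set c := \int[P]_w cos (G w + b).
have iC := integrable_cosD b LG.
have ic : P.-integrable [set: T] (EFin \o cst c) by exact: finite_measure_integrable_cst.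
have iW : P.-integrable [set: T] (EFin \o (fun w => cos (G w + b) - c)).
  by have := integrableB measurableT iC ic; apply: eq_integrable.
have : \int[P]_w ((cos (G w + b) - c) * \1_E w) = 0.
  apply: (annihilates_sigma linO (orthogonal_in0 LG) iW _ sE) => f b' [Lf f0].
  under eq_Rintegral do rewrite mulrBr.
  have Lm := gaussian_space_measurable Lf.
  rewrite RintegralB//; [|exact: integrable_cosM..].
  rewrite uncorrelated_cos// RintegralZr//; last exact: integrable_cosD.
  by rewrite subrr.
under eq_Rintegral do rewrite mulrBl.
have ind M (h : T -> R) : measurable_fun [set: T] h -> (forall w, `|h w| <= M) ->
   P.-integrable [set: T] (EFin \o (fun w => h w * \1_E w)).
  by move=> mh hM; apply: integrable_bounded_mul hM _ => //; exact: integrable_indic.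
rewrite RintegralB//.
- rewrite RintegralZl//; last exact: integrable_indic.
  by rewrite Rintegral_indic// => /eqP; rewrite subr_eq0 => /eqP.
- apply: (ind 1) => [|w]; last exact: cos_max.
  by apply: measurable_cosD; exact: gaussian_space_measurable.
- by apply: (ind `|c|) => //.
Qed.

Lemma integral_centered_indic (E A : set T) : measurable E -> measurable A ->
  \int[P]_w ((\1_E w - fine (P E)) * \1_A w) = fine (P (E `&` A)) - fine (P E) * fine (P A).
Proof.
move=> mE mA; under eq_Rintegral do rewrite mulrBl.
have -> : (fun w => \1_E w * \1_A w - fine (P E) * \1_A w) =
   (fun w => \1_(E `&` A) w - fine (P E) * \1_A w) :> (T -> R).
  by apply/funext => w; rewrite indicI.
rewrite RintegralB//.
- by rewrite RintegralZl// ?Rintegral_indic//; [exact: measurableI|exact: integrable_indic].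
- by apply: integrable_indic; exact: measurableI.
- have := integrableZl measurableT (fine (P E)) (integrable_indic mA).
  by apply: eq_integrable => // w _; rewrite /= EFinM.
Qed.

Lemma integrable_centered_indic (E : set T) : measurable E ->
  P.-integrable [set: T] (EFin \o (fun w => \1_E w - fine (P E))).
Proof.
move=> mE; have := integrableB measurableT (integrable_indic mE)
  (finite_measure_integrable_cst P (fine (P E)) measurableT).
exact: eq_integrable.
Qed.

(** [gaussian_independent_cos] read with the roles exchanged: the centered indicator
is now the annihilating function, so that [annihilates_sigma] can be applied once
more and gives independence of events. *)
Lemma annihilates_centered_indic L' E : L' `<=` L ->
  (forall G, L' G -> sigma_of_family (orthogonal_in L G) E) -> measurable E ->
  annihilates P L' (fun w => \1_E w - fine (P E)).
Proof.
move=> L'L sE mE f b L'f; have Lf := L'L _ L'f.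
under eq_Rintegral do rewrite mulrBr.
have mf := gaussian_space_measurable Lf.
rewrite RintegralB//; last 2 first.
- by apply: integrable_cosM => //; exact: integrable_indic.
- apply: integrable_cosM => //; exact: finite_measure_integrable_cst.
rewrite gaussian_independent_cos//; last exact: sE.
by rewrite RintegralZr ?subrr//; exact: integrable_cosD.
Qed.

Lemma gaussian_independent G E A : L G -> sigma_of_family (orthogonal_in L G) E ->
  sigma_of_family [set f | exists c : R, f = fun w => c * G w] A ->
  fine (P (E `&` A)) = fine (P E) * fine (P A).
Proof.
move=> LG sE sA; case: gL => LD LZ Lg.
set L' := [set f | exists c : R, f = fun w => c * G w] in sA.
have L'L : L' `<=` L by move=> _ [c ->]; exact: LZ.
have linL' : measurable_linear L'.
  split.
  - move=> _ _ [c ->] [c' ->]; exists (c + c').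
    by apply/funext => w; rewrite mulrDl.
  - by move=> c _ [c' ->]; exists (c * c'); apply/funext => w; rewrite mulrA.
  - by move=> f /L'L; exact: gaussian_space_measurable.
have [mE _] := multiplier_sigma P (orthogonal_in_linear LG) sE.
have [mA _] := multiplier_sigma P linL' sA.
have h : \int[P]_w ((\1_E w - fine (P E)) * \1_A w) = 0.
  apply: (annihilates_sigma linL' _ (integrable_centered_indic mE) _ sA).
    by exists 0; apply/funext => w; rewrite mul0r.
  apply: annihilates_centered_indic => // _ [c ->].
  apply: (sigma_of_family_sub _ sE) => f [Lf f0]; split => //.
  by rewrite covC covZl// covC f0 mulr0.
by move: h; rewrite integral_centered_indic// => /eqP; rewrite subr_eq0 => /eqP.
Qed.

(** An event that is generated by the orthogonal complement of each single G is
independent of everything that L generates, in particular of itself. *)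
Lemma gaussian_zero_one E : L (cst 0) -> sigma_of_family L E ->
  (forall G, L G -> sigma_of_family (orthogonal_in L G) E) ->
  P E = 0%E \/ P E = 1%E.
Proof.
move=> L0 sE orthE; have linL := gaussian_space_linear.
have [mE _] := multiplier_sigma P linL sE.
have h : \int[P]_w ((\1_E w - fine (P E)) * \1_E w) = 0.
  apply: (annihilates_sigma linL L0 (integrable_centered_indic mE) _ sE).
  by apply: annihilates_centered_indic => //; exact: subset_refl.
move: h; rewrite integral_centered_indic// setIid.
rewrite -[X in X - _]mulr1 -mulrBr => /eqP; rewrite mulf_eq0 subr_eq0.
have Pf : P E \is a fin_num by exact: fin_num_measure.
move=> /orP[/eqP h|/eqP h]; [left|right]; first by rewrite -(fineK Pf) h.
by rewrite -(fineK Pf) -h.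
Qed.

(** The event that the limsup of |Z_i| along the decreasing index sets S n is at
most q. *)
Definition limsup_le (Z : nat -> T -> R) (S : nat -> set nat) (q : R) : set T :=
  [set w | forall k : nat, exists n, forall i, S n i -> `|Z i w| <= q + k.+1%:R^-1].

Lemma limsup_le_sub (Z Z' : nat -> T -> R) (S : nat -> set nat) q :
  (forall n m, (n <= m)%N -> S m `<=` S n) ->
  (forall w (e : R), 0 < e -> exists n, forall i, S n i -> `|Z i w - Z' i w| <= e) ->
  limsup_le Z S q `<=` limsup_le Z' S q.
Proof.
move=> Sdec ZZ' w Zw k.
have [n hn] := Zw (k.+1 * 2).-1%N.
have k2 : 0 < (k.+1 * 2)%:R^-1 :> R by rewrite invr_gt0 ltr0n.
have [m hm] := ZZ' w _ k2.
exists (maxn n m) => i Si.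
have := hn i (Sdec _ _ (leq_maxl n m) _ Si).
have := hm i (Sdec _ _ (leq_maxr n m) _ Si).
rewrite prednK// => h1 h2.
have -> : q + k.+1%:R^-1 = (k.+1 * 2)%:R^-1 + (q + (k.+1 * 2)%:R^-1).
  by rewrite natrM; field; rewrite addrC natr1 pnatr_eq0.
rewrite (le_trans _ (lerD h1 h2))// addrC.
by have := ler_normB (Z i w) (Z i w - Z' i w); rewrite subKr.
Qed.

Lemma sigma_limsup_le L' (Z : nat -> T -> R) (S : nat -> set nat) q :
  measurable_linear L' ->
  (forall i, L' (Z i)) -> sigma_of_family L' (limsup_le Z S q).
Proof.
move=> linL' LZi.
pose G := [set E | exists f y, L' f /\ E = [set w | y < f w]].
have -> : limsup_le Z S q =
    \bigcap_k \bigcup_n \bigcap_(i in S n) [set w | `|Z i w| <= q + k.+1%:R^-1].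
  apply/seteqP; split => [w h k _|w h k].
    by have [n hn] := h k; exists n.
  by have [n _ hn] := h k I; exists n.
apply: (@bigcapT_measurable _ (g_sigma_algebraType G)) => k.
apply: (@bigcupT_measurable _ (g_sigma_algebraType G)) => n.
by apply: sigma_of_family_bigcap => i _; exact: sigma_of_family_norm_le.
Qed.

(** Write Z_i = Z'_i + a_i G with Z'_i orthogonal to G. By Cauchy-Schwarz a_i^2 is at
most the variance of Z_i divided by that of G, so a_i G(w) tends to 0 for every
w, and the event is the same for Z' as for Z. Hence it is generated by the
orthogonal complement of G, for every G, and [gaussian_zero_one] applies. *)
Theorem gaussian_limsup_zero_one (Z : nat -> T -> R) (S : nat -> set nat) q :
  (forall i, L (Z i)) -> (forall n m, (n <= m)%N -> S m `<=` S n) ->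
  (forall e : R, 0 < e -> exists n, forall i, S n i -> 'Cov (Z i) (Z i) <= e) ->
  P (limsup_le Z S q) = 0%E \/ P (limsup_le Z S q) = 1%E.
Proof.
move=> LZi Sdec vZ; have linL := gaussian_space_linear; case: gL => LD LZ _.
apply: gaussian_zero_one; first exact: gaussian_space0 (LZi 0%N).
  exact: sigma_limsup_le.
move=> G LG.
pose v := 'Cov G G.
pose a i := 'Cov (Z i) G / v.
have v0 : 0 <= v := var_ge0 G.
have covv i : 'Cov (Z i) G = a i * v.
  rewrite /a; have [vE|vn0] := eqVneq v 0; last by rewrite divfK.
  have := gaussian_cauchy_schwarz (LZi i) LG; rewrite -/v vE !mulr0.
  by rewrite exprn_even_le0//= => /eqP.
(* If v = 0 then a i = 0, by the convention for division by 0. *)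
have va i : v * a i ^+ 2 <= 'Cov (Z i) (Z i).
  have [vE|vn0] := eqVneq v 0; first by rewrite vE mul0r var_ge0.
  have vp : 0 < v by rewrite lt_neqAle eq_sym vn0.
  rewrite -(ler_pM2r vp); have := gaussian_cauchy_schwarz (LZi i) LG.
  by rewrite covv -/v; apply: le_trans; rewrite le_eqVlt; apply/orP; left; apply/eqP; ring.
pose Z' i w := Z i w + - a i * G w.
have OZ' i : orthogonal_in L G (Z' i).
  split; first by apply: LD => //; exact: LZ.
  rewrite /Z' covDl//; last exact: LZ.
  by rewrite covZl// covv mulNr subrr.
have small w (e : R) : 0 < e -> exists n, forall i, S n i -> `|Z i w - Z' i w| <= e.
  move=> e0.
  have [vE|vn0] := eqVneq v 0.
    exists 0%N => i _; rewrite /Z' /a vE invr0 mulr0 oppr0 mul0r addr0 subrr normr0.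
    exact: ltW.
  have vp : 0 < v by rewrite lt_neqAle eq_sym vn0.
  pose K := 1 + `|G w|.
  have K0 : 0 < K by rewrite ltr_wpDr.
  have [|n hn] := vZ (v * (e / K) ^+ 2); first by rewrite mulr_gt0// exprn_gt0// divr_gt0.
  exists n => i Si; have := le_trans (va i) (hn i Si).
  rewrite ler_pM2l// => h.
  have : `|a i| <= e / K.
    have eK : 0 <= e / K by rewrite divr_ge0// ltW.
    rewrite -(@ler_pXn2r _ 2)// ?nnegrE//.
    by rewrite real_normK// num_real.
  rewrite ler_pdivlMr// => aK; rewrite /Z' opprD addrA subrr sub0r normrN mulNr.
  rewrite normrN (normrM (a i)); apply: le_trans aK.
  by rewrite ler_wpM2l// lerDr.
have -> : limsup_le Z S q = limsup_le Z' S q.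
  apply/seteqP; split; apply: limsup_le_sub => // w e e0.
  by have [n hn] := small w e e0; exists n => i Si; rewrite distrC hn.
by apply: sigma_limsup_le => //; exact: orthogonal_in_linear.
Qed.

End theory.
End gaussian_space.

(** * Weakly correlated Gaussian variables *)

Section sudakov.
Variables (d : measure_display) (T : measurableType d) (R : realType)
  (P : probability T R).
Variable L : set (T -> R).
Hypothesis gL : gaussian_space P L.

Local Notation "''Cov' f g" := (\int[P]_w (f w * g w)) (at level 10, f, g at level 8).

(** For each i consider the event that xi_i lies in [l, l + 1] while all residuals
xi_j - r_ij xi_i are at most 2 u in absolute value. The residuals are
uncorrelated with xi_i, so this event has probability at least
P(l <= xi_i <= l + 1) P(all |xi_j| <= u). On it xi_j <= 2 u + rho xi_i < xi_i for
j != i, so that the m events are disjoint. *)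
Lemma gaussian_sudakov (m : nat) (xi : nat -> T -> R) (rho u l : R) :
  (forall i, (i < m)%N -> L (xi i)) ->
  (forall i, (i < m)%N -> 'Cov (xi i) (xi i) = 1) ->
  (forall i j, (i < m)%N -> (j < m)%N -> i != j -> `|'Cov (xi i) (xi j)| <= rho) ->
  rho <= 1 -> 0 <= u -> 0 <= l -> 2 * u < (1 - rho) * l ->
  m%:R * (normal_peak 1 * expR (- (l + 1) ^+ 2 / 2)) *
  fine (P [set w | forall i, (i < m)%N -> `|xi i w| <= u]) <= 1.
Proof.
move=> Lxi var1 cov rho1 u0 l0 ul; case: (gL) => LD LZ Lg.
set c := normal_peak 1 * _; set U := [set w | _].
have linL := gaussian_space_linear gL.
pose r i j := 'Cov (xi j) (xi i).
pose eta i j w := xi j w + - r i j * xi i w.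
pose E i := \bigcap_(j in [set j | (j < m)%N]) [set w | `|eta i j w| <= 2 * u].
pose A i := [set w | l <= xi i w] `&` [set w | xi i w <= l + 1].
have r1 i j : (i < m)%N -> (j < m)%N -> `|r i j| <= 1.
  move=> im jm; rewrite /r; have [<-|ij] := eqVneq i j; first by rewrite var1// normr1.
  by rewrite (le_trans (cov _ _ _ _ _))// eq_sym.
have Oeta i j : (i < m)%N -> (j < m)%N -> orthogonal_in P L (xi i) (eta i j).
  move=> im jm; split; first by apply: LD; [exact: Lxi|apply: LZ; exact: Lxi].
  have Li := Lxi _ im; have Lj := Lxi _ jm; have Lr := LZ (- r i j) _ Li.
  by rewrite /eta (covDl gL)// (covZl gL)// var1// mulr1 subrr.
have sE i : (i < m)%N -> sigma_of_family (orthogonal_in P L (xi i)) (E i).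
  move=> im; apply: sigma_of_family_bigcap => j jm.
  apply: sigma_of_family_norm_le; last exact: Oeta.
  by apply: orthogonal_in_linear => //; exact: Lxi.
have linZ i : (i < m)%N -> measurable_linear [set f | exists c : R, f = fun w => c * xi i w].
  move=> im; split.
  - move=> _ _ [a ->] [a' ->]; exists (a + a').
    by apply/funext => w; rewrite mulrDl.
  - by move=> a _ [a' ->]; exists (a * a'); apply/funext => w; rewrite mulrA.
  - move=> _ [a ->]; apply: measurable_funM => //.
    by apply: (gaussian_space_measurable gL); exact: Lxi.
have self i : [set f | exists c : R, f = fun w => c * xi i w] (xi i).
  by exists 1; apply/funext => w; rewrite mul1r.
have sA i : (i < m)%N ->
    sigma_of_family [set f | exists c : R, f = fun w => c * xi i w] (A i).
  move=> im; apply: sigma_of_familyI.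
    by apply: sigma_of_family_ge; [exact: linZ|exact: self].
  by apply: sigma_of_family_le; exact: self.
have mE i : (i < m)%N -> measurable (E i).
  move=> im; apply: (multiplier_sigma P _ (sE _ im)).1.
  by apply: orthogonal_in_linear => //; exact: Lxi.
have mA i : (i < m)%N -> measurable (A i).
  by move=> im; exact: (multiplier_sigma P (linZ _ im) (sA _ im)).1.
have mU : measurable U.
  have -> : U = \bigcap_(i in [set i | (i < m)%N]) [set w | `|xi i w| <= u].
    by apply/seteqP; split.
  apply: (multiplier_sigma P linL _).1; apply: sigma_of_family_bigcap => i im.
  by apply: sigma_of_family_norm_le => //; exact: Lxi.
have UE i : (i < m)%N -> U `<=` E i.
  move=> im w Uw j jm /=; rewrite (le_trans (ler_normD _ _))// mulr_natl mulr2n.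
  rewrite lerD ?Uw// mulNr normrN normrM -[leRHS]mul1r ler_pM ?Uw//.
  exact: r1.
have PB i : (i < m)%N -> c * fine (P U) <= fine (P (E i `&` A i)).
  move=> im; rewrite (gaussian_independent gL (Lxi _ im) (sE _ im) (sA _ im)) mulrC.
  apply: ler_pM.
  - by rewrite fine_ge0.
  - by rewrite mulr_ge0 ?normal_peak_ge0 ?expR_ge0.
  - apply: fine_le; rewrite ?fin_num_measure ?le_measure ?inE//; [exact: mE| |exact: UE].
    exact: mE.
  - have -> : A i = [set w | l <= xi i w <= l + 1].
      by apply/seteqP; split => w /=; [move=> [-> ->]|move=> /andP].
    rewrite -lee_fin fineK ?fin_num_measure//; last first.
      have -> : [set w | l <= xi i w <= l + 1] = A i; last exact: mA.
      by apply/seteqP; split => w /=; [move=> /andP|move=> [-> ->]].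
    apply: centered_gaussian_lower => //; first by apply: Lg; exact: Lxi.
    by under eq_Rintegral do rewrite expr2; exact: var1.
have dom i k w : (i < m)%N -> (k < m)%N -> i != k -> (E i `&` A i) w -> xi k w < xi i w.
  move=> im km ik [Ew [/= Al _]].
  have := Ew _ km; rewrite /= /eta mulNr => eb.
  have xi0 : 0 <= xi i w by exact: le_trans Al.
  have h1 : xi k w <= 2 * u + rho * xi i w.
    rewrite -[xi k w](subrK (r i k * xi i w)) lerD//; first exact: le_trans (ler_norm _) eb.
    rewrite ler_wpM2r//; apply: le_trans (ler_norm _) _; rewrite /r.
    by apply: cov => //; rewrite eq_sym.
  apply: (le_lt_trans h1); rewrite -ltrBrDr.
  have -> : xi i w - rho * xi i w = (1 - rho) * xi i w by ring.
  by apply: (lt_le_trans ul); rewrite ler_wpM2l// subr_ge0.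
(* The measure of a disjoint union is stated for sequences indexed by nat. *)
pose B i := if (i < m)%N then E i `&` A i else set0.
have mB i : measurable (B i).
  by rewrite /B; case: ifPn => // im; apply: measurableI; [exact: mE|exact: mA].
have tB : trivIset setT B.
  apply/trivIsetP => i j _ _ ij; rewrite -subset0 => w []; rewrite /B.
  case: ifPn => // im Biw; case: ifPn => // jm Bjw.
  have ji : j != i by rewrite eq_sym.
  by have := lt_trans (dom _ _ _ im jm ij Biw) (dom _ _ _ jm im ji Bjw); rewrite ltxx.
have PB' : (\sum_(i < m) P (B i) <= 1)%E.
  have <- := measure_bigsetU P mB tB m.
  by apply: probability_le1; exact: bigsetU_measurable.
rewrite -lee_fin; apply: le_trans PB'.
have -> : (m%:R * c * fine (P U))%:E = (\sum_(i < m) (c * fine (P U))%:E)%E.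
  by rewrite sumEFin sumr_const card_ord -mulrA mulr_natl.
apply: lee_sum => i _; rewrite /B ltn_ord -[leRHS]fineK ?lee_fin ?PB//.
by rewrite fin_num_measure//; apply: measurableI; [exact: mE|exact: mA].
Qed.

End sudakov.

(** [gaussian_sudakov] with u and l proportional to sqrt y, where
y = log((p + m) b): the lower bound for the normal density is then at least
const * ((p + m) b)^(-1/2), and its product with m is unbounded in m. *)
Lemma gaussian_confined_null d (T : measurableType d) (R : realType)
    (P : probability T R) (L : set (T -> R)) (xi : nat -> T -> R) (rho b : R) (p : nat) :
  gaussian_space P L -> (forall i, L (xi i)) ->
  (forall i, \int[P]_w (xi i w * xi i w) = 1) ->
  (forall i j, i != j -> `|\int[P]_w (xi i w * xi j w)| <= rho) ->
  rho < 1 -> 0 < b -> 1 < p%:R * b ->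
  P (\bigcap_i [set w | `|xi i w| <= (1 - rho) / 8 * Num.sqrt (ln ((p + i)%:R * b))]) = 0%E.
Proof.
move=> gL Lxi var1 cov rho1 b0 pb.
have linL := gaussian_space_linear gL.
have mle i (r : R) : measurable [set w | `|xi i w| <= r].
  by apply: (multiplier_sigma P linL _).1; exact: sigma_of_family_norm_le.
set F := \bigcap_i _; have mF : measurable F by exact: bigcapT_measurable.
pose y m := ln ((p + m)%:R * b).
have z1 m : 1 < (p + m)%:R * b.
  by apply: (lt_le_trans pb); rewrite ler_wpM2r ?(ltW b0)// ler_nat leq_addr.
have y0 m : 0 < y m by rewrite ln_gt0.
pose u m := (1 - rho) / 8 * Num.sqrt (y m).
have Fu m : F `<=` [set w | forall i, (i < m)%N -> `|xi i w| <= u m].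
  move=> w Fw i im; apply: le_trans (Fw i I) _.
  rewrite ler_wpM2l ?divr_ge0 ?subr_ge0 ?(ltW rho1)// ler_wsqrtr//.
  rewrite ler_ln ?posrE ?(lt_trans ltr01)// ler_wpM2r ?(ltW b0)//.
  by rewrite ler_nat leq_add2l ltnW.
have mU m : measurable [set w | forall i, (i < m)%N -> `|xi i w| <= u m].
  have -> : [set w | forall i, (i < m)%N -> `|xi i w| <= u m] =
      \bigcap_(i in [set i | (i < m)%N]) [set w | `|xi i w| <= u m] by [].
  by rewrite bigcap_mkcond; apply: bigcapT_measurable => i; case: ifP.
pose q := fine (P F).
have q0 : 0 <= q by rewrite fine_ge0.
set c := normal_peak 1 * expR (-1) : R.
have c0 : 0 < c by rewrite mulr_gt0 ?expR_gt0// normal_peak_gt0.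
have main m : m%:R * c * q <= Num.sqrt ((p + m)%:R * b).
  have l0 : 0 <= Num.sqrt (y m) / 2 by rewrite divr_ge0// sqrtr_ge0.
  have sy : 0 < Num.sqrt (y m) by rewrite sqrtr_gt0.
  have r0 : 0 < 1 - rho by rewrite subr_gt0.
  have u0 : 0 <= u m by rewrite mulr_ge0 ?sqrtr_ge0// divr_ge0 ?(ltW r0).
  have ul : 2 * u m < (1 - rho) * (Num.sqrt (y m) / 2).
    by rewrite /u; have := mulr_gt0 r0 sy; lra.
  have := gaussian_sudakov gL (fun i _ => Lxi i) (fun i _ => var1 i)
    (fun i j _ _ => @cov i j) (ltW rho1) u0 l0 ul (m := m).
  have qU : q <= fine (P [set w | forall i, (i < m)%N -> `|xi i w| <= u m]).
    apply: fine_le; [exact: fin_num_measure..|].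
    by apply: le_measure; rewrite ?inE.
  (* (sqrt y / 2 + 1)^2 / 2 <= y / 2 + 1, by the inequality of arithmetic and
     geometric means, and exp(- y / 2) is the inverse square root. *)
  have ex : expR (-1) / Num.sqrt ((p + m)%:R * b) <=
      expR (- (Num.sqrt (y m) / 2 + 1) ^+ 2 / 2).
    have -> : (Num.sqrt ((p + m)%:R * b))^-1 = expR (- (y m / 2)).
      rewrite -[LHS]lnK ?posrE ?invr_gt0 ?sqrtr_gt0 ?(lt_trans ltr01)//.
      rewrite lnV ?posrE ?sqrtr_gt0 ?(lt_trans ltr01)//; congr (expR (- _)).
      rewrite /y -[in RHS](sqr_sqrtr (ltW (lt_trans ltr01 (z1 m)))).
      by rewrite lnXn ?sqrtr_gt0 ?(lt_trans ltr01)//; field.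
    rewrite -expRD ler_expR.
    have sq := sqr_sqrtr (ltW (y0 m)); rewrite expr2 in sq *.
    have := sqr_ge0 (Num.sqrt (y m) / 2 - 1); rewrite expr2.
    by have := y0 m; lra.
  have sz : 0 < Num.sqrt ((p + m)%:R * b) by rewrite sqrtr_gt0 (lt_trans ltr01).
  move=> sud.
  have : m%:R * (normal_peak 1 * (expR (-1) / Num.sqrt ((p + m)%:R * b))) * q <= 1.
    apply: le_trans sud; apply: ler_pM => //.
      by rewrite !mulr_ge0 ?normal_peak_ge0 ?expR_ge0 ?invr_ge0 ?sqrtr_ge0.
    by rewrite ler_wpM2l// ler_wpM2l// normal_peak_ge0.
  rewrite (_ : _ * q = (m%:R * c * q) / Num.sqrt ((p + m)%:R * b)); last first.
    by rewrite /c; ring.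
  by rewrite ler_pdivrMr// mul1r.
have q_eq0 : q = 0.
  apply/eqP; rewrite eq_le q0 andbT leNgt; apply/negP => qp.
  pose m := maxn p (Num.truncn (2 * b / (c * q) ^+ 2)).+1.
  have m0 : 0 < m%:R :> R by rewrite ltr0n leq_max orbT.
  have := main m; rewrite -mulrA -(@ler_pXn2r _ 2)// ?nnegrE ?sqrtr_ge0//; last first.
    by rewrite mulr_ge0 ?(ltW m0)// mulr_ge0 ?(ltW c0).
  rewrite sqr_sqrtr ?(ltW (lt_trans ltr01 (z1 m)))//.
  have cq0 : 0 < (c * q) ^+ 2 by rewrite exprn_gt0// mulr_gt0.
  have h1 : 2 * b < m%:R * (c * q) ^+ 2.
    rewrite -ltr_pdivrMr//; apply: (lt_le_trans (truncnS_gt _)).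
    by rewrite ler_nat leq_maxr.
  have h2 : (p + m)%:R <= 2 * m%:R :> R.
    have pm : p%:R <= m%:R :> R by rewrite ler_nat leq_maxl.
    by rewrite natrD; lra.
  have h3 := ler_wpM2r (ltW b0) h2.
  have h4 : m%:R * (2 * b) < m%:R * (m%:R * (c * q) ^+ 2) by rewrite ltr_pM2l.
  by rewrite exprMn [_%:R ^+ 2]expr2; lra.
by rewrite -(fineK (fin_num_measure P F mF)) -/q q_eq0.
Qed.

(** * Conditional variance in a Gaussian space *)

Section small_angle.
Variable R : realType.
Implicit Types x v : R.

Lemma normr_sin_le x : `|sin x| <= `|x|.
Proof.
wlog x0 : x / 0 < x => [hw|].
  have [x0|x0|->] := ltgtP x 0.
  - by rewrite -[x]opprK sinN normrN normrN; apply: hw; rewrite oppr_gt0.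
  - exact: hw.
  - by rewrite sin0.
have [c _] : exists2 c : R, c \in `]0, x[ & sin x - sin 0 = cos c * (x - 0).
  apply: MVT => //.
  by apply: continuous_subspaceT; exact: continuous_sin.
rewrite sin0 !subr0 => ->; rewrite normrM ler_piMl//; exact: cos_max.
Qed.

Lemma normr_cosB1_le x : `|cos x - 1| <= `|x|.
Proof.
wlog x0 : x / 0 < x => [hw|].
  have [x0|x0|->] := ltgtP x 0.
  - by rewrite -[x]opprK cosN normrN; apply: hw; rewrite oppr_gt0.
  - exact: hw.
  - by rewrite cos0 subrr.
have [c _] : exists2 c : R, c \in `]0, x[ & cos x - cos 0 = - sin c * (x - 0).
  apply: MVT => //.
  by apply: continuous_subspaceT; exact: continuous_cos.
rewrite cos0 subr0 => ->; rewrite normrM normrN ler_piMl//; exact: sin_max.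
Qed.

Lemma normr_sinB_le x : `|sin x - x| <= x ^+ 2.
Proof.
wlog x0 : x / 0 < x => [hw|].
  have [x0|x0|->] := ltgtP x 0.
  - by rewrite -[x]opprK sinN -opprD normrN sqrrN; apply: hw; rewrite oppr_gt0.
  - exact: hw.
  - by rewrite sin0 subrr normr0 expr0n.
have [c] : exists2 c : R, c \in `]0, x[ & sin x - sin 0 = cos c * (x - 0).
  apply: MVT => //.
  by apply: continuous_subspaceT; exact: continuous_sin.
rewrite in_itv/= => /andP[c0 cx].
rewrite sin0 !subr0 => ->; rewrite -[X in _ - X]mul1r -mulrBl normrM expr2.
rewrite (gtr0_norm x0) ler_wpM2r ?(ltW x0)//.
by rewrite (le_trans (normr_cosB1_le c))// gtr0_norm// ltW.
Qed.

(** The rescaled sines transfer trigonometric moments to the identity function. *)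
Lemma cvg_natr_sin v : n.+1%:R * sin (v / n.+1%:R) @[n --> \oo] --> v.
Proof.
apply/cvgrPdist_le => e e0; near=> n.
have n0 : 0 < n.+1%:R :> R by rewrite ltr0n.
rewrite distrC; have -> : n.+1%:R * sin (v / n.+1%:R) - v =
    n.+1%:R * (sin (v / n.+1%:R) - v / n.+1%:R).
  by field; rewrite addrC natr1 pnatr_eq0.
rewrite normrM gtr0_norm// (le_trans (ler_wpM2l (ltW n0) (normr_sinB_le _)))//.
have -> : n.+1%:R * (v / n.+1%:R) ^+ 2 = v ^+ 2 / n.+1%:R.
  by field; rewrite addrC natr1 pnatr_eq0.
rewrite ler_pdivrMr// mulrC -ler_pdivrMr//.
apply: (le_trans (ltW (truncnS_gt _))); rewrite ler_nat ltnS.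
by near: n; exact: nbhs_infty_ge.
Unshelve. all: by end_near. Qed.

End small_angle.

Section conditional_variance.
Variables (d : measure_display) (T : measurableType d) (R : realType)
  (P : probability T R).
Variable L : set (T -> R).
Hypothesis gL : gaussian_space P L.
Variable Z : T -> R.
Hypothesis LZ : L Z.

Local Notation "''Cov' f g" := (\int[P]_w (f w * g w)) (at level 10, f, g at level 8).
Local Notation lineZ := [set f | exists c : R, f = fun w => c * Z w].

Lemma line_linear : measurable_linear lineZ.
Proof.
split.
- move=> _ _ [a ->] [a' ->]; exists (a + a').
  by apply/funext => w; rewrite mulrDl.
- by move=> a _ [a' ->]; exists (a * a'); apply/funext => w; rewrite mulrA.
- move=> _ [a ->]; apply: measurable_funM => //.
  exact: (gaussian_space_measurable gL).
Qed.

(** E cos(c Z + b) sin(V / n) = 0 because V / n is uncorrelated with c Z and its sine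
has mean zero; multiply by n and let n tend to infinity. *)
Lemma annihilates_uncorrelated V : L V -> 'Cov V Z = 0 -> annihilates P lineZ V.
Proof.
move=> LV VZ0 _ b [c ->]; case: (gL) => LD LZL Lg.
have Lc := LZL c _ LZ.
have mV := gaussian_space_measurable gL LV.
have mZ := gaussian_space_measurable gL Lc.
have sin0 n : \int[P]_w (cos (c * Z w + b) * (n.+1%:R * sin (V w / n.+1%:R))) = 0.
  have Lv := LZL n.+1%:R^-1 _ LV.
  have -> : \int[P]_w (cos (c * Z w + b) * (n.+1%:R * sin (V w / n.+1%:R))) =
     \int[P]_w (n.+1%:R * (cos (c * Z w + b) * cos (n.+1%:R^-1 * V w + - (pi / 2)))).
    apply: eq_Rintegral => w _; rewrite cosBpihalf mulrCA.
    by rewrite (mulrC (V w)).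
  rewrite RintegralZl//; last first.
    apply: (integrable_cosM _ mZ); exact: (integrable_cosD gL).
  rewrite (uncorrelated_cos gL)//.
    by rewrite (gaussian_space_cos gL)// (gaussian_space_cos gL)// cosN cos_pihalf !mulr0.
  by rewrite (covZl gL)// (covC P Z) (covZl gL)// VZ0 !mulr0.
have iV : P.-integrable [set: T] (EFin \o V) := gaussian_space_integrable gL LV.
have [] := @Rdominated_convergence _ _ _ P
  (fun n w => cos (c * Z w + b) * (n.+1%:R * sin (V w / n.+1%:R)))
  (fun w => cos (c * Z w + b) * V w) (fun w => `|V w|).
- move=> n; apply: measurable_funM; first exact: measurable_cosD.
  apply: measurable_funM => //; apply: (@measurableT_comp _ _ _ _ _ _ (@sin R)).
    by apply: continuous_measurable_fun; exact: continuous_sin.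
  exact: measurable_funM.
- by move=> w; apply: cvgM; [exact: cvg_cst|exact: cvg_natr_sin].
- move=> n w; rewrite normrM -[leRHS]mul1r ler_pM ?cos_max// normrM.
  rewrite (le_trans (ler_wpM2l _ (normr_sin_le _)))// -normrM.
  by rewrite mulrC divfK.
- exact: integrable_norm.
move=> _; under eq_fun do rewrite sin0.
by move=> h; apply: (cvg_unique _ h (cvg_cst _)).
Qed.

(** Events generated by Z as preimages of Borel sets are generated by the rays of
the line spanned by Z; the Borel sets are generated by the open rays. *)
Lemma sigma_of_line A : sigma_of Z A -> sigma_of_family lineZ A.
Proof.
move=> [B mB <-]; rewrite setTI.
have LZZ : lineZ Z by exists 1; apply/funext => w; rewrite mul1r.
pose G := [set E | exists f y, lineZ f /\ E = [set w | y < f w]].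
pose S := [set B : set R | sigma_of_family lineZ (Z @^-1` B)].
have : <<s @RGenOInfty.G R >> B.
  by have : (@ocitv R).-sigma.-measurable B by []; rewrite RGenOInfty.measurableE.
move: (B).
apply: (@smallest_sub _ _ _ S); last first.
  move=> _ [y ->]; rewrite /S /=.
  have -> : Z @^-1` `]y, +oo[%classic = [set w | y < Z w].
    by apply/seteqP; split => w /=; rewrite in_itv/= andbT.
  exact: sigma_of_family_ray.
split.
- by rewrite /S /= preimage_set0; exact: (@measurable0 _ (g_sigma_algebraType G)).
- move=> C SC; rewrite /S /= setTD preimage_setC.
  exact: (@measurableC _ (g_sigma_algebraType G)).
- move=> F SF; rewrite /S /= preimage_bigcup.
  by apply: (@bigcupT_measurable _ (g_sigma_algebraType G)).
Qed.

(** Every version W of E(Y | Z) is the linear regression c Z: Y - c Z annihilates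
the line of Z, so W - c Z has mean zero on every event of sigma(Z), in
particular on the events where it is positive or negative. *)
Lemma cond_expectation_gaussian Y W : L Y -> cond_expectation P Y Z W ->
  exists2 c : R, 'Cov (fun w => Y w + - c * Z w) Z = 0 & ae_eq P setT W (fun w => c * Z w).
Proof.
move=> LY [_ iW mW intW]; case: (gL) => LD LZL _.
pose c := 'Cov Y Z / 'Cov Z Z.
have LcZ := LZL (- c) _ LZ.
have LV : L (fun w => Y w + - c * Z w) by exact: LD.
have VZ0 : 'Cov (fun w => Y w + - c * Z w) Z = 0.
  rewrite (covDl gL)// (covZl gL)// /c.
  have [v0|v0] := eqVneq ('Cov Z Z) 0; last by rewrite mulNr divfK ?subrr.
  have := gaussian_cauchy_schwarz gL LY LZ; rewrite v0 !mulr0 addr0.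
  by rewrite exprn_even_le0//= => /eqP.
exists c => //.
have iY := gaussian_space_integrable gL LY.
have icZ := gaussian_space_integrable gL LcZ.
have iV := gaussian_space_integrable gL LV.
pose D w := W w + - c * Z w.
have iD : P.-integrable [set: T] (EFin \o D).
  by have := integrableD measurableT iW icZ; apply: eq_integrable.
have imul f A : measurable A -> P.-integrable [set: T] (EFin \o f) ->
    P.-integrable [set: T] (EFin \o (fun w => f w * \1_A w)).
  move=> mA fi; under eq_fun do rewrite mulrC.
  apply: (@integrable_bounded_mul _ _ _ P _ _ 1) => // w.
  by rewrite indicE ger0_norm// lern1; case: (_ \in _).
have mline := line_linear.
have D0 A : sigma_of Z A -> \int[P]_w (D w * \1_A w) = 0.
  move=> sA; have sA' := sigma_of_line sA.
  have [mA _] := multiplier_sigma P mline sA'.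
  have toind f : \int[P]_w (f w * \1_A w) = \int[P]_(w in A) f w.
    rewrite [RHS]Rintegral_mkcond; apply: eq_Rintegral => w _; rewrite patchE indicE.
    by case: (w \in A); rewrite ?mulr1 ?mulr0.
  have WY : \int[P]_w (W w * \1_A w) = \int[P]_w (Y w * \1_A w).
    by rewrite !toind /Rintegral intW.
  have := annihilates_sigma mline _ iV (annihilates_uncorrelated LV VZ0) sA'.
  move=> <-; last by exists 0; apply/funext => w; rewrite mul0r.
  under eq_Rintegral do rewrite mulrDl.
  under [in RHS]eq_Rintegral do rewrite mulrDl.
  by rewrite !RintegralD// ?WY//; exact: imul.
have sgn (e : R) : sigma_of Z [set w | 0 < e * D w].
  pose T' := g_sigma_algebraType (sigma_of Z).
  have sZ : sigma_algebra setT (sigma_of Z).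
    by apply: sigma_algebra_preimage; exact: sigma_algebra_measurable.
  have idZ : <<s sigma_of Z >> = sigma_of Z by exact: sigma_algebra_id.
  have mW' : measurable_fun [set: T'] (W : T' -> R).
    move=> _ B mB; rewrite setTI; apply: sub_sigma_algebra; exact: mW.
  have mZ' : measurable_fun [set: T'] (Z : T' -> R).
    by move=> _ B mB; apply: sub_sigma_algebra; exists B.
  have mD' : measurable_fun [set: T'] ((fun w => e * D w) : T' -> R).
    apply: measurable_funM => //; apply: measurable_funD => //.
    exact: measurable_funM.
  have := mD' measurableT `]0, +oo[%classic (measurable_itv _).
  rewrite setTI -[X in X -> _]/(<<s sigma_of Z >> _) idZ.
  by congr (sigma_of Z _); apply/seteqP; split => w /=; rewrite in_itv/= andbT.
have pos := D0 _ (sgn 1); have neg := D0 _ (sgn (-1)).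
have [mp _] := multiplier_sigma P mline (sigma_of_line (sgn 1)).
have [mn _] := multiplier_sigma P mline (sigma_of_line (sgn (-1))).
have : \int[P]_w `|D w| = 0.
  transitivity (\int[P]_w (D w * \1_[set w | 0 < 1 * D w] w) -
    \int[P]_w (D w * \1_[set w | 0 < -1 * D w] w)); last by rewrite pos neg subrr.
  rewrite -RintegralB//; [|exact: imul..].
  apply: eq_Rintegral => w _; rewrite !indicE.
  have memE (e : R) : (w \in [set w | 0 < e * D w]) = (0 < e * D w).
    by apply/idP/idP; rewrite inE.
  rewrite !memE mul1r mulN1r oppr_gt0.
  have [w0|w0|w0] := ltrgt0P (D w).
  - by rewrite mulr1 mulr0 subr0.
  - by rewrite mulr1 mulr0 sub0r.
  - by rewrite w0 !mul0r subrr.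
move=> absD0.
have mD : measurable_fun [set: T] (EFin \o D) by case/integrableP: iD.
have /(ae_eq_integral_abs P measurableT mD) : (\int[P]_w `|(EFin \o D) w| = 0)%E.
  rewrite -[LHS]fineK; last by apply: integrable_fin_num => //; exact: integrable_abse.
  by congr (_%:E).
apply: filterS => w /= h _; have /eqP := h I; rewrite eqe /D mulNr subr_eq0.
by move=> /eqP.
Qed.

Lemma cond_variance_gaussian Y (v : R) : L Y -> cond_variance P Y Z (cst v) ->
  exists2 c : R, 'Cov (fun w => Y w + - c * Z w) Z = 0 &
     v = 'Cov (fun w => Y w + - c * Z w) (fun w => Y w + - c * Z w).
Proof.
move=> LY [W cW [i2 _ _ /(_ setT) iv]].
have [c VZ0 Wc] := cond_expectation_gaussian LY cW; exists c => //.
have sT : sigma_of Z setT by exists setT => //; rewrite preimage_setT setTI.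
have /(congr1 fine) := iv sT.
rewrite -/(\int[P]_w v) Rintegral_probability_cst => ->; congr fine.
have [_ iW _ _] := cW.
case: (gL) => LD LZL _.
have LV : L (fun w => Y w + - c * Z w) by apply: LD => //; exact: LZL.
apply: ae_eq_integral => //.
- by case/integrableP: i2.
- by case/integrableP: (gaussian_space_integrableM gL LV LV).
- by apply: filterS Wc => w /= h wT; rewrite (h wT) mulNr expr2.
Qed.

(** The conditional variance equals Var Y - Cov(Y, Z)^2 / Var Z, so a lower bound for
it in terms of Var Y is an upper bound for the correlation. *)
Lemma cond_variance_correlation Y (v c0 : R) : L Y -> cond_variance P Y Z (cst v) ->
  c0 * 'Cov Y Y <= v -> 'Cov Y Z ^+ 2 <= (1 - c0) * 'Cov Y Y * 'Cov Z Z.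
Proof.
move=> LY cv hv; have [LD LZmul _] := gL.
have [c covc vE] := cond_variance_gaussian LY cv.
have YZ : 'Cov Y Z = c * 'Cov Z Z.
  apply/eqP; rewrite -subr_eq0 -mulNr -(covZl gL)// -(covDl gL)//; last exact: LZmul.
  exact/eqP.
have VZ0 := var_ge0 P Z.
rewrite (varDZ gL)// YZ in vE; move: hv; rewrite vE => hv.
have := ler_wpM2r VZ0 hv; rewrite YZ; lra.
Qed.

End conditional_variance.

(** * Grids around the base point *)

Section truncation.
Variable R : realType.
Implicit Types x y : R.

(** Rounding towards 0: the rounded point stays between 0 and x, so that grid
projections remain in the box and do not move away from the base point. *)
Definition trunc0 x : R := Num.sg x * (Num.truncn `|x|)%:R.

Lemma trunc0N x : trunc0 (- x) = - trunc0 x.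
Proof. by rewrite /trunc0 sgrN normrN mulNr. Qed.

Lemma trunc0_ge0 x : 0 <= x -> trunc0 x = (Num.truncn x)%:R.
Proof.
rewrite le_eqVlt => /predU1P[<-|x0]; first by rewrite /trunc0 sgr0 mul0r truncn0.
by rewrite /trunc0 gtr0_sg// mul1r gtr0_norm.
Qed.

Lemma trunc0_itv x : 0 <= x -> 0 <= trunc0 x <= x /\ x < trunc0 x + 1.
Proof.
move=> x0; rewrite trunc0_ge0// ler0n /=; split; first by rewrite truncn_le.
by rewrite natr1 truncnS_gt.
Qed.

Lemma normr_trunc0_le x : `|trunc0 x| <= `|x|.
Proof.
wlog x0 : x / 0 <= x => [hw|].
  have [x0|x0] := leP 0 x; first exact: hw.
  by rewrite -[x]opprK trunc0N normrN [leRHS]normrN hw// oppr_ge0 ltW.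
by have [/andP[h1 h2] _] := trunc0_itv x0; rewrite !ger0_norm.
Qed.

Lemma normr_trunc0B_le x : `|x - trunc0 x| <= 1.
Proof.
wlog x0 : x / 0 <= x => [hw|].
  have [x0|x0] := leP 0 x; first exact: hw.
  by rewrite -[x]opprK trunc0N -opprD normrN hw// oppr_ge0 ltW.
have [/andP[h1 h2] h3] := trunc0_itv x0.
by rewrite ger0_norm ?subr_ge0// lerBlDl ltW.
Qed.

Lemma trunc0_sandwich x a b : a <= 0 -> 0 <= b -> a <= x <= b -> a <= trunc0 x <= b.
Proof.
move=> a0 b0; have [x0|x0] := leP 0 x.
  have [/andP[h1 h2] _] := trunc0_itv x0.
  by move=> /andP[_ xb]; rewrite (le_trans a0)//= (le_trans h2).
have nx0 : 0 <= - x by rewrite oppr_ge0 ltW.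
have [/andP[h1 h2] _] := trunc0_itv nx0.
move: h1 h2; rewrite trunc0N oppr_ge0 lerN2 => h1 h2 /andP[ax _].
by rewrite (le_trans ax)//= (le_trans h1).
Qed.

(** Rounding q x and then rounding its q-th part loses nothing; consequently the
projections on finer and finer grids are compatible. *)
Lemma trunc0_nested (q : nat) x : (0 < q)%N ->
  trunc0 (trunc0 (q%:R * x) / q%:R) = trunc0 x.
Proof.
move=> q0; have qR : 0 < q%:R :> R by rewrite ltr0n.
wlog x0 : x / 0 <= x => [hw|].
  have [x0|x0] := leP 0 x; first exact: hw.
  have := hw (- x); rewrite oppr_ge0 (ltW x0) => /(_ isT).
  by rewrite mulrN !trunc0N mulNr trunc0N => /oppr_inj.
have qx0 : 0 <= q%:R * x by rewrite mulr_ge0// ltW.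
rewrite [trunc0 (q%:R * x)]trunc0_ge0// trunc0_ge0 ?divr_ge0//.
rewrite (trunc0_ge0 x0); congr (_%:R); apply: truncn_def.
have h1 : (Num.truncn x)%:R <= x by rewrite truncn_le.
have h2 := truncnS_gt x.
have h3 : (Num.truncn (q%:R * x))%:R <= q%:R * x by rewrite truncn_le.
apply/andP; split.
  rewrite ler_pdivlMr// -natrM ler_nat truncn_ge_nat//.
  by rewrite natrM mulrC ler_pM2l.
by rewrite ltr_pdivrMr// (le_lt_trans h3)// mulrC ltr_pM2r.
Qed.

Lemma trunc0_int x (M : nat) : `|x| <= M%:R ->
  exists2 z : 'I_(2 * M).+1, trunc0 x = (z : nat)%:R - M%:R & True.
Proof.
wlog x0 : x / 0 <= x => [hw|] xM.
  have [x0|x0] := leP 0 x; first exact: hw.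
  have [||z zE _] := hw (- x); rewrite ?normrN// ?oppr_ge0 ?(ltW x0)//.
  exists (rev_ord z) => //.
  rewrite -[LHS]opprK -trunc0N zE /= subSS natrB; last by rewrite -ltnS.
  by rewrite natrM; ring.
rewrite ger0_norm// in xM.
have tM : (Num.truncn x + M < (2 * M).+1)%N.
  rewrite ltnS mul2n -addnn leq_add2r -(ler_nat R).
  by apply: le_trans xM; rewrite truncn_le.
exists (Ordinal tM) => //=.
by rewrite trunc0_ge0// natrD addrK.
Qed.

End truncation.

Section grid.
Variables (R : realType) (N : nat).
Hypothesis N0 : (0 < N)%N.
Implicit Types (t : 'rV[R]_N) (m n k : nat).

Lemma enorm_le_coord t (r : R) : 0 <= r ->
  (forall i, `|t ord0 i| <= r / N%:R) -> enorm t <= r.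
Proof.
move=> r0 h; have NR : 1 <= N%:R :> R by rewrite ler1n.
have NR0 : 0 < N%:R :> R by rewrite ltr0n.
rewrite /enorm -[leRHS]ger0_norm// -sqrtr_sqr ler_wsqrtr//.
apply: (@le_trans _ _ (\sum_(i < N) (r / N%:R) ^+ 2)).
  apply: ler_sum => i _; rewrite -[leLHS]real_normK ?num_real//.
  by rewrite lerXn2r ?nnegrE ?divr_ge0.
rewrite sumr_const card_ord -[leLHS]mulr_natl expr_div_n.
have -> : N%:R * (r ^+ 2 / N%:R ^+ 2) = r ^+ 2 / N%:R.
  by field; rewrite gt_eqF.
by rewrite ler_pdivrMr// ler_peMr// sqr_ge0.
Qed.

Lemma coord_le_enorm t i : `|t ord0 i| <= enorm t.
Proof.
rewrite /enorm -sqrtr_sqr ler_wsqrtr// (bigD1 i)//= lerDl sumr_ge0// => j _.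
exact: sqr_ge0.
Qed.

Lemma enorm_ge0 t : 0 <= enorm t.
Proof. exact: sqrtr_ge0. Qed.

Variable t0 : 'rV[R]_N.

Local Notation mesh m := (N%:R * 2 ^+ m : R).

(** The projection on the grid of mesh 2^-m / N around t0, coordinatewise towards t0.
The factor 1 / N makes the Euclidean distance between a point and its
projection at most 2^-m. *)
Definition gproj m t : 'rV[R]_N :=
  \row_i (t0 ord0 i + trunc0 (mesh m * (t ord0 i - t0 ord0 i)) / mesh m).

(** The points of the grid whose coordinates are within M steps of t0, indexed by a
finite type in order to be counted. *)
Definition gpt m M (z : {ffun 'I_N -> 'I_(2 * M).+1}) : 'rV[R]_N :=
  \row_i (t0 ord0 i + ((z i : nat)%:R - M%:R) / mesh m).

Lemma mesh_gt0 m : 0 < mesh m.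
Proof. by rewrite mulr_gt0 ?ltr0n// exprn_gt0. Qed.

Lemma gprojBE m t i : (gproj m t - t0) ord0 i =
  trunc0 (mesh m * (t ord0 i - t0 ord0 i)) / mesh m.
Proof. by rewrite !mxE addrC addKr. Qed.

Lemma gproj_box lo hi m t : box lo hi t0 -> box lo hi t -> box lo hi (gproj m t).
Proof.
move=> b0 bt i; rewrite mxE; have m0 := mesh_gt0 m.
have /andP[l0 h0] := b0 i; have /andP[lt ht] := bt i.
have := @trunc0_sandwich _ (mesh m * (t ord0 i - t0 ord0 i))
  (mesh m * (lo ord0 i - t0 ord0 i)) (mesh m * (hi ord0 i - t0 ord0 i)).
rewrite pmulr_rle0// pmulr_rge0// subr_le0 subr_ge0 !ler_pM2l// !lerD2r.
move=> /(_ l0 h0); rewrite lt ht => /(_ isT) /andP[h1 h2].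
apply/andP; split; first by rewrite -lerBlDl ler_pdivlMr// mulrC.
by rewrite -lerBrDl ler_pdivrMr// [leRHS]mulrC.
Qed.

Lemma gproj_coord_le m t i :
  `|(gproj m t - t0) ord0 i| <= `|(t - t0) ord0 i|.
Proof.
rewrite gprojBE !mxE; have m0 := mesh_gt0 m.
rewrite normrM normfV (gtr0_norm m0) ler_pdivrMr//.
by rewrite (le_trans (normr_trunc0_le _))// normrM (gtr0_norm m0) mulrC.
Qed.

Lemma enorm_gproj_le m t : enorm (gproj m t - t0) <= enorm (t - t0).
Proof.
rewrite ler_wsqrtr//; apply: ler_sum => i _.
rewrite -[leLHS]real_normK ?num_real// -[leRHS]real_normK ?num_real//.
by rewrite lerXn2r// gproj_coord_le.
Qed.

Lemma gproj_dist_coord m t i : `|(t - gproj m t) ord0 i| <= 2 ^- m / N%:R.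
Proof.
have m0 := mesh_gt0 m; rewrite !mxE opprD addrA.
set y := t ord0 i - t0 ord0 i.
have -> : y - trunc0 (mesh m * y) / mesh m =
    (mesh m * y - trunc0 (mesh m * y)) / mesh m.
  by rewrite mulrBl (mulrC (mesh m)) mulfK// gt_eqF.
rewrite normrM normfV (gtr0_norm m0) ler_pdivrMr//.
rewrite (le_trans (normr_trunc0B_le _))//.
rewrite mulrA divfK ?gt_eqF ?ltr0n// mulVf// expf_neq0//.
Qed.

Lemma enorm_gproj_dist m t : enorm (t - gproj m t) <= 2 ^- m.
Proof.
by apply: enorm_le_coord; [rewrite invr_ge0 exprn_ge0|exact: gproj_dist_coord].
Qed.

Lemma gproj_nested m m' t : (m <= m')%N -> gproj m (gproj m' t) = gproj m t.
Proof.
move=> mm; apply/rowP => i; rewrite !mxE; congr (_ + _ / _).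
rewrite [X in mesh m * X]addrC addKr.
set y := t ord0 i - t0 ord0 i.
have m0 := mesh_gt0 m.
have e : mesh m' = (2 ^ (m' - m))%:R * mesh m.
  by rewrite -(subnK mm) exprD natrX addnK; ring.
have q0 : (2 ^ (m' - m))%:R != 0 :> R by rewrite pnatr_eq0 expn_eq0.
have mm0 : mesh m != 0 by rewrite gt_eqF.
rewrite -[RHS](@trunc0_nested _ (2 ^ (m' - m))) ?expn_gt0//; congr trunc0.
rewrite e -(mulrA _%:R (mesh m) y).
have simpl (q b c : R) : q != 0 -> b != 0 -> b * (c / (q * b)) = c / q.
  by move=> ? ?; field; apply/andP; split.
exact: simpl.
Qed.

(** A point within 2^-n of t0 is at most N 2^k steps of the mesh 2^-(n + k) / N away in
each coordinate. *)
Lemma gproj_grid n k t : enorm (t - t0) <= 2 ^- n ->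
  exists z, gproj (n + k) t = gpt (n + k) (M := N * 2 ^ k) z.
Proof.
move=> tn.
have h i : exists2 z : 'I_(2 * (N * 2 ^ k)).+1,
    trunc0 (mesh (n + k) * (t ord0 i - t0 ord0 i)) = (z : nat)%:R - (N * 2 ^ k)%:R & True.
  apply: trunc0_int; rewrite normrM (gtr0_norm (mesh_gt0 _)).
  have := coord_le_enorm (t - t0) i; rewrite !mxE => ti.
  rewrite (le_trans (ler_wpM2l (ltW (mesh_gt0 _)) (le_trans ti tn)))//.
  rewrite exprD natrM natrX -mulrA mulrAC divff ?mul1r// expf_neq0//.
exists [ffun i => s2val (cid2 (h i))].
apply/rowP => i; rewrite !mxE ffunE; congr (_ + _ / _).
by case: cid2.
Qed.

End grid.

(** * Union bounds *)

Section union_bound.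
Variables (d : measure_display) (T : measurableType d) (R : realType)
  (P : probability T R).

Lemma probability_finite_union (I : finType) (F : I -> set T) (c : R) :
  (forall i, measurable (F i)) -> (forall i, (P (F i) <= c%:E)%E) ->
  measurable (\big[setU/set0]_i F i) /\
  (P (\big[setU/set0]_i F i) <= (#|I|%:R * c)%:E)%E.
Proof.
move=> mF Fc; split; first exact: bigsetU_measurable.
apply: (@le_trans _ _ (\sum_(i : I) P (F i))%E).
  have : measurable (\big[setU/set0]_i F i) /\
    (P (\big[setU/set0]_i F i) <= \sum_(i : I) P (F i))%E; last by case.
  apply: (big_ind2 (fun (A : set T) (x : \bar R) => measurable A /\ (P A <= x)%E)).
  - by rewrite measure0.
  - move=> A x B y [mA Ax] [mB By]; split; first exact: measurableU.
    by apply: (le_trans (measureU2 _ _ _)) => //; exact: leeD.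
  - by move=> i _; split.
have -> : (#|I|%:R * c)%:E = (\sum_(i : I) c%:E)%E.
  by rewrite sumEFin sumr_const mulr_natl.
exact: lee_sum.
Qed.

Lemma probability_countable_union_quarter (F : nat -> set T) :
  (forall j, measurable (F j)) -> (forall j, (P (F j) <= (4 ^- j.+1)%:E)%E) ->
  (P (\bigcup_j F j) <= (3^-1)%:E)%E.
Proof.
move=> mF Fc.
have mU : measurable (\bigcup_j F j) by exact: bigcup_measurable.
apply: le_trans (measure_sigma_subadditive P mF mU (@subset_refl _ _)) _.
apply: lime_le; first exact: is_cvg_nneseries.
apply: nearW => n /=.
apply: (@le_trans _ _ (\sum_(0 <= i < n) (4 ^- i.+1)%:E)%E); first exact: lee_sum.
rewrite sumEFin lee_fin.
have -> : \sum_(0 <= i < n) (4 ^- i.+1) = 3^-1 * (1 - 4 ^- n) :> R.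
  elim: n => [|n IH]; first by rewrite big_nil expr0 invr1 subrr mulr0.
  rewrite big_nat_recr//= IH exprS; field.
  by rewrite expf_neq0.
by rewrite ler_piMr// ?invr_ge0// gerBl invr_ge0 exprn_ge0.
Qed.

End union_bound.

Section exponential_bounds.
Variable R : realType.

Lemma natr_le_expR (n : nat) : n%:R <= expR n%:R :> R.
Proof. by apply: le_trans (expR_ge1Dx _); rewrite lerDr. Qed.

Lemma exprn2_le_expR (n : nat) : 2 ^+ n <= expR n%:R :> R.
Proof.
rewrite -[n%:R]mulr1 expRM_natl; apply: lerXn2r.
- by rewrite nnegrE.
- by rewrite nnegrE expR_ge0.
- by have := @expR_ge1Dx R 1; rewrite -natr1.
Qed.

(** The number of grid points of mesh 2^-(n + 2^k) / N within 2^-n of the base point,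
k <= j + 1, does not depend on n and grows at most like exp(const * 2^j). *)
Lemma grid_card_le (N k j : nat) : (0 < N)%N -> (k <= j.+1)%N ->
  (((2 * (N * 2 ^ (2 ^ k))).+1 ^ N)%N)%:R <= expR ((N * (3 * N + 2))%:R * 2 ^+ j) :> R.
Proof.
move=> N0 kj.
rewrite natrX.
have h : (2 * (N * 2 ^ (2 ^ k))).+1%:R <= expR ((3 * N + 2)%:R * 2 ^+ j) :> R.
  apply: (@le_trans _ _ ((3 * N)%:R * 2 ^+ (2 ^ j.+1))).
    rewrite -natrX -natrM ler_nat.
    apply: (@leq_trans (3 * N * 2 ^ (2 ^ k))); last first.
      by rewrite leq_mul2l leq_exp2l// leq_exp2l// kj orbT.
    rewrite mulnA -addn1 (_ : 3 * N = 2 * N + N)%N; last by lia.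
    rewrite [leqRHS]mulnDl leq_add2l muln_gt0 N0 expn_gt0//.
  have h1 : (3 * N)%:R <= expR ((3 * N)%:R * 2 ^+ j) :> R.
    apply: le_trans (natr_le_expR _) _; rewrite ler_expR ler_peMr//.
    by rewrite exprn_ege1// ler1n.
  have h2 : 2 ^+ (2 ^ j.+1) <= expR (2 * 2 ^+ j) :> R.
    apply: le_trans (exprn2_le_expR _) _.
    by rewrite ler_expR natrX exprS.
  by rewrite natrD mulrDl expRD ler_pM.
apply: (@le_trans _ _ (expR ((3 * N + 2)%:R * 2 ^+ j) ^+ N)).
  by rewrite lerXn2r// nnegrE// expR_ge0.
by rewrite -expRM_natl natrM mulrA.
Qed.

Lemma expRN_quarter_le (j : nat) : expR (- (2 * 2 ^+ j)) <= 4 ^- j.+1 :> R.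
Proof.
rewrite expRN lef_pV2 ?posrE ?expR_gt0 ?exprn_gt0//.
have -> : (4 : R) ^+ j.+1 = 2 ^+ (2 * j.+1).
  by rewrite exprM; congr (_ ^+ _); rewrite expr2 -natrM.
apply: le_trans (exprn2_le_expR _) _; rewrite ler_expR natrM ler_pM2l//.
by rewrite -natrX ler_nat ltn_expl.
Qed.

End exponential_bounds.

(** * Chaining *)

Section chaining.
Variables (d : measure_display) (T : measurableType d) (R : realType)
  (P : probability T R) (L : set (T -> R)).
Hypothesis gL : gaussian_space P L.
Variables (N : nat) (X : 'rV[R]_N -> T -> R) (lo hi t0 : 'rV[R]_N).
Hypothesis N0 : (0 < N)%N.
Hypothesis LX : forall t, L (X t).
Hypothesis t0I : box lo hi t0.
Variables (phi : R -> R) (C : R).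
Hypothesis C0 : 0 < C.
Hypothesis phi_gt0 : forall r : R, 0 < r -> 0 < phi r.
Hypothesis phi_ge0 : forall r : R, 0 <= r -> 0 <= phi r.
Hypothesis phi_mono : forall r s : R, 0 <= r -> r <= s -> phi r <= phi s.
Hypothesis varX : forall t s, box lo hi t -> box lo hi s ->
  \int[P]_w ((X t w - X s w) ^+ 2) <= (C * phi (enorm (t - s))) ^+ 2.

Let K : nat := (N * (3 * N + 2))%N.

(** Chosen so that the tail at level A sqrt(2^j) is sqrt 2 exp(- (K + 5) 2^j), where
exp(K 2^j) bounds the number of grid points; the surplus 5 pays for the number
2^(2^j) of scales n, for the constants and for summability in j. *)
Definition chaining_factor : R := 2 * Num.sqrt (K + 5)%:R.
Local Notation A := chaining_factor.
Local Notation gproj := (gproj t0).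

(** The conditions on t and s are part of the event, so that grid points outside
the box or too far apart give the empty event and need no separate count. *)
Definition exceed (t s : 'rV[R]_N) (x r : R) : set T :=
  [set w | box lo hi t /\ box lo hi s /\ enorm (t - s) <= r /\
           x * (C * phi r) < `|X t w - X s w|].

Lemma measurable_exceed t s x r : measurable (exceed t s x r).
Proof.
case: (pselect (box lo hi t /\ box lo hi s /\ enorm (t - s) <= r)) => [[bt [bs ts]]|h].
  have [LD LZ _] := gL.
  have Lts := LD _ _ (LX t) (LZ (-1) _ (LX s)).
  have -> : exceed t s x r = ~` [set w | `|X t w + -1 * X s w| <= x * (C * phi r)].
    apply/seteqP; split => w /=; rewrite mulN1r.
      by move=> [_ [_ [_ h]]]; apply/negP; rewrite -ltNge.
    by move=> /negP; rewrite -ltNge.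
  apply: measurableC; apply: (multiplier_sigma P (gaussian_space_linear gL) _).1.
  by apply: sigma_of_family_norm_le => //; exact: gaussian_space_linear gL.
have -> : exceed t s x r = set0; last exact: measurable0.
by rewrite -subset0 => w [bt [bs [ts _]]]; apply: h.
Qed.

Lemma probability_exceed t s (j : nat) r : 0 < r ->
  (P (exceed t s (A * Num.sqrt (2 ^+ j)) r) <=
   (Num.sqrt 2 * expR (- ((K + 5)%:R * 2 ^+ j)))%:E)%E.
Proof.
move=> r0.
have A0 : 0 <= A by rewrite mulr_ge0// sqrtr_ge0.
case: (pselect (box lo hi t /\ box lo hi s /\ enorm (t - s) <= r)) => [[bt [bs ts]]|h]; last first.
  have -> : exceed t s (A * Num.sqrt (2 ^+ j)) r = set0.
    by rewrite -subset0 => w [bt [bs [ts _]]]; apply: h.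
  by rewrite measure0 lee_fin mulr_ge0 ?sqrtr_ge0 ?expR_ge0.
have [LD LZ Lg] := gL.
have Lts := LD _ _ (LX t) (LZ (-1) _ (LX s)).
have v0 : 0 < C * phi r by rewrite mulr_gt0// phi_gt0.
have x0 : 0 <= A * Num.sqrt (2 ^+ j) by rewrite mulr_ge0// sqrtr_ge0.
have var : \int[P]_w ((X t w + -1 * X s w) ^+ 2) <= (C * phi r) ^+ 2.
  under eq_Rintegral do rewrite mulN1r.
  apply: (le_trans (varX bt bs)); rewrite lerXn2r ?nnegrE ?(ltW v0)//.
    by rewrite mulr_ge0 ?(ltW C0)// phi_ge0// enorm_ge0.
  by rewrite ler_pM2l// phi_mono// enorm_ge0.
have := centered_gaussian_tail (Lg _ Lts) v0 x0 var.
have -> : - (A * Num.sqrt (2 ^+ j)) ^+ 2 / 4 = - ((K + 5)%:R * 2 ^+ j).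
  rewrite exprMn sqr_sqrtr ?exprn_ge0// /A exprMn sqr_sqrtr ?ler0n//.
  by field.
apply: le_trans; apply: le_measure; rewrite ?inE.
- exact: measurable_exceed.
- have -> : [set w | A * Num.sqrt (2 ^+ j) * (C * phi r) < `|X t w + -1 * X s w|] =
    exceed t s (A * Num.sqrt (2 ^+ j)) r; last exact: measurable_exceed.
  by apply/seteqP; split => w /=; rewrite mulN1r; [|case=> _ [_ []]].
- by move=> w [_ [_ [_]]]; rewrite /= mulN1r.
Qed.

Let x (j : nat) : R := A * Num.sqrt (2 ^+ j).

Let start (n j : nat) (z : {ffun 'I_N -> 'I_(2 * (N * 2 ^ (2 ^ j))).+1}) :=
  exceed (gpt t0 (n + 2 ^ j) z) t0 (x j) (2 ^- n).

Let link (n j : nat) (z : {ffun 'I_N -> 'I_(2 * (N * 2 ^ (2 ^ j.+1))).+1}) :=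
  exceed (gpt t0 (n + 2 ^ j.+1) z) (gproj (n + 2 ^ j) (gpt t0 (n + 2 ^ j.+1) z))
    (x j) (2 ^- (n + 2 ^ j)).

(** For every n < 2^(2^j), either the first step from t0 to the grid of mesh
2^-(n + 2^j), or the step from a point of the grid 2^-(n + 2^j.+1) to its
projection on the grid 2^-(n + 2^j), is too large. *)
Definition bad (j : nat) : set T := \big[setU/set0]_(n : 'I_(2 ^ (2 ^ j)))
  (\big[setU/set0]_z @start n j z `|` \big[setU/set0]_z @link n j z).

(** The union bound over 2^(2^j) values of n and at most exp(K 2^j) grid points each. *)
Lemma probability_bad j : measurable (bad j) /\ (P (bad j) <= (4 ^- j.+1)%:E)%E.
Proof.
set c := Num.sqrt 2 * expR (- ((K + 5)%:R * 2 ^+ j)) : R.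
have c0 : 0 <= c by rewrite mulr_ge0 ?sqrtr_ge0 ?expR_ge0.
set e := expR (K%:R * 2 ^+ j) : R.
have inv_gt0 m : 0 < 2 ^- m :> R by rewrite invr_gt0 exprn_gt0.
have hn (n : 'I_(2 ^ (2 ^ j))) :
    measurable (\big[setU/set0]_z @start n j z `|` \big[setU/set0]_z @link n j z) /\
    (P (\big[setU/set0]_z @start n j z `|` \big[setU/set0]_z @link n j z)
      <= (2 * (e * c))%:E)%E.
  have [m1 p1] := @probability_finite_union _ _ _ P _ (@start n j) c
    (fun z => measurable_exceed _ _ _ _) (fun z => probability_exceed _ _ _ (inv_gt0 _)).
  have [m2 p2] := @probability_finite_union _ _ _ P _ (@link n j) c
    (fun z => measurable_exceed _ _ _ _) (fun z => probability_exceed _ _ _ (inv_gt0 _)).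
  split; first exact: measurableU.
  apply: (le_trans (measureU2 _ _ _)) => //.
  rewrite mulr_natl mulr2n EFinD; apply: leeD.
    apply: (le_trans p1); rewrite lee_fin ler_wpM2r// card_ffun !card_ord.
    exact: grid_card_le.
  apply: (le_trans p2); rewrite lee_fin ler_wpM2r// card_ffun !card_ord.
  exact: grid_card_le.
have [mb pb] := @probability_finite_union _ _ _ P _ _ _
  (fun n => (hn n).1) (fun n => (hn n).2).
split=> //; apply: (le_trans pb); rewrite card_ord lee_fin.
apply: le_trans (expRN_quarter_le _ j).
have s2 : Num.sqrt 2 <= 2 :> R.
  by rewrite -(@ler_pXn2r _ 2) ?nnegrE ?sqrtr_ge0// sqr_sqrtr// expr2 -natrM ler_nat.
have e2 : 4 <= expR (2 * 2 ^+ j) :> R.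
  have -> : (4 : R) = 2 ^+ 2 by rewrite expr2 -natrM.
  apply: le_trans (exprn2_le_expR R 2) _; rewrite ler_expR ler_peMr//.
  by rewrite exprn_ege1// ler1n.
have e1 : (2 ^ (2 ^ j))%:R <= expR (2 ^+ j) :> R.
  by rewrite natrX; apply: le_trans (exprn2_le_expR R _) _; rewrite natrX.
have -> : - (2 * 2 ^+ j) = 2 ^+ j + (2 * 2 ^+ j + (K%:R * 2 ^+ j + - ((K + 5)%:R * 2 ^+ j))) :> R.
  by rewrite natrD; ring.
rewrite !expRD -/e ler_pM//.
  by rewrite !mulr_ge0// expR_ge0.
rewrite /c (_ : 2 * _ = (2 * Num.sqrt 2) * (e * expR (- ((K + 5)%:R * 2 ^+ j)))); last by ring.
rewrite ler_wpM2r ?mulr_ge0 ?expR_ge0//; apply: le_trans e2.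
by rewrite (_ : 4 = 2 * 2); [rewrite ler_pM2l|ring].
Qed.

Lemma not_bad w n j : ~ bad j w -> (n < 2 ^ (2 ^ j))%N ->
  (forall z, ~ @start n j z w) /\ (forall z, ~ @link n j z w).
Proof.
move=> wbad nj; split => z h; apply: wbad; rewrite /bad (bigD1 (Ordinal nj))//=; left.
  by left; rewrite (bigD1 z)//=; left.
by right; rewrite (bigD1 z)//=; left.
Qed.

(** Induction on J: the projections on successive grids are nested, so that each
step is one of the links that are controlled off the bad events; the restriction
on n holds for all j >= j0 once it holds for j0. *)
Lemma chain_bound w n j0 J t : ~ (\bigcup_j bad j) w -> (n < 2 ^ (2 ^ j0))%N ->
  box lo hi t -> enorm (t - t0) <= 2 ^- n -> (j0 <= J)%N ->
  `|X (gproj (n + 2 ^ J) t) w - X t0 w| <= A * C *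
   (Num.sqrt (2 ^+ j0) * phi (2 ^- n) +
    \sum_(j0 <= j < J) Num.sqrt (2 ^+ j) * phi (2 ^- (n + 2 ^ j))).
Proof.
move=> wbad nj0 bt tn j0J.
have notbad j : (j0 <= j)%N ->
    (forall z, ~ @start n j z w) /\ (forall z, ~ @link n j z w).
  move=> j0j; apply: not_bad; first by move=> h; apply: wbad; exists j.
  by apply: (leq_trans nj0); rewrite leq_exp2l// leq_exp2l.
have bp m : box lo hi (gproj m t) by exact: gproj_box.
have np m : enorm (gproj m t - t0) <= 2 ^- n.
  by apply: le_trans tn; exact: enorm_gproj_le.
rewrite -(subnKC j0J); elim: (J - j0)%N => [|k IH].
  rewrite addn0 big_geq// addr0.
  have [z zE] := gproj_grid N0 (2 ^ j0) tn.
  rewrite leNgt; apply/negP => h; apply: ((notbad _ (leqnn j0)).1 z).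
  rewrite /start -zE; do 3 split => //.
  by apply: le_lt_trans h; rewrite /x le_eqVlt; apply/orP; left; apply/eqP; ring.
rewrite addnS big_nat_recr ?leq_addr//= addrA mulrDr.
set s := gproj (n + 2 ^ (j0 + k)) t in IH *.
set s' := gproj (n + 2 ^ (j0 + k).+1) t.
have ss' : s = gproj (n + 2 ^ (j0 + k)) s'.
  by rewrite /s' gproj_nested// leq_add2l leq_exp2l.
rewrite -[X s' w](subrK (X s w)) -addrA addrC.
apply: (le_trans (ler_normD _ _)); apply: lerD => //.
have [z zE] := gproj_grid N0 (2 ^ (j0 + k).+1) tn.
rewrite leNgt; apply/negP => h; apply: ((notbad _ (leq_addr k j0)).2 z).
rewrite /link -zE -/s' -ss'; split; [exact: bp|split; [exact: bp|split]].
  by rewrite ss'; exact: enorm_gproj_dist.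
by apply: le_lt_trans h; rewrite /x le_eqVlt; apply/orP; left; apply/eqP; ring.
Qed.

End chaining.

(** * The entropy integral as a dyadic sum *)

Section entropy_integral.
Variables (R : realType) (phi : R -> R).
Hypothesis phi_ge0 : forall r : R, 0 <= r -> 0 <= phi r.
Hypothesis phi_mono : forall r s : R, 0 <= r -> r <= s -> phi r <= phi s.
Local Notation mu := (@lebesgue_measure R).

Let f (h r : R) : R := phi (h * r) / (r * Num.sqrt (ln (2 / r))).

(** The function phi is only controlled on nonnegative arguments; truncating the
argument at 0 makes it monotone on the whole line. *)
Lemma measurable_entropy_integrand (h : R) : 0 < h ->
  measurable_fun (`]0, 1]%classic : set R) (f h).
Proof.
move=> h0.
have m1 : measurable_fun (`]0, 1]%classic : set R) (fun r : R => phi (h * r)).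
  apply: (eq_measurable_fun (fun r : R => phi (h * Num.max 0 r))).
    by move=> r; rewrite inE/= in_itv/= => /andP[r0 _]; rewrite max_r// ltW.
  apply: nondecreasing_measurable => // r s rs.
  apply: phi_mono; first by rewrite mulr_ge0 ?(ltW h0)// le_max lexx.
  by rewrite ler_pM2l// ge_max le_max lexx /= le_max rs orbT.
have m2 : measurable_fun (`]0, 1]%classic : set R) (fun r : R => (r * Num.sqrt (ln (2 / r)))^-1).
  apply: subspace_continuous_measurable_fun => //.
  apply: continuous_in_subspaceT => r; rewrite inE/= in_itv/= => /andP[r0 r1].
  have l0 : 0 < ln (2 / r).
    by rewrite ln_gt0// ltr_pdivlMr// mul1r (le_lt_trans r1)// ltrDl.
  apply: cvgV; first by rewrite mulf_neq0 ?gt_eqF// sqrtr_gt0.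
  apply: cvgM; first exact: cvg_id.
  apply: continuous_cvg; first exact: sqrt_continuous.
  apply: continuous_cvg; first by apply: continuous_ln; rewrite divr_gt0.
  by apply: cvgM; [exact: cvg_cst|apply: cvgV; [rewrite gt_eqF|exact: cvg_id]].
exact: measurable_funM.
Qed.

Lemma entropy_integrand_ge0 h r : 0 <= h -> `]0, 1]%classic r -> 0 <= f h r.
Proof.
move=> h0; rewrite /= in_itv/= => /andP[r0 r1].
rewrite /f divr_ge0 ?phi_ge0// mulr_ge0 ?sqrtr_ge0// ltW//.
Qed.

Let b (h : R) (k : nat) : R := phi (h * 2 ^- k.+1) / (2 * Num.sqrt k.+2%:R).

(** On the cell ]2^-(k+1), 2^-k] the integrand is at least its value with phi taken
at the left end point, r replaced by 2^-k and log(2 / r) by k + 2. *)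
Lemma entropy_integral_cell (h : R) k : 0 < h ->
  ((b h k)%:E <= \int[mu]_(r in `]2 ^- k.+1, 2 ^- k]) (f h r)%:E)%E.
Proof.
move=> h0.
have p2 m : 0 < 2 ^- m :> R by rewrite invr_gt0 exprn_gt0.
have sub : (`]2 ^- k.+1, 2 ^- k]%classic : set R) `<=` `]0%R, 1%R]%classic.
  move=> r /=; rewrite !in_itv/= => /andP[r0 r1].
  rewrite (lt_trans (p2 k.+1))//= (le_trans r1)// invf_le1 ?exprn_gt0//.
  by rewrite exprn_ege1// ler1n.
pose c : R := phi (h * 2 ^- k.+1) * 2 ^+ k / Num.sqrt k.+2%:R.
apply: (@le_trans _ _ (\int[mu]_(r in `]2 ^- k.+1, 2 ^- k]) c%:E)%E).
  rewrite integral_cst//= lebesgue_measure_itv/= lte_fin.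
  have e : 2 ^- k = 2 * 2 ^- k.+1 :> R.
    by rewrite exprS invfM mulrA divff ?mul1r.
  rewrite {1}e ltr_pMl// ltr1n -EFinB -EFinM lee_fin /b /c.
  rewrite le_eqVlt; apply/orP; left; apply/eqP.
  have s0 : Num.sqrt k.+2%:R != 0 :> R by rewrite gt_eqF// sqrtr_gt0.
  have k0 : (2 : R) ^+ k != 0 by rewrite expf_neq0.
  by rewrite e exprS; field; rewrite s0 k0.
have phi0 : 0 <= phi (h * 2 ^- k.+1) by rewrite phi_ge0// mulr_ge0 ?ltW.
have c0 : 0 <= c by rewrite /c divr_ge0 ?sqrtr_ge0// mulr_ge0.
apply: ge0_le_integral => //.
- by apply/measurable_EFinP; apply: measurable_funS (measurable_entropy_integrand h0).
move=> r /= rk; have := sub _ rk; move: rk; rewrite /= !in_itv/= lee_fin.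
move=> /andP[rk kr] /andP[r0 r1].
have l0 : 0 < ln (2 / r).
  by rewrite ln_gt0// ltr_pdivlMr// mul1r (le_lt_trans r1)// ltrDl.
rewrite /c /f -mulrA ler_pM//.
  by rewrite phi_mono ?mulr_ge0 ?ltW// ltr_pM2l.
rewrite invfM ler_pM ?invr_ge0 ?sqrtr_ge0//.
  by rewrite -[leLHS]invrK lef_pV2 ?posrE.
rewrite lef_pV2 ?posrE ?sqrtr_gt0// ler_wsqrtr//.
have h1 : 2 / r <= 2 ^+ k.+2.
  rewrite exprS ler_pM2l// -[leRHS]invrK lef_pV2 ?posrE// ltW//.
apply: (@le_trans _ _ (ln (2 ^+ k.+2))).
  by rewrite ler_ln ?posrE ?divr_gt0// exprn_gt0.
rewrite lnXn// -[leLHS]mulr_natl ler_piMr//.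
by rewrite -[leRHS]expRK ler_ln ?posrE ?expR_gt0//; have := @expR_ge1Dx R 1; rewrite -natr1.
Qed.

Lemma entropy_integral_sum (h : R) M : 0 < h ->
  ((\sum_(0 <= k < M) b h k)%:E <= \int[mu]_(r in `]0%R, 1%R]) (f h r)%:E)%E.
Proof.
move=> h0.
have p2 m : 0 < 2 ^- m :> R by rewrite invr_gt0 exprn_gt0.
have le1 m : 2 ^- m <= 1 :> R.
  by rewrite invf_le1 ?exprn_gt0// exprn_ege1// ler1n.
have mf := measurable_entropy_integrand h0.
have sub m : (`]2 ^- m, 1]%classic : set R) `<=` `]0%R, 1%R]%classic.
  by move=> r /=; rewrite !in_itv/= => /andP[r0 ->]; rewrite (lt_trans (p2 m)).
apply: (@le_trans _ _ (\int[mu]_(r in `](2 ^- M)%R, 1%R]) (f h r)%:E)%E); last first.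
  apply: ge0_subset_integral => //.
    exact/measurable_EFinP.
  by move=> r r01; rewrite lee_fin entropy_integrand_ge0// ltW.
elim: M => [|M IH]; first by rewrite big_nil expr0 invr1 set_itvoc0 integral_set0.
rewrite big_nat_recr//= EFinD.
have e : `](2 ^- M.+1)%R, 1%R]%classic = `](2 ^- M)%R, 1%R] `|` `](2 ^- M.+1)%R, (2 ^- M)%R] :> set R.
  rewrite setUC -itv_bndbnd_setU// ?bnd_simp//.
  by rewrite lef_pV2 ?posrE ?exprn_gt0// ler_weXn2l// ler1n.
rewrite e ge0_integral_setU//.
- by apply: leeD => //; exact: entropy_integral_cell.
- by rewrite -e; apply/measurable_EFinP; apply: measurable_funS mf => //; exact: sub.
- by rewrite -e => r /sub rM; rewrite lee_fin entropy_integrand_ge0// ltW.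
- apply/disj_setPS => r [] /=; rewrite !in_itv/= => /andP[r1 _] /andP[_ r2].
  by move: r1; rewrite ltNge r2.
Qed.

(** Cauchy condensation: the 2^J terms with 2^J <= k < 2^(J+1) are each at least
phi(h 2^-(2^(J+1))) / (4 sqrt(2^(J+1))), because k + 2 <= 4 * 2^(J+1). *)
Lemma dyadic_condensation (h : R) J : 0 < h ->
  \sum_(1 <= j < J.+1) Num.sqrt (2 ^+ j) * phi (h * 2 ^- (2 ^ j)) <=
  8 * \sum_(0 <= k < 2 ^ J) b h k.
Proof.
move=> h0; have p2 m : 0 < 2 ^- m :> R by rewrite invr_gt0 exprn_gt0.
have b0 k : 0 <= b h k.
  by rewrite divr_ge0 ?mulr_ge0 ?sqrtr_ge0// phi_ge0// mulr_ge0 ?ltW.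
elim: J => [|J IH].
  by rewrite big_geq// mulr_ge0// sumr_ge0.
rewrite big_nat_recr//= (@big_cat_nat _ _ _ (2 ^ J) 0)//=; last first.
  by rewrite leq_exp2l.
rewrite mulrDr lerD//.
set p := phi _; have pp : 0 <= p by rewrite phi_ge0// mulr_ge0 ?ltW.
have s0 : 0 < Num.sqrt (2 ^+ J.+1) :> R by rewrite sqrtr_gt0 exprn_gt0.
have cell k : (2 ^ J <= k < 2 ^ J.+1)%N -> p / (4 * Num.sqrt (2 ^+ J.+1)) <= b h k.
  move=> /andP[Jk kJ]; rewrite /b ler_pM ?invr_ge0 ?mulr_ge0 ?sqrtr_ge0//.
    rewrite phi_mono ?mulr_ge0 ?(ltW h0) ?(ltW (p2 _))// ler_pM2l//.
    by rewrite lef_pV2 ?posrE ?exprn_gt0// ler_weXn2l// ler1n.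
  rewrite lef_pV2 ?posrE ?mulr_gt0 ?sqrtr_gt0 ?exprn_gt0//.
  have -> : 4 * Num.sqrt (2 ^+ J.+1) = 2 * Num.sqrt (4 * 2 ^+ J.+1) :> R.
    rewrite sqrtrM// (_ : 4 = 2 ^+ 2); last by rewrite expr2 -natrM.
    by rewrite sqrtr_sqr ger0_norm// expr2 mulrA.
  rewrite ler_pM2l// ler_wsqrtr// -natrX -natrM ler_nat.
  by have := expn_gt0 2 J.+1; lia.
apply: (@le_trans _ _ (8 * \sum_(2 ^ J <= k < 2 ^ J.+1) (p / (4 * Num.sqrt (2 ^+ J.+1))))).
  rewrite sumr_const_nat (_ : (2 ^ J.+1 - 2 ^ J = 2 ^ J)%N); last by rewrite expnS; lia.
  have -> : Num.sqrt (2 ^+ J.+1) * p = p * (Num.sqrt (2 ^+ J.+1) ^+ 2) / Num.sqrt (2 ^+ J.+1).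
    by field; rewrite gt_eqF.
  rewrite sqr_sqrtr ?exprn_ge0// -[X in 8 * X]mulr_natl natrX exprS.
  rewrite le_eqVlt; apply/orP; left; apply/eqP; field.
  by rewrite -exprS gt_eqF.
by rewrite ler_pM2l// ler_sum_nat.
Qed.

End entropy_integral.

(** * The points and the scale of the limit *)

Section dyadic_points.
Variables (R : realType) (N : nat) (t0 : 'rV[R]_N).
Hypothesis N0 : (0 < N)%N.
Local Notation mesh m := (N%:R * 2 ^+ m : R).

(** An enumeration of the grid points of all meshes: a countable set that is dense
and contains every projection [gproj t0 m t]. *)
Definition dyadic_point (i : nat) : 'rV[R]_N :=
  if unpickle i is Some (m, z) then
    \row_k (t0 ord0 k + ((z : {ffun 'I_N -> int}) k)%:~R / mesh m)
  else t0.

Lemma trunc0_intr (x : R) : exists z : int, trunc0 x = z%:~R.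
Proof.
have [x0|x0] := leP 0 x.
  by exists (Num.truncn x)%:Z; rewrite trunc0_ge0.
exists (- (Num.truncn (- x))%:Z); rewrite -[x in LHS]opprK trunc0N mulrNz.
by rewrite trunc0_ge0// oppr_ge0 ltW.
Qed.

Lemma intr_trunc0 (z : int) : trunc0 (z%:~R : R) = z%:~R.
Proof.
have pos (n : nat) : trunc0 (n%:R : R) = n%:R by rewrite trunc0_ge0// natrK.
case: (intP z) => [|n|n]; first exact: (pos 0%N).
  exact: (pos n.+1).
by rewrite mulrNz trunc0N; congr (- _); exact: (pos n.+1).
Qed.

Lemma gproj_dyadic_point m t : exists i, dyadic_point i = gproj t0 m t.
Proof.
have h k := trunc0_intr (mesh m * (t ord0 k - t0 ord0 k)).
pose z := [ffun k => sval (cid (h k))] : {ffun 'I_N -> int}.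
exists (pickle (m, z)); rewrite /dyadic_point pickleK.
by apply/rowP => k; rewrite !mxE ffunE; case: cid => /= y ->.
Qed.

Lemma dyadic_point_gproj i : exists m0, forall m, (m0 <= m)%N ->
  gproj t0 m (dyadic_point i) = dyadic_point i.
Proof.
rewrite /dyadic_point; case: unpickle => [[m0 z]|].
  exists m0 => m mm; apply/rowP => k; rewrite !mxE.
  rewrite [X in mesh m * X]addrC addKr.
  have n0 : N%:R != 0 :> R by rewrite pnatr_eq0 -lt0n.
  have p0 q : (2 : R) ^+ q != 0 by rewrite expf_neq0.
  have e : mesh m * ((z k)%:~R / mesh m0) = (z k * (2 ^ (m - m0))%:Z)%:~R.
    rewrite -(subnK mm) addnK exprD intrM -pmulrn natrX; field.
    by rewrite n0 p0.
  rewrite e intr_trunc0 -e; congr (_ + _).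
  by field; rewrite n0 !p0.
exists 0%N => m _; apply/rowP => k; rewrite !mxE subrr mulr0.
by rewrite trunc0_ge0// truncn0 mul0r addr0.
Qed.

Lemma cvg_gproj t : gproj t0 m t @[m --> \oo] --> t.
Proof.
apply/cvg_ballP => e e0; near=> m.
split => // i j; rewrite ord1 -ball_normE /=.
have := gproj_dist_coord N0 t0 m t j; rewrite !mxE => /le_lt_trans; apply.
have h : 2 ^- m < e.
  rewrite -[ltRHS]invrK ltf_pV2 ?posrE ?exprn_gt0 ?invr_gt0//.
  apply: (lt_le_trans (truncnS_gt e^-1)); rewrite -natrX ler_nat.
  apply: (@leq_trans m); last by rewrite ltnW// ltn_expl.
  by near: m; exact: nbhs_infty_ge.
apply: le_lt_trans h; rewrite ler_pdivrMr ?ltr0n// ler_peMr ?ler1n//.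
Unshelve. all: by end_near. Qed.

Lemma cvg_enorm_gproj t : enorm (gproj t0 m t - t0) @[m --> \oo] --> enorm (t - t0).
Proof.
rewrite /enorm; apply: continuous_cvg; first exact: sqrt_continuous.
apply: (@cvg_big R^o 'I_N +%R 0 xpredT) => [|i _]; first exact: add_continuous.
have ci : (gproj t0 m t - t0) ord0 i @[m --> \oo] --> (t - t0) ord0 i.
  apply/cvgrPdist_le => e e0; near=> m.
  have := gproj_dist_coord N0 t0 m t i; rewrite !mxE => h.
  rewrite opprB addrA subrK; apply: (le_trans h).
  have h2 : 2 ^- m <= e.
    rewrite -[leRHS]invrK lef_pV2 ?posrE ?exprn_gt0 ?invr_gt0//.
    apply: (le_trans (ltW (truncnS_gt e^-1))); rewrite -natrX ler_nat.
    apply: (@leq_trans m); last by rewrite ltnW// ltn_expl.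
    by near: m; exact: nbhs_infty_ge.
  by apply: le_trans h2; rewrite ler_pdivrMr ?ltr0n// ler_peMr ?ler1n.
by under eq_fun do rewrite expr2; rewrite expr2; exact: cvgM.
Unshelve. all: by end_near. Qed.

End dyadic_points.

Section modulus.
Variables (R : realType) (phi : R -> R).
Hypothesis phi_gt0 : forall r : R, 0 < r -> 0 < phi r.
Hypothesis phi_ge0 : forall r : R, 0 <= r -> 0 <= phi r.
Hypothesis phi_mono : forall r s : R, 0 <= r -> r <= s -> phi r <= phi s.
Hypothesis phi_cont : {within `[0, +oo[, continuous phi}.

Definition lil_scale (r : R) : R := phi r * Num.sqrt (ln (ln (1 / r))).

Lemma ln2_ge : 2^-1 <= ln 2 :> R.
Proof.
have := @le_ln1Dx R (- 2^-1); rewrite (_ : 1 + - 2^-1 = 2^-1); last by field.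
by rewrite lnV ?posrE// lerN2; apply; lra.
Qed.

(** Below 2^-3 the iterated logarithm is positive, so that dividing by the scale is
meaningful. *)
Lemma loglog_gt1 (r : R) : 0 < r -> r <= 2 ^- 3 -> 1 < ln (1 / r).
Proof.
move=> r0 r8; apply: (@lt_le_trans _ _ (ln (2 ^+ 3))).
  by rewrite lnXn//; have := ln2_ge; rewrite -[ln 2 *+ 3]mulr_natl; lra.
rewrite ler_ln ?posrE ?divr_gt0 ?exprn_gt0// div1r -[leLHS]invrK lef_pV2//.
by rewrite posrE invr_gt0 exprn_gt0.
Qed.

Lemma lil_scale_gt0 (r : R) : 0 < r -> r <= 2 ^- 3 -> 0 < lil_scale r.
Proof.
move=> r0 r8; rewrite mulr_gt0 ?phi_gt0// sqrtr_gt0 ln_gt0//.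
exact: loglog_gt1.
Qed.

Lemma lil_scale_continuous (r : R) : 0 < r -> r <= 2 ^- 3 ->
  {for r, continuous lil_scale}.
Proof.
move=> r0 r8; have l1 := loglog_gt1 r0 r8.
have cphi : {for r, continuous phi}.
  have := phi_cont; move/continuous_within_itvcyP => [/(_ r) h _].
  by apply: h; rewrite in_itv/= r0.
apply: cvgM; first exact: cphi.
apply: continuous_cvg; first exact: sqrt_continuous.
apply: continuous_cvg; first by apply: continuous_ln; rewrite (lt_trans ltr01).
apply: continuous_cvg; first by apply: continuous_ln; rewrite divr_gt0.
by apply: cvgM; [exact: cvg_cst|apply: cvgV; [rewrite gt_eqF|exact: cvg_id]].
Qed.

End modulus.

(** * The event that the limsup is small *)

Section iterated_logarithm.
Variables (d : measure_display) (T : measurableType d) (R : realType)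
  (P : probability T R) (L : set (T -> R)).
Hypothesis gL : gaussian_space P L.
Variables (N : nat) (X : 'rV[R]_N -> T -> R) (lo hi t0 : 'rV[R]_N).
Hypothesis N0 : (0 < N)%N.
Hypothesis LX : forall t, L (X t).
Hypothesis X_cont : forall w, continuous (fun t => X t w).
Hypothesis t0I : box lo hi t0.
Variables (phi : R -> R) (C : R).
Hypothesis C0 : 0 < C.
Hypothesis phi_gt0 : forall r : R, 0 < r -> 0 < phi r.
Hypothesis phi_ge0 : forall r : R, 0 <= r -> 0 <= phi r.
Hypothesis phi_mono : forall r s : R, 0 <= r -> r <= s -> phi r <= phi s.
Hypothesis phi_cont : {within `[0, +oo[, continuous phi}.
Hypothesis varX : forall t s, box lo hi t -> box lo hi s ->
  \int[P]_w ((X t w - X s w) ^+ 2) <= (C * phi (enorm (t - s))) ^+ 2.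

Local Notation dyadic := (dyadic_point t0).
Local Notation scale := (lil_scale phi).

Definition dyadic_ball (n : nat) : set nat :=
  [set i | box lo hi (dyadic i) /\ 0 < enorm (dyadic i - t0) <= 2 ^- n].

Definition lil_ratio (i : nat) (w : T) : R :=
  (scale (enorm (dyadic i - t0)))^-1 * (X (dyadic i) w + -1 * X t0 w).

Local Notation limsup_event := (limsup_le lil_ratio dyadic_ball).

Lemma exprN2_le (m n : nat) : (m <= n)%N -> 2 ^- n <= 2 ^- m :> R.
Proof. by move=> mn; rewrite lef_pV2 ?posrE ?exprn_gt0// ler_weXn2l// ler1n. Qed.

Lemma dyadic_ball_decreasing (n m : nat) : (n <= m)%N -> dyadic_ball m `<=` dyadic_ball n.
Proof.
move=> nm i [bi /andP[i0 im]]; split => //.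
by rewrite i0 (le_trans im)// exprN2_le.
Qed.

Lemma lil_ratio_in i : L (lil_ratio i).
Proof. by case: gL => LD LZ _; exact: (LZ _ _ (LD _ _ (LX _) (LZ _ _ (LX _)))). Qed.

Lemma normr_lil_ratio i w : dyadic_ball 3 i ->
  `|lil_ratio i w| = `|X (dyadic i) w - X t0 w| / scale (enorm (dyadic i - t0)).
Proof.
move=> [_ /andP[i0 i8]]; have s0 := lil_scale_gt0 phi_gt0 i0 i8.
by rewrite /lil_ratio normrM mulN1r normfV (gtr0_norm s0) mulrC.
Qed.

Lemma lil_ratio_le i w (q : R) : dyadic_ball 3 i ->
  (`|lil_ratio i w| <= q) =
  (`|X (dyadic i) w - X t0 w| <= q * scale (enorm (dyadic i - t0))).
Proof.
move=> Si; rewrite normr_lil_ratio//; have [_ /andP[i0 i8]] := Si.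
by rewrite ler_pdivrMr// lil_scale_gt0.
Qed.

(** The projections of t are dyadic points of the same ball that converge to t; the
path and the scale are continuous there. *)
Lemma dyadic_to_all w (q : R) n : (3 <= n)%N ->
  (forall i, dyadic_ball n i -> `|lil_ratio i w| <= q) ->
  forall t, box lo hi t -> 0 < enorm (t - t0) <= 2 ^- n ->
  `|X t w - X t0 w| <= q * scale (enorm (t - t0)).
Proof.
move=> n3 h t bt /andP[t0' tn].
have t8 : enorm (t - t0) <= 2 ^- 3 by rewrite (le_trans tn)// exprN2_le.
have cX0 : X (gproj t0 m t) w @[m --> \oo] --> X t w.
  exact: (cvg_comp (fun m => gproj t0 m t) (fun t => X t w) (@cvg_gproj _ _ t0 N0 t) (@X_cont w t)).
have cX : `|X (gproj t0 m t) w - X t0 w| @[m --> \oo] --> `|X t w - X t0 w|.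
  by apply: cvg_norm; apply: (@cvgB _ R^o); [exact: cX0|exact: cvg_cst].
have cen := @cvg_enorm_gproj _ _ t0 N0 t.
have cs : q * scale (enorm (gproj t0 m t - t0)) @[m --> \oo] -->
    q * scale (enorm (t - t0)).
  apply: cvgM; first exact: cvg_cst.
  by apply: continuous_cvg; [exact: lil_scale_continuous|exact: cen].
apply: (ler_cvg_to cX cs); near=> m.
have [i iE] := gproj_dyadic_point t0 m t.
have Si : dyadic_ball n i.
  rewrite /dyadic_ball /= iE; split; first exact: gproj_box.
  rewrite (le_trans (enorm_gproj_le N0 t0 m t) tn) andbT.
  by near: m; apply: cvgr_gt cen _ t0'.
have := h i Si; rewrite (lil_ratio_le _ _ (dyadic_ball_decreasing n3 Si)).
by rewrite iE.
Unshelve. all: by end_near. Qed.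

Lemma loglog_pow2 (r : R) (n : nat) : 0 < r -> (0 < n)%N -> r <= 2 ^- n ->
  ln (n%:R / 2) <= ln (ln (1 / r)).
Proof.
move=> r0 n0 rn; have n0R : 0 < n%:R :> R by rewrite ltr0n.
have h : n%:R / 2 <= ln (1 / r).
  apply: (@le_trans _ _ (ln (2 ^+ n))).
    by rewrite lnXn// -[leRHS]mulr_natl ler_wpM2l// ln2_ge.
  rewrite ler_ln ?posrE ?divr_gt0 ?exprn_gt0// div1r -[leLHS]invrK lef_pV2//.
  by rewrite posrE invr_gt0 exprn_gt0.
by rewrite ler_ln ?posrE ?divr_gt0// (lt_le_trans _ h)// divr_gt0.
Qed.

Lemma var_increment t s : \int[P]_w ((X t w + -1 * X s w) * (X t w + -1 * X s w)) =
  \int[P]_w ((X t w - X s w) ^+ 2).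
Proof. by apply: eq_Rintegral => w _; rewrite mulN1r expr2. Qed.

(** The variance of the normalized increment is at most C^2 / log log (1/r): the
iterated logarithm in the scale makes it vanish at t0. *)
Lemma lil_ratio_var (e : R) : 0 < e -> exists n, forall i, dyadic_ball n i ->
  \int[P]_w (lil_ratio i w * lil_ratio i w) <= e.
Proof.
move=> e0; have [LD LZ _] := gL.
pose n := maxn 3 (2 * (Num.truncn (expR (C ^+ 2 / e))).+1).
exists n => i Si; have Si3 := dyadic_ball_decreasing (leq_maxl _ _) Si.
have [bi /andP[i0 i8]] := Si3; have [_ /andP[_ ein]] := Si.
have s0 := lil_scale_gt0 phi_gt0 i0 i8.
have Ldiff := LD _ _ (LX (dyadic i)) (LZ (-1) _ (LX t0)).
have Lc := LZ (scale (enorm (dyadic i - t0)))^-1 _ Ldiff.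
rewrite /lil_ratio (covZl gL)// (covC P (fun w => _ + _)) (covZl gL)//.
rewrite var_increment mulrA -expr2.
set r := enorm _ in i0 i8 ein s0 *.
have ph : 0 < phi r by exact: phi_gt0.
have ll : C ^+ 2 / e <= ln (ln (1 / r)).
  apply: (le_trans _ (loglog_pow2 i0 _ ein)); last by rewrite /n leq_max.
  rewrite -[leLHS]expRK ler_ln ?posrE ?expR_gt0//; last first.
    by rewrite divr_gt0// ltr0n /n leq_max.
  rewrite ler_pdivlMr// mulrC; apply: (@le_trans _ _ (2 * (Num.truncn (expR (C ^+ 2 / e))).+1)%:R).
    by rewrite natrM ler_pM2l// ltW// truncnS_gt.
  by rewrite ler_nat leq_maxr.
have ll0 : 0 < ln (ln (1 / r)) by rewrite ln_gt0// loglog_gt1.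
apply: (le_trans (ler_wpM2l _ (varX bi t0I))); first by rewrite sqr_ge0.
rewrite -/r /lil_scale exprMn exprVn [X in X^-1]exprMn sqr_sqrtr ?(ltW ll0)//.
rewrite invfM (_ : _ * _ = C ^+ 2 / ln (ln (1 / r))); last first.
  by field; rewrite !gt_eqF.
by rewrite ler_pdivrMr// mulrC -ler_pdivrMr.
Qed.

Lemma limsup_event_zero_one (q : R) : P (limsup_event q) = 0%E \/ P (limsup_event q) = 1%E.
Proof.
apply: (gaussian_limsup_zero_one gL); first exact: lil_ratio_in.
  exact: dyadic_ball_decreasing.
exact: lil_ratio_var.
Qed.

Lemma measurable_limsup_event (q : R) : measurable (limsup_event q).
Proof.
have linL := gaussian_space_linear gL.
apply: (multiplier_sigma P linL _).1.
by apply: (sigma_limsup_le) => //; exact: lil_ratio_in.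
Qed.

Lemma limsup_event_mono (q q' : R) : q <= q' -> limsup_event q `<=` limsup_event q'.
Proof.
move=> qq w h k; have [n hn] := h k; exists n => i Si.
by rewrite (le_trans (hn i Si))// lerD2r.
Qed.

(** * Upper bound *)

Lemma dyadic_shell (r : R) n : 0 < r -> r <= 2 ^- n ->
  exists n', [/\ (n <= n')%N, 2 ^- n'.+1 < r & r <= 2 ^- n'].
Proof.
move=> r0 rn.
have ex : exists m, 2 ^- m.+1 < r.
  exists (Num.truncn r^-1); rewrite -[ltRHS]invrK ltf_pV2 ?posrE ?exprn_gt0 ?invr_gt0//.
  apply: (lt_le_trans (truncnS_gt _)); rewrite -natrX ler_nat ltnW//.
  exact: ltn_expl.
case: (ex_minnP ex) => m mr mmin; exists m; split => //.
  rewrite leqNgt; apply/negP => mn; move: mr; apply/negP; rewrite -leNgt.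
  by rewrite (le_trans rn)// exprN2_le.
case: m mr mmin => [|m] mr mmin.
  by rewrite (le_trans rn)// exprN2_le.
by rewrite leNgt; apply/negP => /mmin; rewrite ltnn.
Qed.

(** The least admissible first level satisfies 2^(2^(j0 - 1)) <= n, so that 2^j0 is at
most of the order of log n, which is the order of log log 2^n. The condition
4 <= n gives n / 2 >= sqrt n, used to compare log n with log(n log 2). *)
Lemma chaining_start n : (4 <= n)%N -> exists j0,
  [/\ (0 < j0)%N, (n < 2 ^ (2 ^ j0))%N &
      Num.sqrt (2 ^+ j0) <= 3 * Num.sqrt (ln (ln (1 / 2 ^- n))) :> R].
Proof.
move=> n4; have n0R : 0 < n%:R :> R by rewrite ltr0n (leq_trans _ n4).
have ex : exists j, (n < 2 ^ (2 ^ j))%N.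
  by exists n; rewrite (ltn_trans (ltn_expl n (ltnSn 1)))// ltn_exp2l// ltn_expl.
case: (ex_minnP ex) => -[|j] nj jmin; first by rewrite expn0 expn1 in nj; lia.
exists j.+1; split => //.
have lej : (2 ^ (2 ^ j) <= n)%N.
  by rewrite leqNgt; apply/negP => /jmin; rewrite ltnn.
have h1 : 2 ^+ j * ln 2 <= ln n%:R :> R.
  rewrite -[X in X * _]natrX [leLHS]mulr_natl -lnXn// ler_ln ?posrE ?exprn_gt0//.
  by rewrite -natrX ler_nat.
have h2 : ln n%:R <= 2 * ln (ln (1 / 2 ^- n)) :> R.
  have n2 : 2^-1 * n%:R <= ln (1 / 2 ^- n) :> R.
    rewrite div1r invrK lnXn// -[leRHS]mulr_natl mulrC ler_wpM2l//.
    exact: ln2_ge.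
  have m0 : 0 < 2^-1 * n%:R :> R by rewrite mulr_gt0.
  have : ln (2^-1 * n%:R) <= ln (ln (1 / 2 ^- n)) :> R.
    by rewrite ler_ln ?posrE// (lt_le_trans m0).
  have : ln (2 ^+ 2) <= ln n%:R :> R by rewrite ler_ln ?posrE// -natrX ler_nat.
  rewrite lnXn// lnM ?posrE// lnV ?posrE// -[ln 2 *+ 2]mulr_natl.
  by move=> *; lra.
have j0 : 0 < 2 ^+ j :> R by rewrite exprn_gt0.
have h3 : 2 ^+ j.+1 <= 8 * ln (ln (1 / 2 ^- n)) :> R.
  rewrite exprS; have : 2 ^+ j * 2^-1 <= 2 ^+ j * ln 2 :> R.
    by rewrite ler_wpM2l ?ln2_ge// ltW.
  by lra.
have -> : 3 = Num.sqrt (3 ^+ 2) :> R by rewrite sqrtr_sqr ger0_norm.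
rewrite -sqrtrM ?exprn_ge0//; apply: ler_wsqrtr.
have ll0 : 0 <= ln (ln (1 / 2 ^- n)) :> R.
  have : 0 < 2 ^+ j.+1 :> R by exact: exprn_gt0.
  by lra.
by apply: (le_trans h3); rewrite ler_wpM2r//; lra.
Qed.

(** Off the bad events the bound holds for every dyadic point near t0, and these
events have probability at most 1/3, so that the limsup event is not null; the
zero-one law does the rest. *)
Lemma exists_limsup_bound (kappa C' h0 : R) : 0 < kappa -> 0 <= C' -> 0 < h0 ->
  (forall r, 0 < r <= h0 -> phi r <= kappa * phi (r / 2)) ->
  (forall h, 0 < h <= h0 ->
    (\int[lebesgue_measure]_(r in `]0%R, 1%R])
       (phi (h * r) / (r * Num.sqrt (ln (2 / r))))%:E <=
     (C' * (phi h * Num.sqrt (ln (ln (1 / h)))))%:E)%E) ->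
  exists Q, P (limsup_event Q) = 1%E.
Proof.
move=> k0 C'0 h00 doubling integral_le.
have [mb Pb] : (forall j, measurable (bad X lo hi t0 phi C j)) /\
    (forall j, (P (bad X lo hi t0 phi C j) <= (4 ^- j.+1)%:E)%E).
  by split => j; have [] := probability_bad gL t0 N0 LX C0 phi_gt0 phi_ge0 phi_mono varX j.
have PU := probability_countable_union_quarter mb Pb.
have mU : measurable (\bigcup_j bad X lo hi t0 phi C j) by exact: bigcup_measurable.
have F0 : 0 <= chaining_factor R N * C.
  by rewrite mulr_ge0 ?(ltW C0)// mulr_ge0// sqrtr_ge0.
pose Q := chaining_factor R N * C * (3 + 8 * C') * kappa; exists Q.
have p2 m : 0 < 2 ^- m :> R by rewrite invr_gt0 exprn_gt0.
suff sub : ~` (\bigcup_j bad X lo hi t0 phi C j) `<=` limsup_event Q.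
  case: (limsup_event_zero_one Q) => // Z0.
  have : (P (~` (\bigcup_j bad X lo hi t0 phi C j)) <= 0)%E.
    by rewrite -Z0 le_measure ?inE//; [exact: measurableC|exact: measurable_limsup_event].
  rewrite probability_setC// sube_le0 => /le_trans /(_ PU).
  by move=> h; exfalso; move: h; rewrite lee_fin; lra.
move=> w wgood k.
pose n := maxn 4 (Num.truncn h0^-1); exists n => i [bi /andP[i0 iN]].
have n4 : (4 <= n)%N by exact: leq_maxl.
suff : `|lil_ratio i w| <= Q by move=> /le_trans; apply; rewrite lerDl invr_ge0.
have Si3 : dyadic_ball 3 i.
  by split => //; rewrite i0 (le_trans iN)// exprN2_le// (leq_trans _ n4).
rewrite lil_ratio_le//.
set r := enorm _ in i0 iN *.
(* The chain starts at the dyadic scale 2^-n' of the point itself, and J is taken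
   so large that the point is on the last grid. *)
have [n' [nn' n'r rn']] := dyadic_shell i0 iN.
have n'4 : (4 <= n')%N := leq_trans n4 nn'.
have [j0 [j0p n'j0 sj0]] := chaining_start n'4.
have [m0 fixm0] := dyadic_point_gproj t0 N0 i.
have := chain_bound N0 t0I wgood n'j0 bi rn' (leq_maxl j0 m0).
set J := maxn j0 m0; rewrite fixm0; last first.
  rewrite (leq_trans (leq_maxr j0 m0))// (leq_trans _ (leq_addl _ _))// ltnW//.
  exact: ltn_expl.
move=> /le_trans; apply.
have hh0 : 2 ^- n' <= h0.
  apply: le_trans (exprN2_le nn') _.
  rewrite -[leRHS]invrK lef_pV2 ?posrE ?exprn_gt0 ?invr_gt0//.
  apply: ltW (lt_le_trans (truncnS_gt _) _).
  rewrite -natrX ler_nat (leq_ltn_trans (leq_maxr 4 _))//; exact: ltn_expl.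
set ell := Num.sqrt (ln (ln (1 / 2 ^- n'))) in sj0.
have ell0 : 0 <= ell by exact: sqrtr_ge0.
have sum_le : \sum_(j0 <= j < J) Num.sqrt (2 ^+ j) * phi (2 ^- (n' + 2 ^ j)) <=
    8 * (C' * (phi (2 ^- n') * ell)).
  apply: (@le_trans _ _ (\sum_(1 <= j < J.+1) Num.sqrt (2 ^+ j) * phi (2 ^- n' * 2 ^- (2 ^ j)))).
    have t_ge0 j : 0 <= Num.sqrt (2 ^+ j) * phi (2 ^- n' * 2 ^- (2 ^ j)).
      by rewrite mulr_ge0 ?sqrtr_ge0// phi_ge0// mulr_ge0 ?ltW.
    have j0J : (j0 <= J.+1)%N by rewrite leqW// leq_maxl.
    rewrite (big_cat_nat j0p j0J)/= big_nat_recr ?leq_maxl//=.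
    under eq_bigr do rewrite exprD invfM.
    rewrite addrCA lerDl addr_ge0//.
    by rewrite sumr_ge0.
  apply: le_trans (dyadic_condensation phi_ge0 phi_mono J (p2 n')) _.
  rewrite ler_wpM2l// -lee_fin.
  apply: le_trans (entropy_integral_sum phi_ge0 phi_mono (2 ^ J) (p2 n')) _.
  by apply: integral_le; rewrite p2.
have ph0 : 0 <= phi (2 ^- n') by rewrite phi_ge0// ltW.
have step1 : Num.sqrt (2 ^+ j0) * phi (2 ^- n') +
   \sum_(j0 <= j < J) Num.sqrt (2 ^+ j) * phi (2 ^- (n' + 2 ^ j)) <=
   (3 + 8 * C') * (phi (2 ^- n') * ell).
  rewrite mulrDl; apply: lerD; last by rewrite -mulrA.
  by rewrite [leRHS]mulrCA mulrC ler_wpM2l.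
apply: (le_trans (ler_wpM2l F0 step1)).
rewrite /Q -[leRHS]mulrA -[leRHS]mulrA; apply: ler_wpM2l => //.
apply: ler_wpM2l; first by rewrite addr_ge0// mulr_ge0.
rewrite /lil_scale mulrA; apply: ler_pM => //.
  apply: le_trans (doubling _ _) _; first by rewrite p2.
  apply: (ler_wpM2l (ltW k0)); apply: phi_mono; first by rewrite divr_ge0// ltW.
  by rewrite -invfM -exprSr ltW.
apply: ler_wsqrtr.
have l1 : 1 < ln (1 / 2 ^- n') :> R.
  by rewrite loglog_gt1// exprN2_le// (leq_trans _ n'4).
have l2 : ln (1 / 2 ^- n') <= ln (1 / r).
  have lr : 1 / 2 ^- n' <= 1 / r by rewrite !div1r lef_pV2// posrE.
  by rewrite ler_ln// posrE div1r invr_gt0.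
by rewrite ler_ln ?posrE ?(lt_trans ltr01 (lt_le_trans l1 l2))// (lt_trans ltr01).
Qed.

(** * Lower bound *)

(** With standard deviations at least c1 phi(a^-n), a limsup of at most c confines the
standardized increments at t_n, for all large n, to
|xi_n| <= (2 c / c1) sqrt(log(n log a)). For c = c1 (1 - rho) / 16 this is the null
event of [gaussian_confined_null]. *)
Lemma limsup_event_null (c1 rho a : R) (n0 : nat) (t_ : nat -> 'rV[R]_N) :
  0 < c1 -> 0 <= rho -> rho < 1 -> 1 < a ->
  (forall n, (n0 <= n)%N -> box lo hi (t_ n)) ->
  (forall n, (n0 <= n)%N -> enorm (t_ n - t0) = a ^- n) ->
  (forall n, (n0 <= n)%N ->
     (c1 * phi (a ^- n)) ^+ 2 <= \int[P]_w ((X (t_ n) w - X t0 w) ^+ 2)) ->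
  (forall m n, (n0 <= n)%N -> (n < m)%N ->
     (\int[P]_w ((X (t_ n) w + -1 * X t0 w) * (X (t_ m) w + -1 * X t0 w))) ^+ 2 <=
     rho ^+ 2 * \int[P]_w ((X (t_ n) w - X t0 w) ^+ 2)
              * \int[P]_w ((X (t_ m) w - X t0 w) ^+ 2)) ->
  P (limsup_event (c1 * (1 - rho) / 16)) = 0%E.
Proof.
move=> c10 rho0 rho1 a1 t_box t_norm var_ge cov_le.
have [LD LZ _] := gL.
set c := c1 * (1 - rho) / 16.
have c0 : 0 < c by rewrite divr_gt0// mulr_gt0// subr_gt0.
have lna : 0 < ln a by rewrite ln_gt0.
have a0 : 0 < a := lt_trans ltr01 a1.
pose Y n w := X (t_ n) w + -1 * X t0 w.
have LY n : L (Y n) by exact: (LD _ _ (LX _) (LZ _ _ (LX _))).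
pose V n := \int[P]_w ((X (t_ n) w - X t0 w) ^+ 2).
have VE n : \int[P]_w (Y n w * Y n w) = V n by exact: var_increment.
have pa n : 0 < phi (a ^- n) by rewrite phi_gt0// invr_gt0 exprn_gt0.
have V0 n : (n0 <= n)%N -> 0 < V n.
  by move=> nn; apply: lt_le_trans (var_ge n nn); rewrite exprn_gt0// mulr_gt0.
pose sg n := Num.sqrt (V n).
have sg0 n : (n0 <= n)%N -> 0 < sg n by move=> nn; rewrite sqrtr_gt0 V0.
have sgV n : (n0 <= n)%N -> sg n ^+ 2 = V n.
  by move=> nn; rewrite sqr_sqrtr// ltW// V0.
have sg_ge n : (n0 <= n)%N -> c1 * phi (a ^- n) <= sg n.
  move=> nn; rewrite -(@ler_pXn2r _ 2)// ?nnegrE ?sqrtr_ge0//; last first.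
    by rewrite mulr_ge0// ltW.
  by rewrite sgV// var_ge.
pose xi n w := (sg n)^-1 * Y n w.
have Lxi n : L (xi n) by exact: LZ.
have covxi n m : \int[P]_w (xi n w * xi m w) =
    (sg n)^-1 * (sg m)^-1 * \int[P]_w (Y n w * Y m w).
  rewrite /xi (covZl gL)//; last exact: Lxi.
  by rewrite covC (covZl gL)// mulrA covC.
(* The shift by p0 makes all indices admissible and all logarithms positive. *)
pose p0 := maxn n0 (Num.truncn (ln a)^-1).+1.
have p0n0 : (n0 <= p0)%N by exact: leq_maxl.
have p0a : 1 < p0%:R * ln a.
  rewrite -ltr_pdivrMr// div1r; apply: (lt_le_trans (truncnS_gt _)).
  by rewrite ler_nat leq_maxr.
pose A p := \bigcap_i [set w | `|xi (p + p0 + i)%N w| <=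
  (1 - rho) / 8 * Num.sqrt (ln ((p + p0 + i)%:R * ln a))].
have A_null p : P (A p) = 0%E.
  have le_n0 i : (n0 <= p + p0 + i)%N.
    by rewrite (leq_trans p0n0)// (leq_trans (leq_addl p p0))// leq_addr.
  apply: (@gaussian_confined_null _ _ _ P L (fun i => xi (p + p0 + i)%N) rho) => //.
  - by move=> i; rewrite covxi VE -sgV// expr2; field; rewrite gt_eqF// sg0.
  - move=> i j ij; rewrite covxi.
    wlog lt_ij : i j ij / (i < j)%N => [hw|].
      move: (ij); rewrite neq_ltn => /orP[/hw|ji]; first exact.
      by rewrite covC [X in X * _]mulrC hw// eq_sym.
    have si := sg0 _ (le_n0 i); have sj := sg0 _ (le_n0 j).
    rewrite -invfM normrM normfV (gtr0_norm (mulr_gt0 si sj)) mulrC.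
    rewrite ler_pdivrMr ?mulr_gt0// -(@ler_pXn2r _ 2)// ?nnegrE//; last first.
      by rewrite mulr_ge0// ltW// mulr_gt0.
    rewrite real_normK ?num_real// 2!exprMn !sgV// mulrA; apply: cov_le => //.
    by rewrite ltn_add2l.
  - apply: (lt_le_trans p0a); rewrite ler_wpM2r ?(ltW lna)// ler_nat.
    exact: leq_addl.
have mA p : measurable (A p).
  apply: bigcapT_measurable => i.
  apply: (multiplier_sigma P (gaussian_space_linear gL) _).1.
  by apply: sigma_of_family_norm_le => //; exact: gaussian_space_linear gL.
have negA : P.-negligible (\bigcup_p A p).
  apply: negligible_bigcup => p; exists (A p).
  by split; [exact: mA|exact: A_null|].
apply: measure_negligible; first exact: measurable_limsup_event.
apply: negligibleS negA => w /= wE.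
pose k := Num.truncn c^-1.
have kc : k.+1%:R^-1 <= c.
  by rewrite invf_ple ?posrE ?ltr0n// ltW// truncnS_gt.
have [n hn] := wE k.
pose n3 := maxn 3 n.
have h t : box lo hi t -> 0 < enorm (t - t0) <= 2 ^- n3 ->
    `|X t w - X t0 w| <= (c + c) * scale (enorm (t - t0)).
  apply: dyadic_to_all; first exact: leq_maxl.
  move=> i Si; apply: le_trans (hn i _) _; last by rewrite lerD2l.
  exact: (dyadic_ball_decreasing (leq_maxr 3 n) Si).
have [p hp] : exists p, forall m, (p <= m)%N -> a ^- m <= 2 ^- n3.
  have la1 : 0 < ln a / n3.+1%:R by rewrite divr_gt0// ltr0n.
  exists (n3 * (Num.truncn (ln a)^-1).+1)%N => m pm.
  rewrite lef_pV2 ?posrE ?exprn_gt0//.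
  rewrite -ler_ln ?posrE ?exprn_gt0// !lnXn//.
  rewrite -[leLHS]mulr_natl -[leRHS]mulr_natl.
  apply: (@le_trans _ _ (n3%:R * 1)).
    by rewrite ler_wpM2l//; have := @le_ln1Dx R 1; apply; lra.
  apply: (@le_trans _ _ ((n3 * (Num.truncn (ln a)^-1).+1)%:R * ln a)).
    rewrite natrM -mulrA ler_wpM2l// -ler_pdivrMr// div1r ltW//.
    exact: truncnS_gt.
  by rewrite ler_wpM2r ?(ltW lna)// ler_nat.
exists p => // i _ /=.
set j := (p + p0 + i)%N.
have pj : (p <= j)%N by rewrite /j -addnA leq_addr.
have jn0 : (n0 <= j)%N.
  by rewrite (leq_trans p0n0)// (leq_trans (leq_addl p p0))// leq_addr.
have := h (t_ j) (t_box j jn0).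
rewrite t_norm// hp// invr_gt0 exprn_gt0// => /(_ isT) hj.
have sj := sg0 j jn0.
rewrite /xi normrM normfV (gtr0_norm sj) mulrC ler_pdivrMr// /Y mulN1r.
apply: (le_trans hj).
rewrite /lil_scale div1r invrK lnXn// -[ln a *+ j]mulr_natl.
set s := Num.sqrt _; have s0 : 0 <= s by exact: sqrtr_ge0.
rewrite (_ : (c + c) * _ = (1 - rho) / 8 * s * (c1 * phi (a ^- j))).
  by rewrite ler_wpM2l ?sg_ge// mulr_ge0// divr_ge0// subr_ge0 ltW.
by rewrite /c; field.
Qed.

(** * The almost sure limit *)

(** The events increase with q, so the infimum of the q with probability one is a
threshold; it lies between c and Q. *)
Lemma exists_lil_constant (Q c : R) : 0 < c ->
  P (limsup_event Q) = 1%E -> P (limsup_event c) = 0%E ->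
  exists2 K : R, 0 < K & forall q : R,
    (K < q -> P (limsup_event q) = 1%E) /\ (q < K -> P (limsup_event q) = 0%E).
Proof.
move=> c0 PQ Pc.
pose S := [set q : R | P (limsup_event q) = 1%E].
have le_P q q' : q <= q' -> (P (limsup_event q) <= P (limsup_event q'))%E.
  move=> qq; apply: le_measure; rewrite ?inE; [exact: measurable_limsup_event..|].
  exact: limsup_event_mono.
have lbS : lbound S c.
  move=> q /= Pq; rewrite leNgt; apply/negP => /ltW/le_P.
  by rewrite Pq Pc; apply/negP; rewrite -ltNge lte_fin ltr01.
have hS : has_inf S by split; [exists Q|exists c].
exists (inf S); first by apply: lt_le_trans c0 _; apply: lb_le_inf => //; exists Q.
move=> q; split => [Kq|qK].
  have [q' Sq' q'q] := inf_adherent (eqbRL (subr_gt0 _ _) Kq) hS.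
  rewrite addrC subrK in q'q; apply/eqP; rewrite eq_le probability_le1/=; last first.
    exact: measurable_limsup_event.
  by rewrite -[leLHS]Sq'; exact/le_P/ltW.
case: (limsup_event_zero_one q) => // Pq.
by move: qK; rewrite ltNge => /negP; case; apply: ge_inf => //; exists c.
Qed.

Definition lil_sup (w : T) (h : R) : \bar R :=
  ereal_sup [set (`|X t w - X t0 w| / scale (enorm (t - t0)))%:E
            | t in [set t | box lo hi t /\ 0 < enorm (t - t0) <= h]].

(** The bound on dyadic points extends to all points by [dyadic_to_all]. *)
Lemma lil_sup_le w (q e : R) : 0 < e -> limsup_event q w ->
  \forall h \near 0^'+, (lil_sup w h <= (q + e)%:E)%E.
Proof.
move=> e0 wq.
have [n hn] := wq (Num.truncn e^-1).
have e' : (Num.truncn e^-1).+1%:R^-1 <= e.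
  by rewrite invf_ple ?posrE ?ltr0n// ltW// truncnS_gt.
pose n3 := maxn 3 n.
have h3 t : box lo hi t -> 0 < enorm (t - t0) <= 2 ^- n3 ->
    `|X t w - X t0 w| <= (q + e) * scale (enorm (t - t0)).
  apply: dyadic_to_all; first exact: leq_maxl.
  move=> i Si; apply: le_trans (hn i _) _; last by rewrite lerD2l.
  exact: (dyadic_ball_decreasing (leq_maxr 3 n) Si).
near=> h; apply: ge_ereal_sup => _ [t [bt /andP[t0' th]] <-].
have tn : enorm (t - t0) <= 2 ^- n3.
  by rewrite (le_trans th)//; near: h; apply: nbhs_right_le; rewrite invr_gt0 exprn_gt0.
rewrite lee_fin ler_pdivrMr; first by apply: h3; rewrite // t0'.
by rewrite lil_scale_gt0// (le_trans tn)// exprN2_le// leq_maxl.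
Unshelve. all: by end_near. Qed.

(** If the limsup exceeds q, then every ball around t0 contains a dyadic point where
the normalized increment exceeds q. *)
Lemma lil_sup_ge w (q h : R) : 0 < h -> ~ limsup_event q w -> (q%:E <= lil_sup w h)%E.
Proof.
move=> h0 /existsNP[k /forallNP wk].
pose n := maxn 3 (Num.truncn h^-1).
have /existsNP[i /not_implyP[Si /negP]] := wk n.
rewrite -ltNge => qi.
have Si3 : dyadic_ball 3 i := dyadic_ball_decreasing (leq_maxl 3 _) Si.
have [bi /andP[i0 iN]] := Si.
apply: (@le_trans _ _ (`|lil_ratio i w|)%:E).
  by rewrite lee_fin (le_trans _ (ltW qi))// lerDl invr_ge0.
apply: ereal_sup_ubound; exists (dyadic i); last by rewrite normr_lil_ratio.
split => //; rewrite i0 (le_trans iN)//.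
rewrite -[leRHS]invrK lef_pV2 ?posrE ?exprn_gt0 ?invr_gt0//.
apply: ltW (lt_le_trans (truncnS_gt _) _).
rewrite -natrX ler_nat (leq_ltn_trans (leq_maxr 3 _))//; exact: ltn_expl.
Qed.

Lemma iterated_logarithm_law (Q c : R) : 0 < c ->
  P (limsup_event Q) = 1%E -> P (limsup_event c) = 0%E ->
  exists K : R, 0 < K /\ {ae P, forall w, lil_sup w h @[h --> 0^'+] --> K%:E}.
Proof.
move=> c0 PQ Pc; have [K K0 PK] := exists_lil_constant c0 PQ Pc.
exists K; split => //.
pose e (k : nat) : R := k.+1%:R^-1.
have e0 k : 0 < e k by rewrite invr_gt0 ltr0n.
have neg1 : P.-negligible (\bigcup_k ~` limsup_event (K + e k)).
  apply: negligible_bigcup => k; exists (~` limsup_event (K + e k)).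
  have mE := measurable_limsup_event (K + e k).
  split; [exact: measurableC| |by []].
  by rewrite /= probability_setC// (PK _).1 ?subee// ltrDl.
have neg0 : P.-negligible (\bigcup_k limsup_event (K - e k)).
  apply: negligible_bigcup => k; exists (limsup_event (K - e k)).
  split; [exact: measurable_limsup_event| |by []].
  by apply: (PK _).2; rewrite gtrBl.
apply: negligibleS (negligibleU neg1 neg0) => w /=.
apply: contra_notP => wgood.
have {wgood} [w1 w0] : (forall k, limsup_event (K + e k) w) /\
    (forall k, ~ limsup_event (K - e k) w).
  split => k; first by apply: contrapT => h; apply: wgood; left; exists k.
  by move=> h; apply: wgood; right; exists k.
have close (d' : R) : 0 < d' -> \forall h \near 0^'+,
    ((K - d')%:E <= lil_sup w h <= (K + d')%:E)%E.
  move=> d'0; pose k := Num.truncn (2 / d').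
  have ek : e k <= d' / 2.
    by rewrite /e invf_ple ?posrE ?divr_gt0 ?ltr0n// invf_div ltW// truncnS_gt.
  near=> h; apply/andP; split.
    apply: le_trans (lil_sup_ge _ (w0 k)); last by near: h; exact: nbhs_right_gt.
    by rewrite lee_fin; lra.
  apply: (@le_trans _ _ (K + e k + d' / 2)%:E); last by rewrite lee_fin; lra.
  by near: h; apply: lil_sup_le => //; rewrite divr_gt0.
apply/fine_cvgP; split.
  near=> h; have : ((K - 1)%:E <= lil_sup w h <= (K + 1)%:E)%E by near: h; exact: close.
  move=> /andP[h1 h2]; rewrite fin_numE; apply/andP; split; apply/eqP => hE.
    by move: h1; rewrite hE.
  by move: h2; rewrite hE.
apply/cvgrPdist_le => d' d'0; near=> h.
have : ((K - d')%:E <= lil_sup w h <= (K + d')%:E)%E by near: h; exact: close.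
rewrite /=; case: (lil_sup w h) => [r| |]; last 2 first.
- by rewrite leye_eq andbF.
- by rewrite leeNy_eq.
by rewrite !lee_fin /= ler_distlC.
Unshelve. all: by end_near. Qed.

End iterated_logarithm.

(** * The span of a Gaussian field; regular variation *)

Section linear_span.
Variables (d : measure_display) (T : measurableType d) (R : realType)
  (P : probability T R) (I : Type) (X : I -> {RV P >-> R}).
Hypotheses (X_gaussian : gaussian_field P X) (X_centered : centered_field P X).

(** Linear combinations are indexed by lists, so that sums are concatenations. *)
Definition linear_span : set (T -> R) :=
  [set f | exists s : seq (R * I), f = fun w => \sum_(p <- s) p.1 * X p.2 w].

Lemma linear_span_generator t : linear_span (X t).
Proof.
exists [:: (1, t)]; apply/funext => w.
by rewrite big_cons big_nil addr0 mul1r.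
Qed.

Lemma linear_span_gaussian f : linear_span f -> is_gaussian P f.
Proof.
move=> [s ->]; rewrite (_ : (fun _ => _) =
    fun w => \sum_(i < size s) (tnth (in_tuple s) i).1 * X (tnth (in_tuple s) i).2 w).
  exact: X_gaussian.
by apply/funext => w; rewrite big_tnth.
Qed.

Lemma linear_span_mean f : linear_span f -> \int[P]_w f w = 0.
Proof.
move=> [s ->]; elim: s => [|p s IH].
  under eq_Rintegral do rewrite big_nil.
  by rewrite Rintegral_probability_cst.
under eq_Rintegral do rewrite big_cons.
rewrite RintegralD//; last 2 first.
- apply: is_gaussian_integrable; apply: linear_span_gaussian; exists [:: p].
  by apply/funext => w; rewrite big_cons big_nil addr0.
- by apply: is_gaussian_integrable; apply: linear_span_gaussian; exists s.
rewrite IH addr0 RintegralZl//; last first.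
  by apply: is_gaussian_integrable; exact/linear_span_gaussian/linear_span_generator.
have := X_centered p.2; rewrite unlock => h.
by rewrite /Rintegral h mulr0.
Qed.

Lemma linear_span_gaussian_space : gaussian_space P linear_span.
Proof.
split => [f g [s ->] [s' ->]|c f [s ->]|f Lf].
- by exists (s ++ s'); apply/funext => w; rewrite big_cat.
- exists [seq (c * p.1, p.2) | p <- s]; apply/funext => w.
  by rewrite big_map mulr_sumr; apply: eq_bigr => p _; rewrite mulrA.
- by apply: is_gaussian_centered; [exact: linear_span_gaussian|exact: linear_span_mean].
Qed.

End linear_span.

Section near_zero.
Variable R : realType.

Lemma at_right0P (Q : R -> Prop) : (\forall h \near 0^'+, Q h) ->
  exists2 e : R, 0 < e & forall h, 0 < h <= e -> Q h.
Proof.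
move=> [e /= e0 he]; exists (e / 2); first by rewrite divr_gt0.
move=> h /andP[h0 hle]; apply: he => //=.
by rewrite sub0r normrN gtr0_norm//; lra.
Qed.

Variables (phi : R -> R) (theta : R).
Hypothesis phi_ge0 : forall r, 0 <= r -> 0 <= phi r.
Hypothesis phi_mono : forall r s, 0 <= r -> r <= s -> phi r <= phi s.
Hypothesis phi_regular : regularly_varying_at0 phi theta.

(** With ratio lam = 1 the hypothesis forces phi to be nonzero at arbitrarily small
arguments, and phi is monotone. *)
Lemma regularly_varying_gt0 r : 0 < r -> 0 < phi r.
Proof.
move=> r0; have : \forall h \near 0^'+, 2^-1 < phi (1 * h) / phi h.
  have := phi_regular ltr01; rewrite powR1 => /cvgr_gt; apply; lra.
move=> /at_right0P[e e0 he].
have m0 : 0 < Num.min r e by rewrite lt_min r0.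
have := he (Num.min r e); rewrite m0 ge_min lexx orbT => /(_ isT).
have [-> |n0 _] := eqVneq (phi (Num.min r e)) 0; first by rewrite invr0 mulr0; lra.
apply: (@lt_le_trans _ _ (phi (Num.min r e))).
  by rewrite lt_neqAle eq_sym n0 phi_ge0// ltW.
by apply: phi_mono; [exact: ltW|rewrite ge_min lexx].
Qed.

Lemma regularly_varying_doubling : exists2 kappa : R, 0 < kappa &
  \forall r \near 0^'+, phi r <= kappa * phi (r / 2).
Proof.
pose q : R := 2^-1 `^ theta; have q0 : 0 < q by exact: powR_gt0.
exists (2 / q); first exact: divr_gt0.
have h2 : 0 < 2^-1 :> R by [].
have : \forall h \near 0^'+, q / 2 < phi (2^-1 * h) / phi h.
  have := phi_regular h2; rewrite -/q => /cvgr_gt; apply; lra.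
apply: filterS2 (nbhs_right_gt 0) => r r0.
have p0 := regularly_varying_gt0 r0.
rewrite ltr_pdivlMr// mulrC => /ltW h.
by rewrite [_ / q * _]mulrAC ler_pdivlMr// (mulrC r); move: h; lra.
Qed.

End near_zero.

(** * The law of the iterated logarithm *)

Theorem theorem1p2 (R : realType) (d : measure_display) (T : measurableType d)
    (P : probability T R) (P_complete : measure_is_complete P)
    (N : nat) (N_gt0 : (0 < N)%N)
    (X : 'rV[R]_N -> {RV P >-> R})
    (X_gaussian : gaussian_field P X) (X_centered : centered_field P X)
    (X_continuous : forall w : T, continuous (fun t : 'rV[R]_N => X t w))
    (lo hi : 'rV[R]_N) (lo_hi : forall i, lo ord0 i < hi ord0 i)
    (t0 : 'rV[R]_N) (t0_I : box lo hi t0)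
    (phi : R -> R) (theta : R)
    (X_phi : asymp (globally (box lo hi `*` box lo hi))
      (fun ts => ('E_P[(fun w => (X ts.1 w - X ts.2 w) ^+ 2)%R] `^ 2^-1)%E)
      (fun ts => (phi (enorm (ts.1 - ts.2)))%:E))
    (phi_ge0 : forall r, 0 <= r -> 0 <= phi r)
    (phi_nondecreasing : forall r s, 0 <= r -> r <= s -> phi r <= phi s)
    (phi_continuous : {within `[0, +oo[, continuous phi})
    (theta_01 : 0 <= theta <= 1)
    (phi_regular : regularly_varying_at0 phi theta)
    (phi_integral : lesssim 0^'+
      (fun h => (\int[lebesgue_measure]_(r in `]0%R, 1%R])
                   (phi (h * r) / (r * Num.sqrt (ln (2 / r))))%R%:E)%E)
      (fun h => (phi h * Num.sqrt (ln (ln (1 / h))))%:E))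
    (phi_o1 : phi h * Num.sqrt (ln (ln (1 / h))) @[h --> 0^'+] --> 0)
    (n0 : nat) (n0_gt0 : (0 < n0)%N) (a : R) (a_gt1 : 1 < a)
    (t_ : nat -> 'rV[R]_N)
    (t_I : forall n, (n0 <= n)%N -> box lo hi (t_ n))
    (t_norm : forall n, (n0 <= n)%N -> enorm (t_ n - t0) = a ^- n)
    (C0 : R) (C0_gt0 : 0 < C0)
    (t_var : forall m n, (n0 <= n)%N -> (n < m)%N ->
      exists2 v : R,
        cond_variance P (X (t_ n) \- X t0) (X (t_ m) \- X t0) (cst v) &
        (C0%:E * 'V_P[(X (t_ n) \- X t0)%R] <= v%:E)%E) :
  exists K2 : R, 0 < K2 /\
    {ae P, forall w : T,
      ereal_sup [set (`|X t w - X t0 w| /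
                       (phi (enorm (t - t0)) *
                        Num.sqrt (ln (ln (1 / enorm (t - t0))))))%:E
                | t in [set t | box lo hi t /\ 0 < enorm (t - t0) <= h]]
        @[h --> 0^'+] --> K2%:E}.
Proof.
pose L := linear_span X.
have gL : gaussian_space P L := linear_span_gaussian_space X_gaussian X_centered.
have LX t : L (X t) := linear_span_generator X t.
have [LD LZ _] := gL.
have LB t s : L (fun w => X t w + -1 * X s w) by exact: (LD _ _ (LX _) (LZ _ _ (LX _))).
have phi_gt0 r : 0 < r -> 0 < phi r.
  exact: (regularly_varying_gt0 phi_ge0 phi_nondecreasing phi_regular).
have sqr_increment t s : ('E_P[(fun w => (X t w - X s w) ^+ 2)%R] =
    (\int[P]_w ((X t w - X s w) ^+ 2))%R%:E)%E.
  rewrite unlock fineK//; apply: integrable_fin_num => //.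
  have := gaussian_space_integrableM gL (LB t s) (LB t s).
  by apply: eq_integrable => // w _; rewrite /= mulN1r expr2.
have sqr_ge0 t s : 0 <= \int[P]_w ((X t w - X s w) ^+ 2).
  by apply: Rintegral_ge0 => w _; exact: sqr_ge0.
have [[C C_gt0 /= hC] [C' C'_gt0 /= hC']] := X_phi.
have var_le t s : box lo hi t -> box lo hi s ->
    \int[P]_w ((X t w - X s w) ^+ 2) <= (C * phi (enorm (t - s))) ^+ 2.
  move=> bt bs; have := hC (t, s) (conj bt bs).
  rewrite /= sqr_increment poweR_EFin powR12_sqrt// -EFinM lee_fin => h.
  by rewrite -[leLHS]sqr_sqrtr// ler_pXn2r ?nnegrE ?sqrtr_ge0// (le_trans (sqrtr_ge0 _) h).
have var_ge t s : box lo hi t -> box lo hi s ->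
    (C'^-1 * phi (enorm (t - s))) ^+ 2 <= \int[P]_w ((X t w - X s w) ^+ 2).
  move=> bt bs; have := hC' (t, s) (conj bt bs).
  rewrite /= sqr_increment poweR_EFin powR12_sqrt// -EFinM lee_fin => h.
  rewrite -[leRHS]sqr_sqrtr// ler_pXn2r ?nnegrE ?sqrtr_ge0//.
    by rewrite mulrC ler_pdivrMr// mulrC.
  by rewrite mulr_ge0 ?invr_ge0 ?(ltW C'_gt0)// phi_ge0// enorm_ge0.
have [kappa kappa_gt0 /at_right0P[h1 h1_gt0 doubling]] :=
  regularly_varying_doubling phi_ge0 phi_nondecreasing phi_regular.
have [C2 C2_gt0 /at_right0P[h2 h2_gt0 integral_le]] := phi_integral.
have [Q PQ] : exists Q, P (limsup_le (lil_ratio (X : _ -> T -> R) t0 phi)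
    (dyadic_ball lo hi t0) Q) = 1%E.
  apply: (exists_limsup_bound gL N_gt0 LX t0_I C_gt0 phi_gt0 phi_ge0
    phi_nondecreasing var_le kappa_gt0 (ltW C2_gt0) (h0 := Num.min h1 h2)).
  - by rewrite lt_min h1_gt0.
  - by move=> r /andP[r0 rh]; apply: doubling; rewrite r0 (le_trans rh)// ge_min lexx.
  - move=> h /andP[h0 hh]; rewrite EFinM; apply: integral_le.
    by rewrite h0 (le_trans hh)// ge_min lexx orbT.
(* The maximum covers the case C0 > 1. *)
pose rho := Num.sqrt (Num.max 0 (1 - C0)).
have rho_sqr : rho ^+ 2 = Num.max 0 (1 - C0) by rewrite sqr_sqrtr// le_max lexx.
have rho_lt1 : rho < 1.
  rewrite -sqrtr1 ltr_sqrt// gt_max ltr01/=; lra.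
have cov_le m n : (n0 <= n)%N -> (n < m)%N ->
     (\int[P]_w ((X (t_ n) w + -1 * X t0 w) * (X (t_ m) w + -1 * X t0 w))) ^+ 2 <=
     rho ^+ 2 * \int[P]_w ((X (t_ n) w - X t0 w) ^+ 2)
              * \int[P]_w ((X (t_ m) w - X t0 w) ^+ 2).
  move=> nn nm; have [v cv vle] := t_var m n nn nm.
  have XE k : X (t_ k) \- X t0 = (fun w => X (t_ k) w + -1 * X t0 w) :> (T -> R).
    by apply/funext => w; rewrite mulN1r.
  have VE : ('V_P[(X (t_ n) \- X t0)%R] =
      (\int[P]_w ((X (t_ n) w + -1 * X t0 w) * (X (t_ n) w + -1 * X t0 w)))%R%:E)%E.
    have E0 : ('E_P[(X (t_ n) \- X t0)%R] = 0)%E.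
      rewrite unlock XE -[LHS]fineK.
        congr (_%:E); exact: (linear_span_mean X_gaussian X_centered (LB _ _)).
      apply: integrable_fin_num => //; apply: is_gaussian_integrable.
      exact: (linear_span_gaussian X_gaussian (LB _ _)).
    rewrite /variance unlock E0 unlock XE fineK; last first.
      apply: integrable_fin_num => //; exact: (gaussian_space_integrableM gL).
    by apply: eq_integral => w _; rewrite mulrfctE /= subr0.
  rewrite !XE in cv; rewrite VE -EFinM lee_fin in vle.
  have := cond_variance_correlation gL (LB _ _) (LB _ _) cv vle.
  rewrite !(var_increment P (X : _ -> T -> R)) => /le_trans; apply.
  rewrite ler_wpM2r// ler_wpM2r// rho_sqr le_max lexx orbT//.
have c_gt0 : 0 < C'^-1 * (1 - rho) / 16.
  by rewrite divr_gt0// mulr_gt0 ?invr_gt0// subr_gt0.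
apply: (iterated_logarithm_law gL N_gt0 LX X_continuous t0_I phi_gt0
  phi_continuous var_le c_gt0 PQ).
apply: (limsup_event_null gL N_gt0 LX X_continuous t0_I phi_gt0 phi_continuous
  _ _ rho_lt1 a_gt1 t_I t_norm _ cov_le); first by rewrite invr_gt0.
  exact: sqrtr_ge0.
by move=> n nn; rewrite -t_norm//; exact: var_ge (t_I n nn) t0_I.
Qed.
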